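(* There is an absolute constant $C>0$ such that the following holds. Consider the system $x_{t+1}=A^*x_t+w_t$, $t=0,1,\dots,T-1$, with $A^*\in\mathbb{R}^{d\times d}$ and random $x_0,w_0,\dots,w_{T-1}\in\mathbb{R}^d$, satisfying the following assumptions listed in the context: (Operator norm), (Maximum sub-Gaussian norm) with constant $\sigma_w>0$, (Probabilistic attack) with attack probability $0<p<1$, (Non-degeneracy) with constant $\lambda>0$, and (Sign-restricted disturbances). Let $\tau=\sigma_w/\lambda$ and let $\delta\in(0,1]$. If $$T\ \ge\ C\cdot\frac{d\cdot\max\{1,\tau^{10}\}}{p(1-p)^2(1-\|A^*\|_2)^2}\cdot\max\left\{1,\ \log\left(\frac{d\cdot\tau}{\delta(1-p)(1-\|A^*\|_2)}\right)\right\},$$ then, with probability at least $1-\delta$, the $l_1$-norm estimator at time $T$ achieves exact recovery, i.e. $A^*$ is the unique solution of $$\min_{A\in\mathbb{R}^{d\times d}}\ \sum_{t=0}^{T-1}\|x_{t+1}-Ax_t\|_1 .$$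
   Context: Norms. $\|A\|_2$ is the operator norm of a matrix; $\|\cdot\|_1,\|\cdot\|_2$ are the $l_1$- and $l_2$-norms of vectors; $\succeq$ is the positive semidefinite order; $\circ$ is the entrywise product of vectors. Sub-Gaussian variables. A scalar random variable $w$ is sub-Gaussian if $\mathbb{E}[\exp(w^2/c^2)]\le 2$ for some $c>0$, and its norm is $\|w\|_{\psi_2}=\inf\{c>0:\mathbb{E}[\exp(w^2/c^2)]\le 2\}$. A random vector $w\in\mathbb{R}^d$ is sub-Gaussian if $w^Tx$ is a sub-Gaussian scalar for every $x\in\mathbb{R}^d$, and $\|w\|_{\psi_2}=\sup_{\|x\|_2\le 1}\|w^Tx\|_{\psi_2}$. ''Conditioned on $\mathcal{F}$'' means that expectations are replaced by conditional expectations given $\mathcal{F}$. Filtration. $\mathcal{F}_t=\sigma\{x_0,w_0,\dots,w_{t-1}\}$. The distribution of $w_t$ may depend on $\mathcal{F}_t$ (the disturbance may be chosen adversarially from past information), and $\mathbb{E}[w_t\mid\mathcal{F}_t]$ need not be zero. Assumptions. (Operator norm) $\|A^*\|_2<1$. (Maximum sub-Gaussian norm) There is $\sigma_w>0$ with $\|x_0\|_{\psi_2}\le\sigma_w$ and, for all $t\ge 0$, $\|w_t\|_{\psi_2}\le\sigma_w$ conditioned on $\mathcal{F}_t$ (for every $\mathcal{F}_t$). (Probabilistic attack) At each time $t\ge0$, conditionally on $\mathcal{F}_t$ (for every $\mathcal{F}_t$), the system is not under attack with probability $1-p$, in which case $w_t$ is identically zero: $\mathbb{P}(w_t\equiv 0\mid\mathcal{F}_t)=1-p$;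 with probability $p$ it is under attack. The set of attack times is $\mathcal{K}_T=\{0\le t\le T-1: w_t\text{ is not identically zero}\}$. Conditions imposed below ''at attack times'' concern the distribution of $w_t$ given $\mathcal{F}_t$ and given that $t$ is an attack time. (Non-degeneracy) There is $\lambda>0$ such that for every $x\in\mathbb{R}^d$, $\mathbb{E}[(x+w_t)(x+w_t)^T\mid\mathcal{F}_t]\succeq\lambda^2 I_d$ for all $t\in\mathcal{K}_T$ (i.e. at attack times) and all $\mathcal{F}_t$. (Sign-restricted disturbances) At attack times, $w_t=\alpha_t\circ\beta_t$, where, conditioned on $\mathcal{F}_t$, $\alpha_t=[\alpha_t^1,\dots,\alpha_t^d]^T$ is a sub-Gaussian vector with $\mathbb{P}(\alpha_t^i>0\mid\mathcal{F}_t)=\mathbb{P}(\alpha_t^i<0\mid\mathcal{F}_t)$ for all $i=1,\dots,d$, and $\beta_t=[\beta_t^1,\dots,\beta_t^d]^T$ is a random vector with $0<\beta_t^i<\infty$ for all $i=1,\dots,d$.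
   Formalization: The bound of w_t's sub-Gaussian norm by sigma_w is required conditionally on F_t and also conditionally on F_t given that t is an attack time; with the bound given F_t alone the claim fails for every absolute constant C as p tends to 0. *)

(* Defs.v *)
(* MathComp / MathComp-Analysis *)
From HB Require Import structures.
From mathcomp Require Import all_boot all_order all_algebra.
From mathcomp Require Import all_classical all_reals all_analysis.
From mathcomp Require Import measurable_realfun.

Set Implicit Arguments.
Unset Strict Implicit.
Unset Printing Implicit Defensive.

Import Order.TTheory GRing.Theory Num.Theory.
Import numFieldNormedType.Exports.

Local Open Scope classical_set_scope.
Local Open Scope ring_scope.

(* Column vectors carry the product (= Borel) sigma-algebra, the one generated
   by the coordinates. *)
Section measurable_cV.
Context (R : realType) (n : nat).

Let coord (i : 'I_n) (v : 'cV[R]_n) : R := v i ord0.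

Let cV_set0 : g_sigma_preimage coord set0.
Proof. exact: sigma_algebra0. Qed.

Let cV_setC A : g_sigma_preimage coord A -> g_sigma_preimage coord (~` A).
Proof. exact: sigma_algebraC. Qed.

Let cV_bigcup (F : (set 'cV[R]_n)^nat) :
  (forall i, g_sigma_preimage coord (F i)) ->
  g_sigma_preimage coord (\bigcup_i F i).
Proof. exact: sigma_algebra_bigcup. Qed.

Definition measure_cV_display : measure_display.
Proof. exact: (measure_tuple_display default_measure_display). Qed.

HB.instance Definition _ := @isMeasurable.Build measure_cV_display
  'cV[R]_n (g_sigma_preimage coord) cV_set0 cV_setC cV_bigcup.

End measurable_cV.

Section vectors.
Context {R : realType} {d : nat}.
Implicit Types (u v : 'cV[R]_d) (A B : 'M[R]_d).

Definition dotv u v : R := \sum_i u i ord0 * v i ord0.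

Definition norm1 v : R := \sum_i `|v i ord0|.

Definition norm2 v : R := Num.sqrt (\sum_i v i ord0 ^+ 2).

Definition opnorm2 A : R :=
  sup [set norm2 (A *m v) | v in [set v | norm2 v <= 1]].

Definition hadamard u v : 'cV[R]_d := \col_i (u i ord0 * v i ord0).

Definition psd A : Prop := A^T = A /\ forall v, 0 <= dotv v (A *m v).

Definition loewner_le A B : Prop := psd (B - A).

End vectors.

(* These are stated for an arbitrary measure: with [mu] the ambient probability
   they are the unconditional notions, with [mu] a regular conditional law they
   are the conditional ones. *)
Section sub_gaussian.
Context {R : realType} {d0} {S : measurableType d0}.
Variable mu : {measure set S -> \bar R}.

Definition psi2_bound (f : S -> R) (c : R) : Prop :=
  0 < c /\ (\int[mu]_s (expR (f s ^+ 2 / c ^+ 2))%:E <= 2%:E)%E.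

Definition sub_gaussian (f : S -> R) : Prop := exists c, psi2_bound f c.

(* Equal to +oo when [f] is not sub-Gaussian. *)
Definition psi2_norm (f : S -> R) : \bar R :=
  ereal_inf [set c%:E | c in psi2_bound f].

Context {d : nat}.

Definition sub_gaussianv (X : S -> 'cV[R]_d) : Prop :=
  forall u, sub_gaussian (fun s => dotv (X s) u).

Definition psi2_normv (X : S -> 'cV[R]_d) : \bar R :=
  ereal_sup [set psi2_norm (fun s => dotv (X s) u) | u in
             [set u : 'cV[R]_d | norm2 u <= 1]].

End sub_gaussian.

Section conditioning.
Context {R : realType} {d0} {Omega : measurableType d0}.
Variable P : probability Omega R.

(* [G] is a generating family; the conditioning sigma-algebra is [<<s G >>]. *)
Variable G : set (set Omega).

(* [g] is a version of P(E | <<s G >>). *)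
Definition is_cond_prob (E : set Omega) (g : Omega -> \bar R) : Prop :=
  measurable_fun setT (g : g_sigma_algebraType G -> \bar R) /\
  forall A, <<s G >> A -> P (A `&` E) = (\int[P]_(omega in A) g omega)%E.

(* [k] is a regular conditional law of [X] given <<s G >> and given the event
   [E]: under P(. | E), [k omega] is the conditional law of [X] given
   <<s G >>. For [E = setT] it is the conditional law of [X] given <<s G >>.
   On vectors such a kernel always exists (if P(E) > 0), and it is unique up to
   a null set if P(E | <<s G >>) > 0 almost surely. *)
Definition is_cond_law d (E : set Omega) (X : Omega -> 'cV[R]_d)
    (k : R.-pker (g_sigma_algebraType G) ~> 'cV[R]_d) : Prop :=
  forall A B, <<s G >> A -> measurable B ->
    P (A `&` E `&` X @^-1` B) = (\int[P]_(omega in A `&` E) k omega B)%E.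

(* "Conditionally on <<s G >> and on [E], the law of [X] satisfies [Q], for
   (almost) every realization of <<s G >>." *)
Definition cond_law_sat d (E : set Omega) (X : Omega -> 'cV[R]_d)
    (Q : {measure set 'cV[R]_d -> \bar R} -> Prop) : Prop :=
  exists k : R.-pker (g_sigma_algebraType G) ~> 'cV[R]_d,
    is_cond_law E X k /\ {ae P, forall omega, Q (k omega)}.

End conditioning.

Section system.
Context {R : realType} {d0} {Omega : measurableType d0}.
Variable P : probability Omega R.
Context {d : nat}.
Variables (x0 : Omega -> 'cV[R]_d) (w : nat -> Omega -> 'cV[R]_d).

Fixpoint state (A : 'M[R]_d) (t : nat) (omega : Omega) : 'cV[R]_d :=
  if t is t'.+1 then A *m state A t' omega + w t' omega else x0 omega.

(* Generators of F_t = sigma(x_0, w_0, ..., w_(t-1)). *)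
Definition history (t : nat) : set (set Omega) :=
  [set x0 @^-1` B | B in measurable] `|`
  [set A | exists2 s, (s < t)%N & [set w s @^-1` B | B in measurable] A].

Definition l1_loss (A : 'M[R]_d) (T : nat) (omega : Omega) (A' : 'M[R]_d) : R :=
  \sum_(t < T) norm1 (state A t.+1 omega - A' *m state A t omega).

(* [attack t] is the event that the system is under attack at
   time [t]. It is only required that [w t] vanishes off [attack t]; one may take
   [attack t := [set omega | w t omega != 0]], but a disturbance drawn at an
   attack time is also allowed to take the value 0. *)
Variables (attack : nat -> set Omega) (T : nat).

Definition probabilistic_attack (p : R) : Prop :=
  forall t, (t < T)%N ->
    [/\ measurable (attack t),
        forall omega, ~ attack t omega -> w t omega = 0
      & is_cond_prob P (history t) (~` attack t) (cst (1 - p)%:E)].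

(* The bound on [w t] holds conditionally on F_t, at attack times included.
   The latter matters: from the bound given F_t alone the law at attack times
   could only be controlled up to a factor log(1/p), and the sample size
   considered here would then be insufficient for small p. (Off attack times
   [w t] is 0, so the bound at attack times implies the one given F_t.) *)
Definition max_sub_gaussian (sigma : R) : Prop :=
  (psi2_normv P x0 <= sigma%:E)%E /\
  forall t, (t < T)%N -> forall E, E = setT \/ E = attack t ->
    cond_law_sat P (history t) E (w t)
      (fun mu => psi2_normv mu id <= sigma%:E)%E.

Definition second_moment (mu : {measure set 'cV[R]_d -> \bar R})
    (x : 'cV[R]_d) : 'M[R]_d :=
  \matrix_(i, j) \int[mu]_y ((x + y) i ord0 * (x + y) j ord0).

Definition non_degenerate (lambda : R) : Prop :=
  forall t, (t < T)%N ->
    cond_law_sat P (history t) (attack t) (w t)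
      (fun mu => forall x, loewner_le (lambda ^+ 2)%:M (second_moment mu x)).

Definition sign_restricted : Prop :=
  exists alpha beta : nat -> Omega -> 'cV[R]_d,
  forall t, (t < T)%N ->
    [/\ measurable_fun setT (alpha t), measurable_fun setT (beta t),
        forall omega, attack t omega ->
          w t omega = hadamard (alpha t omega) (beta t omega) /\
          forall i, 0 < beta t omega i ord0
      & cond_law_sat P (history t) (attack t) (alpha t)
          (fun mu => sub_gaussianv mu id /\
             forall i, mu [set a | 0 < a i ord0] = mu [set a | a i ord0 < 0])].

End system.

Definition argmin {R : realType} {U : Type} (f : U -> R) : set U :=
  [set a | forall b, f a <= f b].

(* Main.v *)
(* Fix a row i and a direction z, and put a_t = <x_t, z>. Moving row i of A^* by z
   changes the loss by sum_t (|w_t^i - a_t| - |w_t^i|), which is at least the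
   sum of its linearized terms: |a_t| when w_t^i = 0, which holds off attack times,
   and -/+ a_t according to the sign of w_t^i otherwise. Given F_t the signs are
   balanced, so the conditional mean of a term is at least (1-p) |a_t|, and an
   exponential supermartingale bounds the linearized loss below by
   (1-p) sum_t |a_t| minus a multiple of sum_t a_t^2, up to a fluctuation.

   Two more supermartingales control these sums. Non-degeneracy and the
   fourth-moment bound give a small-ball estimate at attack times, whence
   sum_t |a_t| >~ p T lambda / tau^4. Stability, by convexity over the expansion
   of a_t in x_0, w_0, w_1, ..., gives sum_t a_t^2 <~ p T sigma^2 / (1 - |A^*|)^2.
   Hence for fixed (i, z) the linearized loss is positive, by a definite margin, off
   an event of exponentially small probability.

   The linearized loss is positively homogeneous in z, so it is enough to consider
   |z|_oo = 1; it is Lipschitz with constant sum_t |x_t|, which Markov's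
   inequality bounds polynomially. A union bound over a grid of polynomial mesh then
   treats all directions, and yields the factor d log(d tau / ...). *)
From HB Require Import structures.
Require Import Defs.
From mathcomp Require Import all_boot all_order all_algebra.
From mathcomp Require Import all_classical all_reals all_analysis.
From mathcomp Require Import measurable_realfun ring lra.

Set Implicit Arguments.
Unset Strict Implicit.
Unset Printing Implicit Defensive.

Import Order.TTheory GRing.Theory Num.Theory.
Import numFieldNormedType.Exports.

Local Open Scope classical_set_scope.
Local Open Scope ring_scope.


(** The disturbances are dependent and may have nonzero mean; only their laws given the past are
    constrained. Each one-step estimate is therefore stated for the integral of a function of [w t]
    times an arbitrary nonnegative weight [H] measurable for the past. Taking for [H] the
    exponential accumulated so far makes it one step of a supermartingale. Attacks are rare when [p]
    is small, so a step may lose only a factor [1 + p] and gains a multiple of [p]: every step is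
    split into attack and no attack. Excitation and energy are then both of order [p T], and [p]
    enters the sample size to the first power. The small-ball bound must hold for an unbounded
    predictable part of [a_t], hence a scale that depends on the past. Put
    [k = lambda^4 / (4096 s^4)]. Excitation is of order [p T lambda k] and energy of order
    [p T s^2 / (1 - r)^2]; optimizing the exponential parameter gives an exponent of order
    [(1 - p)^2] times the square of the first over the second, that is [p T (1 - p)^2 (1 - r)^2
    lambda^2 k^2 / s^2]. This is where the tenth power of [tau] comes from. *)

Section conditional_law.
Context {R : realType} {d0} {Omega : measurableType d0}.
Variables (P : probability Omega R) (G : set (set Omega)).
Hypothesis mG : <<s G >> `<=` measurable.
Local Open Scope ereal_scope.

Lemma measurable_fun_sub {d1} {U : measurableType d1} (f : Omega -> U) :
  measurable_fun setT (f : g_sigma_algebraType G -> U) -> measurable_fun setT f.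
Proof. by move=> mf _ B mB; apply: mG; exact: mf. Qed.

(** * Disintegration along a conditional law *)

Section disintegration.
Context {d1} {U : measurableType d1}.
Variables (E : set Omega) (X : Omega -> U).
Variable k : R.-pker (g_sigma_algebraType G) ~> U.
Hypotheses (mE : measurable E) (mX : measurable_fun setT X).
Hypothesis lawX : forall A B, <<s G >> A -> measurable B ->
  P (A `&` E `&` X @^-1` B) = \int[P]_(w in A `&` E) k w B.

Let graph (w : Omega) : g_sigma_algebraType G * U := (w, X w).

Let measurable_graph : measurable_fun setT graph.
Proof.
apply: measurable_fun_pair; last exact: mX.
move=> _ B mB; rewrite setTI; exact: mG.
Qed.

Let mk (D : set (g_sigma_algebraType G * U)) : measurable D ->
  measurable_fun setT ((fun w => k w (xsection D w)) : Omega -> \bar R).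
Proof.
move=> mD; apply: measurable_fun_sub.
apply: measurable_fun_xsection_finite_kernel; exact: mem_set.
Qed.

Let mgraph (D : set (g_sigma_algebraType G * U)) :
  measurable D -> measurable (graph @^-1` D).
Proof.
by move=> mD; rewrite -[X in measurable X]setTI; exact: measurable_graph.
Qed.

(** For rectangles this is [lawX], and rectangles form a pi-system generating the product
    sigma-algebra, so Dynkin induction applies. The complement case subtracts two measures, which is
    legitimate because [P] is finite. *)
Let law_xsection (C : set (g_sigma_algebraType G * U)) : measurable C ->
  P (E `&` graph @^-1` C) = \int[P]_(w in E) k w (xsection C w).
Proof.
rewrite measurable_prod_measurableType => mC.
have PE : P E = \int[P]_(w in E) cst 1 w by rewrite integral_cst// mul1e.
move: C mC; apply: dynkin_induction.
- by rewrite measurable_prod_measurableType.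
- move=> _ _ [A1 mA1 [B1 mB1 <-]] [A2 mA2 [B2 mB2 <-]].
  exists (A1 `&` A2); first exact: measurableI.
  by exists (B1 `&` B2); [exact: measurableI|rewrite setXI].
- rewrite preimage_setT setIT PE; apply: eq_integral => w _.
  by rewrite -(@prob_kernel _ _ _ _ _ k w); congr (k w _);
    apply/seteqP; split => // y _; rewrite /xsection /= in_setT.
- move=> _ [A mA [B mB <-]].
  have -> : E `&` graph @^-1` (A `*` B) = A `&` E `&` X @^-1` B.
    by apply/seteqP; split => w /=; rewrite /graph /=; tauto.
  rewrite lawX// integral_mkcondl; apply: eq_integral => w _.
  rewrite patchE; case: ifPn => wA; first by rewrite in_xsectionX.
  by rewrite notin_xsectionX// measure0.
- move=> S mS PS.
  have fS : P (E `&` graph @^-1` S) \is a fin_num.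
    by apply: fin_num_measure; apply: measurableI => //; exact: mgraph.
  rewrite -[LHS](addeK _ fS) -[RHS](addeK _ fS); congr (_ - _).
  rewrite -measureU; last 3 first.
  + by apply: measurableI => //; apply: mgraph; exact: measurableC.
  + by apply: measurableI => //; exact: mgraph.
  + by apply/seteqP; split => // w /=; rewrite /graph/=; tauto.
  rewrite -setIUr -preimage_setU setvU preimage_setT setIT.
  rewrite [in RHS]PS.
  apply: (eq_trans PE).
  rewrite -ge0_integralD//; last 2 first.
  + by apply/measurable_funTS/mk; exact: measurableC.
  + by apply/measurable_funTS/mk.
  apply: eq_integral => w _.
  rewrite -measureU; last 3 first.
  + by apply: measurable_xsection; exact: measurableC.
  + exact: measurable_xsection.
  + by apply/seteqP; split => // y /=; rewrite /xsection /= !inE /=; tauto.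
  rewrite -(@prob_kernel _ _ _ _ _ k w); congr (k w _).
  apply/seteqP; split => // y _; rewrite /xsection /= !inE /=.
  by have [?|?] := pselect (S (w, y)); tauto.
- move=> F mF tF PF.
  rewrite preimage_bigcup setI_bigcupr measure_semi_bigcup//; last 3 first.
  + by move=> i; apply: measurableI => //; exact: mgraph.
  + apply: trivIset_setIl => i j _ _ [w [wi wj]].
    by apply: (tF i j) => //; exists (graph w).
  + apply: bigcup_measurable => i _.
    by apply: measurableI => //; exact: mgraph.
  transitivity (\sum_(n <oo) \int[P]_(w in E) k w (xsection (F n) w)).
    by apply: eq_eseriesr => n _; exact: PF.
  rewrite -integral_nneseries//; last first.
    by move=> n; apply/measurable_funTS/mk.
  apply: eq_integral => w _; rewrite xsection_bigcup measure_semi_bigcup//.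
  + by move=> i; exact: measurable_xsection.
  + exact: trivIset_xsection.
  + by apply: bigcup_measurable => i _; exact: measurable_xsection.
Qed.


Import HBNNSimple.

Let disint_nnsfun (h : {nnsfun (g_sigma_algebraType G * U) >-> R}) :
  \int[P]_(w in E) (h (graph w))%:E =
  \int[P]_(w in E) \int[k w]_y (h (w, y))%:E.
Proof.
pose A (r : R) : set (g_sigma_algebraType G * U) := h @^-1` [set r].
(* Level sets at negative values are empty; this supplies the nonnegativity needed to exchange sum
   and integral at every [r]. *)
have A0 (r : R) : (r < 0)%R -> A r = set0.
  by move=> r0; rewrite /A preimage_nnfun0.
have mA r : measurable (A r) by rewrite /A.
have mxA r w : measurable (xsection (A r) w) by exact: measurable_xsection.
have rA0 (r : R) w : 0 <= r%:E * k w (xsection (A r) w).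
  have [r0|r0] := leP 0%R r; first by rewrite mule_ge0// lee_fin.
  by rewrite A0// xsection0 measure0 mule0.
have inner w : \int[k w]_y (h (w, y))%:E =
    \sum_(r \in range h) r%:E * k w (xsection (A r) w).
  transitivity (\int[k w]_y
      \sum_(r \in range h) (r * \1_(xsection (A r) w) y)%:E).
    apply: eq_integral => y _; rewrite fimfunE -fsumEFin//.
    by apply: eq_fsbigr => r _; rewrite !indicE mem_xsection.
  rewrite ge0_integral_fsum//; last 2 first.
  - by move=> r; apply/measurable_EFinP/measurable_funM.
  - move=> r y _; have [r0|r0] := leP 0%R r.
      by rewrite lee_fin mulr_ge0.
    by rewrite A0// xsection0 indic0 mulr0.
  apply: eq_fsbigr => r _.
  rewrite (integralZl_indic _ (fun r => xsection (A r) w))//.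
    by rewrite integral_indic// setIT.
  by move=> r0; rewrite A0// xsection0.
under [RHS]eq_integral do rewrite inner.
rewrite [RHS]ge0_integral_fsum//; last first.
  by move=> r; apply/measurable_funTS/measurable_funeM/mk.
transitivity (\int[P]_(w in E)
    \sum_(r \in range h) (r * \1_(graph @^-1` (A r)) w)%:E).
  by apply: eq_integral => w _; rewrite fimfunE -fsumEFin.
rewrite ge0_integral_fsum//; last 2 first.
- move=> r; apply/measurable_funTS/measurable_EFinP/measurable_funM => //.
  by apply: measurable_indic; exact: mgraph.
- move=> r y _; have [r0|r0] := leP 0%R r.
    by rewrite lee_fin mulr_ge0.
  by rewrite A0// preimage_set0 indic0 mulr0.
apply: eq_fsbigr => r _.
rewrite (integralZl_indic _ (fun r => graph @^-1` (A r)))//; last 2 first.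
- by move=> r0; rewrite A0// preimage_set0.
- exact: mgraph.
rewrite integral_indic//; last exact: mgraph.
have [r0|r0] := leP 0%R r; last first.
  rewrite A0// preimage_set0 set0I measure0 mule0.
  by rewrite integral0_eq// => w _; rewrite xsection0 measure0 mule0.
rewrite ge0_integralZl//; last exact/measurable_funTS/mk.
by rewrite setIC; congr (_ * _); exact: law_xsection.
Qed.

(** The freezing principle: what the past determines is held constant while [X] is integrated
    against its conditional law. The case of simple functions passes to the limit by monotone
    convergence on both sides. *)
Lemma disintegration (f : g_sigma_algebraType G * U -> \bar R) :
  measurable_fun setT f -> (forall z, 0 <= f z) ->
  \int[P]_(w in E) f (w, X w) = \int[P]_(w in E) \int[k w]_y f (w, y).
Proof.
move=> mf f0; pose f_ := nnsfun_approx measurableT mf.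
have fE z : f z = lim ((f_ n z)%:E @[n --> \oo]).
  by apply/esym/cvg_lim => //; exact: cvg_nnsfun_approx.
have mfy n w : measurable_fun setT (fun y => (f_ n (w, y))%:E : \bar R).
  by apply/measurable_EFinP; apply: measurableT_comp.
have nd z : {homo (fun n => (f_ n z)%:E : \bar R) : m n / (m <= n)%N >-> m <= n}.
  by move=> m n mn; rewrite lee_fin; exact/lefP/nd_nnsfun_approx.
transitivity (lim (\int[P]_(w in E) (f_ n (graph w))%:E @[n --> \oo])).
  rewrite -monotone_convergence//; last 2 first.
  - by move=> n; apply/measurable_funTS/measurable_EFinP/measurableT_comp.
  - by move=> n w _; rewrite lee_fin.
  by apply: eq_integral => w _; exact: fE.
under eq_fun do rewrite disint_nnsfun.
rewrite -monotone_convergence//; last 3 first.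
- move=> n; apply/measurable_funTS/measurable_fun_sub.
  apply: (measurable_fun_integral_finite_kernel (fun z => (f_ n z)%:E)) => //.
  + by move=> z; rewrite lee_fin.
  + exact/measurable_EFinP.
- by move=> n w _; apply: integral_ge0 => y _; rewrite lee_fin.
- move=> w _ m n mn; apply: ge0_le_integral => //.
  + by move=> y _; rewrite lee_fin.
  + by move=> y _; exact: nd.
apply: eq_integral => w _; rewrite -monotone_convergence//.
- by apply: eq_integral => y _; rewrite fE.
- by move=> n y _; rewrite lee_fin.
Qed.

End disintegration.

Lemma ge0_integral_mrestr (E : set Omega) (mE : measurable E)
    (f : Omega -> \bar R) : measurable_fun setT f -> (forall w, 0 <= f w) ->
  \int[mrestr P mE]_w f w = \int[P]_(w in E) f w.
Proof.
move=> mf f0; rewrite -(setUv E) ge0_integral_setU//; last 3 first.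
- exact: measurableC.
- by rewrite setUv.
- exact/disj_setPCl.
rewrite [X in _ + X](_ : _ = 0) ?adde0; last first.
  rewrite null_set_integral//; [exact: measurableC|exact: measurable_funTS|].
  by rewrite /= /mrestr setICl measure0.
by apply: eq_measure_integral => A mA AE; rewrite /= /mrestr setIidl.
Qed.

(** Two measures on [<<s G >>] are compared: the image of [P] restricted to [E], and [p] times the
    image of [P]. The third hypothesis says that they coincide, so every integrand measurable for
    [<<s G >>] has the same integral against both. *)
Lemma integral_indep (E : set Omega) (p : R) (f : Omega -> \bar R) :
  measurable E -> (0 <= p)%R ->
  (forall A, <<s G >> A -> P (A `&` E) = p%:E * P A) ->
  measurable_fun setT (f : g_sigma_algebraType G -> \bar R) ->
  (forall w, 0 <= f w) ->
  \int[P]_(w in E) f w = p%:E * \int[P]_w f w.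
Proof.
move=> mE p0 hE mf f0; pose i : Omega -> g_sigma_algebraType G := id.
have mi : measurable_fun setT i by move=> _ B mB; rewrite setTI; exact: mG.
pose push (mu : {measure set Omega -> \bar R}) :
    {measure set (g_sigma_algebraType G) -> \bar R} :=
  measure_function_pushforward__canonical__measure_function_Measure mu mi.
have -> : \int[P]_(w in E) f w = \int[push (mrestr P mE)]_w f w.
  rewrite ge0_integral_pushforward// preimage_setT ge0_integral_mrestr//.
  exact: measurable_fun_sub.
transitivity (\int[mscale (NngNum p0) (push P)]_w f w).
  by apply: eq_measure_integral => A mA _; exact: hE.
by rewrite ge0_integral_mscale//= ge0_integral_pushforward// preimage_setT.
Qed.

End conditional_law.

Section vector_measurability.
Context {R : realType} {n : nat}.

Lemma measurable_coord (i : 'I_n) :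
  measurable_fun setT (fun v : 'cV[R]_n => v i ord0).
Proof.
move=> _ B mB; rewrite setTI; apply: sub_sigma_algebra.
rewrite -bigcup_seq; exists i => /=; first by rewrite mem_index_enum.
by exists B => //; rewrite setTI.
Qed.

Lemma measurable_fun_cV {d1} {U : measurableType d1} (f : U -> 'cV[R]_n) :
  (forall i, measurable_fun setT (fun x => f x i ord0)) -> measurable_fun setT f.
Proof.
move=> mf; apply: (measurability (\big[setU/set0]_(i < n)
  preimage_set_system setT (fun v : 'cV[R]_n => v i ord0) measurable)) => //.
move=> _ [B + <-].
rewrite -bigcup_seq => -[i /= _ [C mC <-]]; rewrite !setTI.
by rewrite -[X in measurable X]setTI; exact: mf.
Qed.

Lemma measurable_dotv (z : 'cV[R]_n) : measurable_fun setT (dotv ^~ z).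
Proof.
by apply: measurable_sum => i; apply: measurable_funM => //; exact: measurable_coord.
Qed.

End vector_measurability.

(** * Euclidean norm and operator norm *)

Section euclidean.
Context {R : realType} {d : nat}.
Implicit Types (u v z : 'cV[R]_d) (A : 'M[R]_d) (a : R).

Lemma dotvC u v : dotv u v = dotv v u.
Proof. by apply: eq_bigr => i _; rewrite mulrC. Qed.

Lemma dotvDl u v z : dotv (u + v) z = dotv u z + dotv v z.
Proof. by rewrite -big_split; apply: eq_bigr => i _; rewrite /= mxE mulrDl. Qed.

Lemma dotvZl a u v : dotv (a *: u) v = a * dotv u v.
Proof. by rewrite mulr_sumr; apply: eq_bigr => i _; rewrite mxE mulrA. Qed.

Lemma dotvNl u v : dotv (- u) v = - dotv u v.
Proof. by rewrite -scaleN1r dotvZl mulN1r. Qed.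

Lemma dotvDr u v z : dotv u (v + z) = dotv u v + dotv u z.
Proof. by rewrite dotvC dotvDl !(dotvC u). Qed.

Lemma dotvZr a u v : dotv u (a *: v) = a * dotv u v.
Proof. by rewrite dotvC dotvZl dotvC. Qed.

Lemma dotv0l v : dotv 0 v = 0.
Proof. by rewrite -(scale0r 0) dotvZl mul0r. Qed.

Lemma dotvE u v : dotv u v = (u^T *m v) ord0 ord0.
Proof. by rewrite mxE; apply: eq_bigr => i _; rewrite mxE. Qed.

Lemma dotv_mulmx A u v : dotv (A *m u) v = dotv u (A^T *m v).
Proof. by rewrite !dotvE trmx_mul mulmxA. Qed.

Lemma norm2_ge0 v : 0 <= norm2 v. Proof. exact: sqrtr_ge0. Qed.

Lemma sqr_norm2 v : norm2 v ^+ 2 = dotv v v.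
Proof.
rewrite sqr_sqrtr; last by apply: sumr_ge0 => i _; exact: sqr_ge0.
by apply: eq_bigr => i _; rewrite expr2.
Qed.

Lemma norm2_eq0 v : (norm2 v == 0) = (v == 0).
Proof.
apply/idP/eqP => [|->]; last first.
  by rewrite -sqrf_eq0 sqr_norm2 dotv0l.
rewrite -sqrf_eq0 sqr_norm2 psumr_eq0; last first.
  by move=> i _; rewrite -expr2 sqr_ge0.
move=> /allP v0; apply/colP => i; rewrite mxE.
by have := v0 i (mem_index_enum i); rewrite mulf_eq0 orbb => /eqP.
Qed.

Lemma norm2Z a v : norm2 (a *: v) = `|a| * norm2 v.
Proof.
apply/eqP; rewrite -(eqrXn2 (n := 2))// ?mulr_ge0 ?norm2_ge0//.
by rewrite exprMn !sqr_norm2 dotvZl dotvZr mulrA real_normK ?num_real ?expr2.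
Qed.

Lemma dotv_le u v : dotv u v <= norm2 u * norm2 v.
Proof.
have [->|u0] := eqVneq u 0; first by rewrite dotv0l mulr_ge0 ?norm2_ge0.
have [->|v0] := eqVneq v 0.
  by rewrite dotvC dotv0l mulr_ge0 ?norm2_ge0.
have nu : 0 < norm2 u by rewrite lt_neqAle norm2_ge0 eq_sym norm2_eq0 u0.
have nv : 0 < norm2 v by rewrite lt_neqAle norm2_ge0 eq_sym norm2_eq0 v0.
have : 0 <= norm2 (norm2 v *: u - norm2 u *: v) ^+ 2 by exact: sqr_ge0.
rewrite sqr_norm2 !(dotvDl, dotvDr, dotvNl, dotvZl, dotvZr).
rewrite -scaleN1r !(dotvDl, dotvDr, dotvNl, dotvZl, dotvZr).
rewrite -!sqr_norm2 (dotvC v u) => h.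
have : 0 <= (norm2 u * norm2 v) * (norm2 u * norm2 v - dotv u v) by nra.
by rewrite pmulr_rge0 ?mulr_gt0// subr_ge0.
Qed.

Lemma dotv_abs_le u v : `|dotv u v| <= norm2 u * norm2 v.
Proof.
rewrite ler_norml dotv_le andbT lerNl -dotvNl.
by rewrite (le_trans (dotv_le _ _))// -scaleN1r norm2Z normrN1 mul1r.
Qed.

Lemma norm2D u v : norm2 (u + v) <= norm2 u + norm2 v.
Proof.
rewrite -(ler_pXn2r (n := 2)) ?nnegrE ?addr_ge0 ?norm2_ge0//.
rewrite sqr_norm2 dotvDl !dotvDr (dotvC v u) -!sqr_norm2.
by have := dotv_le u v; nra.
Qed.

Lemma norm2_le_norm1 v : norm2 v <= norm1 v.
Proof.
have n0 : 0 <= norm1 v by exact: sumr_ge0.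
rewrite -(ler_pXn2r (n := 2)) ?nnegrE ?norm2_ge0//.
rewrite sqr_norm2 expr2 [leRHS]mulr_suml; apply: ler_sum => i _.
rewrite (le_trans (ler_norm _))// normrM ler_wpM2l//.
by rewrite [leRHS](bigD1 i)//= lerDl sumr_ge0.
Qed.

Lemma norm_coord_le v i : `|v i ord0| <= norm2 v.
Proof.
rewrite -(ler_pXn2r (n := 2)) ?nnegrE ?norm2_ge0//.
rewrite real_normK ?num_real// sqr_norm2 /dotv (bigD1 i)//= -expr2 lerDl.
by apply: sumr_ge0 => j _; rewrite -expr2 sqr_ge0.
Qed.

Lemma dotv_delta u i : dotv u (delta_mx i ord0) = u i ord0.
Proof.
rewrite /dotv (bigD1 i)//= mxE !eqxx mulr1 big1 ?addr0// => j ji.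
by rewrite mxE (negbTE ji) mulr0.
Qed.

Lemma norm2_delta i : norm2 (delta_mx i ord0 : 'cV[R]_d) = 1.
Proof.
apply/eqP; rewrite -(eqrXn2 (n := 2))// ?norm2_ge0// sqr_norm2 expr1n.
by rewrite dotv_delta mxE !eqxx.
Qed.

(** [sup] takes a default value on a set without supremum, so [opnorm2] carries information only
    once the set is known to be nonempty and bounded. The sum of the row norms is a bound. *)
Let opnorm2_has_sup A :
  has_sup [set norm2 (A *m v) | v in [set v : 'cV_d | norm2 v <= 1]].
Proof.
split.
  by exists (norm2 (A *m 0)), 0 => //=; rewrite (eqP _ : norm2 0 = 0)// norm2_eq0.
exists (\sum_i norm2 (row i A)^T) => _ [v /= v1 <-].
rewrite (le_trans (norm2_le_norm1 _))//; apply: ler_sum => i _.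
have -> : (A *m v) i ord0 = dotv (row i A)^T v.
  by rewrite mxE; apply: eq_bigr => j _; rewrite !mxE.
by rewrite (le_trans (dotv_abs_le _ _))// ler_piMr ?norm2_ge0.
Qed.

Lemma opnorm2_ge0 A : 0 <= opnorm2 A.
Proof.
apply: le_trans (ub_le_sup (opnorm2_has_sup A).2 _); last first.
  exists 0 => //=; rewrite (eqP _ : norm2 0 = 0)// norm2_eq0//.
exact: norm2_ge0.
Qed.

Lemma norm2_mulmx A v : norm2 (A *m v) <= opnorm2 A * norm2 v.
Proof.
have [->|v0] := eqVneq v 0.
  by rewrite mulmx0 (eqP _ : norm2 0 = 0) ?mulr0// norm2_eq0.
have nv : 0 < norm2 v by rewrite lt_neqAle norm2_ge0 eq_sym norm2_eq0 v0.
rewrite -ler_pdivrMr// mulrC -[X in X * _]ger0_norm ?invr_ge0 ?norm2_ge0//.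
rewrite -norm2Z scalemxAr; apply: (ub_le_sup (opnorm2_has_sup A).2).
exists ((norm2 v)^-1 *: v) => //=.
by rewrite norm2Z ger0_norm ?invr_ge0 ?norm2_ge0// mulVf ?gt_eqF.
Qed.

(** Directions are propagated backwards in time by the transpose, while stability is assumed for [A]
    itself. Moving one transpose across the inner product turns the square of the left norm into a
    quantity that [norm2_mulmx] controls. *)
Lemma norm2_mulmx_tr A v : norm2 (A^T *m v) <= opnorm2 A * norm2 v.
Proof.
have [->|v0] := eqVneq (A^T *m v) 0.
  by rewrite (eqP _ : norm2 0 = 0) ?mulr_ge0 ?opnorm2_ge0 ?norm2_ge0// norm2_eq0.
have nv : 0 < norm2 (A^T *m v).
  by rewrite lt_neqAle norm2_ge0 eq_sym norm2_eq0 v0.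
rewrite -(ler_pM2l nv) -expr2 sqr_norm2 -dotv_mulmx.
rewrite (le_trans (dotv_le _ _))// mulrA ler_wpM2r ?norm2_ge0//.
by rewrite mulrC norm2_mulmx.
Qed.

End euclidean.

(** * Scalar inequalities for the exponential *)

Section exponential_inequalities.
Context {R : realType}.
Implicit Types (x y u v p q : R).

(** The linear term is kept exact so that it cancels in the mean of a centred variable. Above
    [1 / 2] already [x <= 2 * x ^+ 2]; below, [(1 - x)^-1] lies between the exponential and its
    quadratic bound. *)
Lemma expR_le_quadratic x : expR x <= x + expR (2 * x ^+ 2).
Proof.
have [x12|x12] := leP x (1 / 2); last first.
  have : expR x <= expR (2 * x ^+ 2) by rewrite ler_expR; nra.
  by move=> /le_trans; apply; rewrite lerDr; lra.
have x1 : 0 < 1 - x by lra.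
have h1 : expR x <= (1 - x)^-1.
  by rewrite -[X in X <= _]invrK lef_pV2 ?posrE ?invr_gt0 ?expR_gt0// -expRN expR_ge1Dx.
have h2 : (1 - x)^-1 <= 1 + x + 2 * x ^+ 2.
  by rewrite -div1r ler_pdivrMr//; nra.
have := expR_ge1Dx (2 * x ^+ 2); lra.
Qed.

(* Hoeffding's bound, up to the constant, for a variable equal to [- u] with
   probability [1 - p] and to [u] or [- u] with probability [p / 2] each. *)
Lemma hoeffding_three_point p u : 0 <= p <= 1 ->
  (1 - p) * expR (- u) + p * ((expR u + expR (- u)) / 2) <=
  expR (- ((1 - p) * u) + 8 * u ^+ 2).
Proof.
(* Multiplying by [expR ((1 - p) * u)] centres the variable: its values become [- (p * u)] with
   weight [1 - p / 2] and [(2 - p) * u] with weight [p / 2]. The linear terms of [expR_le_quadratic]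
   then cancel. *)
move=> /andP[p0 p1]; rewrite expRD -ler_pdivrMl ?expR_gt0// -expRN opprK.
have e1 : expR ((1 - p) * u) * expR u = expR ((2 - p) * u).
  by rewrite -expRD; congr expR; ring.
have e2 : expR ((1 - p) * u) * expR (- u) = expR (- (p * u)).
  by rewrite -expRD; congr expR; ring.
have -> : expR ((1 - p) * u) *
    ((1 - p) * expR (- u) + p * ((expR u + expR (- u)) / 2)) =
    (1 - p / 2) * expR (- (p * u)) + p / 2 * expR ((2 - p) * u).
  by rewrite -e1 -e2; field.
have h1 : expR (- (p * u)) <= - (p * u) + expR (8 * u ^+ 2).
  rewrite (le_trans (expR_le_quadratic _))// lerD2l ler_expR sqrrN exprMn.
  have : 0 <= (1 - p) * (1 + p) * u ^+ 2.
    by apply: mulr_ge0; [apply: mulr_ge0; lra|exact: sqr_ge0].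
  by have := sqr_ge0 u; lra.
have h2 : expR ((2 - p) * u) <= (2 - p) * u + expR (8 * u ^+ 2).
  rewrite (le_trans (expR_le_quadratic _))// lerD2l ler_expR exprMn.
  have : 0 <= p * (4 - p) * u ^+ 2.
    by apply: mulr_ge0; [apply: mulr_ge0; lra|exact: sqr_ge0].
  by have := sqr_ge0 u; lra.
have : (1 - p / 2) * expR (- (p * u)) <=
    (1 - p / 2) * (- (p * u) + expR (8 * u ^+ 2)) by apply: ler_wpM2l => //; lra.
have : p / 2 * expR ((2 - p) * u) <=
    p / 2 * ((2 - p) * u + expR (8 * u ^+ 2)) by apply: ler_wpM2l => //; lra.
lra.
Qed.

(* A polynomial minorant of [1 - exp (- `|y| / l)]: it reduces small-ball bounds
   to second and fourth moments. *)
Lemma expRN_quartic l q y : 0 < l -> 0 <= q -> q * l ^+ 2 <= 1 ->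
  expR (- (`|y| / l)) + q * y ^+ 2 / 2 <= 1 + q ^+ 2 * y ^+ 4 / 2.
Proof.
(* The claim reads [exp (-v) <= 1 - t / 2 + t^2 / 2]. For [v <= 1] it follows from [t <= v^2] and
   [exp (-v) <= 1 / (1 + v)]; for [v > 1] the left side is at most [1 / 2] and the right side at
   least [7 / 8]. *)
move=> l0 q0 ql; set v := `|y| / l; set t := q * y ^+ 2.
have v0 : 0 <= v by rewrite divr_ge0// ltW.
have t0 : 0 <= t by rewrite mulr_ge0// sqr_ge0.
have tv : t <= v ^+ 2.
  have -> : t = q * l ^+ 2 * v ^+ 2.
    rewrite /t /v exprMn real_normK ?num_real// exprVn; field.
    by rewrite gt_eqF.
  by rewrite ler_piMl// sqr_ge0.
have -> : q ^+ 2 * y ^+ 4 = t ^+ 2 by rewrite /t; ring.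
have e1 : expR (- v) * (1 + v) <= 1.
  have := expR_ge1Dx v; have := expRxMexpNx_1 v; have := expR_gt0 (- v); nra.
have e0 := expR_gt0 (- v).
have [v1|v1] := leP v 1.
  have [t1|t1] := leP t 1; nra.
have e2 : expR (- v) <= 1 / 2 by nra.
by have := sqr_ge0 (t - 1 / 2); lra.
Qed.

(** Jensen's inequality for weights of mass at most 1: the missing mass is placed at the point 0.
    The tangent line at the mean [m] is used at every point. *)
Lemma expR_convex {I : finType} (w y : I -> R) :
  (forall i, 0 <= w i) -> \sum_i w i <= 1 ->
  expR (\sum_i w i * y i) <= 1 - \sum_i w i + \sum_i w i * expR (y i).
Proof.
move=> w0 w1; set m := \sum_i w i * y i.
have hi i : w i * (expR m * (1 + (y i - m))) <= w i * expR (y i).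
  apply: ler_wpM2l => //; have -> : expR (y i) = expR m * expR (y i - m).
    by rewrite -expRD; congr expR; ring.
  by rewrite ler_wpM2l ?expR_ge0// expR_ge1Dx.
have h0 : (1 - \sum_i w i) * (expR m * (1 - m)) <= 1 - \sum_i w i.
  rewrite ler_piMr ?subr_ge0//.
  have := expR_ge1Dx (- m); have := expRxMexpNx_1 m; have := expR_gt0 m; nra.
have : \sum_i w i * (expR m * (1 + (y i - m))) <= \sum_i w i * expR (y i).
  by apply: ler_sum => i _; exact: hi.
have -> : \sum_i w i * (expR m * (1 + (y i - m))) =
    expR m * ((\sum_i w i) * (1 - m) + m).
  rewrite mulr_suml /m -big_split mulr_sumr; apply: eq_bigr => i _ /=; ring.
move=> h; nra.
Qed.

Lemma expR_sqr_ge x : 1 + x ^+ 2 <= expR (x ^+ 2).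
Proof. exact: expR_ge1Dx. Qed.

Lemma expR_sqr_ge4 x : x ^+ 4 <= 4 * expR (x ^+ 2).
Proof.
have -> : x ^+ 2 = x ^+ 2 / 2 + x ^+ 2 / 2 by field.
rewrite expRD; have := expR_ge1Dx (x ^+ 2 / 2); have := sqr_ge0 x.
have -> : x ^+ 4 = x ^+ 2 * x ^+ 2 by ring.
set e := expR _; set t := x ^+ 2; nra.
Qed.

Lemma norm_le_expR_sqr x : `|x| <= expR (x ^+ 2).
Proof.
rewrite (le_trans _ (expR_sqr_ge x))// -(real_normK (num_real x)).
have := normr_ge0 x; nra.
Qed.

End exponential_inequalities.

(** * The linearized loss of one coordinate *)

Section tilt.
Context {R : realType}.
Implicit Types w a b c : R.

(* The directional derivative at 0 of [a |-> `|w - a|] in the direction [a]. *)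
Definition tilt w a : R :=
  `|a| - (0 < w)%R%:R * (`|a| + a) - (w < 0)%R%:R * (`|a| - a).

Lemma tilt_gt0 w a : 0 < w -> tilt w a = - a.
Proof. by move=> w0; rewrite /tilt w0 ltNge ltW//=; ring. Qed.

Lemma tilt_lt0 w a : w < 0 -> tilt w a = a.
Proof. by move=> w0; rewrite /tilt w0 ltNge ltW//=; ring. Qed.

Lemma tilt0 a : tilt 0 a = `|a|.
Proof. by rewrite /tilt ltxx !mul0r !subr0. Qed.

(** Convexity: the graph lies above its tangent half-line. What replaces the loss depends on the
    disturbance through its sign alone, which is all that the sign assumption controls. *)
Lemma tilt_le w a : tilt w a <= `|w - a| - `|w|.
Proof.
case: (ltrgt0P w) => w0.
- by rewrite tilt_gt0//; have := ler_norm (w - a); lra.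
- by rewrite tilt_lt0//; have := ler_norm (- (w - a)); rewrite normrN; lra.
- by rewrite subr0 w0 tilt0 sub0r normrN.
Qed.

Lemma tiltM w a c : 0 <= c -> tilt w (c * a) = c * tilt w a.
Proof. by move=> c0; rewrite /tilt normrM (ger0_norm c0); ring. Qed.

Lemma tilt_lipschitz w a b : tilt w b - `|a - b| <= tilt w a.
Proof.
have := ler_norm (a - b); have := ler_norm (- (a - b)); rewrite normrN => h1 h2.
case: (ltrgt0P w) => w0.
- by rewrite !tilt_gt0//; lra.
- by rewrite !tilt_lt0//; lra.
- by rewrite w0 !tilt0; have := ler_dist_dist a b; rewrite ler_norml; lra.
Qed.

Lemma measurable_tilt {d1} {U : measurableType d1} (f g : U -> R) :
  measurable_fun setT f -> measurable_fun setT g ->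
  measurable_fun setT (fun u => tilt (f u) (g u)).
Proof.
move=> mf mg.
have mg' : measurable_fun setT (fun u => `|g u|) by exact: measurableT_comp.
have mpos : measurable_fun setT (fun u => (0 < f u)%R%:R : R).
  have -> : (fun u => (0 < f u)%R%:R : R) = \1_(f @^-1` `]0, +oo[).
    apply/funext => u; rewrite indicE; congr ((nat_of_bool _)%:R).
    by apply/idP/idP => [?|/set_mem]; [apply/mem_set|];
      rewrite /= in_itv/= ?andbT.
  by apply: measurable_indic; rewrite -[X in measurable X]setTI; exact: mf.
have mneg : measurable_fun setT (fun u => (f u < 0)%R%:R : R).
  have -> : (fun u => (f u < 0)%R%:R : R) = \1_(f @^-1` `]-oo, 0[).
    apply/funext => u; rewrite indicE; congr ((nat_of_bool _)%:R).
    by apply/idP/idP => [?|/set_mem]; [apply/mem_set|];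
      rewrite /= in_itv/=.
  by apply: measurable_indic; rewrite -[X in measurable X]setTI; exact: mf.
apply: measurable_funB; last first.
  by apply: measurable_funM => //; exact: measurable_funB.
apply: measurable_funB => //; apply: measurable_funM => //.
exact: measurable_funD.
Qed.

End tilt.

(** * Integrals of nonnegative real functions and sub-Gaussian moments *)

Section ge0_real_integral.
Context {R : realType} {d0} {S : measurableType d0}.
Variable mu : {measure set S -> \bar R}.
Implicit Types (D : set S) (f g : S -> R).
Local Open Scope ereal_scope.

Lemma le_integral_EFin D f g : measurable D ->
  measurable_fun setT f -> measurable_fun setT g ->
  (forall x, D x -> 0 <= f x <= g x)%R ->
  \int[mu]_(x in D) (f x)%:E <= \int[mu]_(x in D) (g x)%:E.
Proof.
move=> mD mf mg fg; apply: ge0_le_integral => //.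
- by move=> x /fg /andP[? _]; rewrite lee_fin.
- exact/measurable_funTS/measurable_EFinP.
- exact/measurable_funTS/measurable_EFinP.
- by move=> x /fg /andP[_ ?]; rewrite lee_fin.
Qed.

Lemma integralD_EFin_ge0 D f g : measurable D ->
  measurable_fun setT f -> measurable_fun setT g ->
  (forall x, 0 <= f x)%R -> (forall x, 0 <= g x)%R ->
  \int[mu]_(x in D) (f x + g x)%:E =
  \int[mu]_(x in D) (f x)%:E + \int[mu]_(x in D) (g x)%:E.
Proof.
move=> mD mf mg f0 g0.
by under eq_integral do rewrite EFinD; apply: ge0_integralD => //;
  first [by move=> x _; rewrite lee_fin
        |exact/measurable_funTS/measurable_EFinP].
Qed.

Lemma integralZl_EFin_ge0 D f (c : R) : measurable D ->
  measurable_fun setT f -> (forall x, 0 <= f x)%R -> (0 <= c)%R ->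
  \int[mu]_(x in D) (c * f x)%:E = c%:E * \int[mu]_(x in D) (f x)%:E.
Proof.
move=> mD mf f0 c0; under eq_integral do rewrite EFinM.
apply: ge0_integralZl => //; last by move=> x _; rewrite lee_fin.
exact/measurable_funTS/measurable_EFinP.
Qed.

End ge0_real_integral.

Section sub_gaussian_integrals.
Context {R : realType} {d0} {S : measurableType d0} {n : nat}.
Variables (mu : {measure set S -> \bar R}) (X : S -> 'cV[R]_n).
Hypothesis mX : measurable_fun setT X.

Let mXz z : measurable_fun setT (fun w => dotv (X w) z).
Proof. exact: (measurableT_comp (measurable_dotv z)). Qed.

Let me c z : measurable_fun setT (fun w => expR (dotv (X w) z ^+ 2 / c ^+ 2)).
Proof.
apply: measurableT_comp => //; apply: measurable_funM => //.
exact: measurable_funX.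
Qed.

(** Working strictly above the infimum avoids showing that it is attained: some admissible [c'] lies
    below [c], and the integrand decreases in the scale. Hence the gap [sigma < s] kept
    throughout. *)
Lemma psi2_normv_le (sigma c : R) (z : 'cV[R]_n) :
  (psi2_normv mu X <= sigma%:E)%E -> sigma < c -> norm2 z <= 1 ->
  (\int[mu]_w (expR (dotv (X w) z ^+ 2 / c ^+ 2))%:E <= 2%:E)%E.
Proof.
move=> sub sc z1.
have : (psi2_norm mu (fun w => dotv (X w) z) < c%:E)%E.
  apply: (le_lt_trans _ (_ : sigma%:E < c%:E)%E); last by rewrite lte_fin.
  by apply: le_trans sub; apply: ereal_sup_ubound; exists z.
move=> /ereal_inf_lt[_ [c' [c'0 hc'] <-]]; rewrite lte_fin => c'c.
apply: le_trans hc'; apply: le_integral_EFin => // w _.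
rewrite expR_ge0 ler_expR ler_wpM2l ?sqr_ge0//.
rewrite lef_pV2 ?posrE ?exprn_gt0// ?(lt_trans c'0)//.
by rewrite ler_pXn2r ?nnegrE ?ltW// (lt_trans c'0).
Qed.

Lemma integral_norm1_le (D : set S) (s K : R) : measurable D -> 0 < s ->
  (forall z : 'cV[R]_n, norm2 z <= 1 ->
    (\int[mu]_(w in D) (expR (dotv (X w) z ^+ 2 / s ^+ 2))%:E <= K%:E)%E) ->
  (\int[mu]_(w in D) (norm1 (X w))%:E <= (n%:R * (s * K))%:E)%E.
Proof.
move=> mD s0 expX.
have mi i : measurable_fun setT (fun w => `|X w i ord0|).
  by apply: measurableT_comp => //; exact: (measurableT_comp (measurable_coord i)).
rewrite /norm1; under eq_integral do rewrite -sumEFin.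
rewrite ge0_integral_sum//; last by move=> i; exact/measurable_funTS/measurable_EFinP.
rewrite (_ : (n%:R * (s * K))%:E = \sum_(i < n) (s * K)%:E)%E; last first.
  by rewrite sumEFin sumr_const card_ord mulr_natl.
apply: lee_sum => i _.
have := expX (delta_mx i ord0); rewrite norm2_delta => /(_ (lexx _)) h.
rewrite EFinM; apply: (le_trans _ (lee_wpmul2l _ h)); last by rewrite lee_fin ltW.
rewrite -integralZl_EFin_ge0//; do ?[by move=> w; exact: expR_ge0|exact: ltW].
apply: le_integral_EFin => //; first exact: measurable_funM.
move=> w _; rewrite normr_ge0 dotv_delta /=.
have -> : `|X w i ord0| = s * `|X w i ord0 / s|.
  by rewrite normrM [`|s^-1|]gtr0_norm ?invr_gt0// mulrCA divff ?mulr1// gt_eqF.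
by rewrite ler_pM2l// -expr_div_n norm_le_expR_sqr.
Qed.

(** Bounds for single directions combine by convexity, so no independence between the directions is
    involved. The leftover mass [1 - \sum_i c i] contributes a multiple of the integral of [H],
    absorbed thanks to [1 <= K]. *)
Lemma integral_exp_convex {I : finType} (D : set S) (s K : R) (H : S -> R)
    (c : I -> R) (z : I -> 'cV[R]_n) : measurable D -> 1 <= K ->
  (forall i, 0 <= c i) -> \sum_i c i <= 1 ->
  measurable_fun setT H -> (forall w, 0 <= H w) ->
  (forall i, (\int[mu]_(w in D)
      (H w * expR (dotv (X w) (z i) ^+ 2 / s ^+ 2))%:E <=
    K%:E * \int[mu]_(w in D) (H w)%:E)%E) ->
  (\int[mu]_(w in D)
      (H w * expR (\sum_i c i * (dotv (X w) (z i) ^+ 2 / s ^+ 2)))%:E <=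
   K%:E * \int[mu]_(w in D) (H w)%:E)%E.
Proof.
move=> mD K1 c0 c1 mH H0 expX; pose c' := 1 - \sum_i c i.
have c'0 : 0 <= c' by rewrite subr_ge0.
have mS : measurable_fun setT (fun w =>
    expR (\sum_i c i * (dotv (X w) (z i) ^+ 2 / s ^+ 2))).
  apply: measurableT_comp => //; apply: measurable_sum => i.
  by do 2![apply: measurable_funM => //]; exact: measurable_funX.
have mHi i : measurable_fun setT
    (fun w => H w * expR (dotv (X w) (z i) ^+ 2 / s ^+ 2)).
  exact: measurable_funM.
have Hi0 i w : 0 <= H w * expR (dotv (X w) (z i) ^+ 2 / s ^+ 2).
  by rewrite mulr_ge0 ?expR_ge0.
apply: (@le_trans _ _ (\int[mu]_(w in D) (c' * H w +
    \sum_i c i * (H w * expR (dotv (X w) (z i) ^+ 2 / s ^+ 2)))%:E)%E).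
  apply: le_integral_EFin => //.
  - exact: measurable_funM.
  - apply: measurable_funD; first exact: measurable_funM.
    by apply: measurable_sum => i; exact: measurable_funM.
  - move=> w _; rewrite mulr_ge0 ?expR_ge0//=.
    have := expR_convex (fun i => dotv (X w) (z i) ^+ 2 / s ^+ 2) c0 c1.
    move=> /(ler_wpM2l (H0 w)) /le_trans; apply.
    rewrite -/c' mulrDr mulrC lerD2l mulr_sumr; apply: ler_sum => i _.
    by rewrite mulrCA.
rewrite integralD_EFin_ge0//; last 4 first.
- exact: measurable_funM.
- by apply: measurable_sum => i; exact: measurable_funM.
- by move=> w; rewrite mulr_ge0.
- by move=> w; apply: sumr_ge0 => i _; rewrite mulr_ge0.
rewrite integralZl_EFin_ge0//.
set J := (\int[mu]_(w in D) (H w)%:E)%E.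
have J0 : (0 <= J)%E by apply: integral_ge0 => w _; rewrite lee_fin.
apply: (@le_trans _ _ (c'%:E * J + (\sum_i c i)%:E * (K%:E * J))%E).
  rewrite leeD2l//; under eq_integral do rewrite -sumEFin.
  rewrite ge0_integral_sum//; last 2 first.
  - move=> i; apply/measurable_funTS/measurable_EFinP.
    exact: measurable_funM.
  - by move=> i w _; rewrite lee_fin mulr_ge0.
  rewrite -sumEFin ge0_sume_distrl; last by move=> i _; rewrite lee_fin.
  apply: lee_sum => i _.
  rewrite integralZl_EFin_ge0//; apply: lee_wpmul2l; first by rewrite lee_fin.
  exact: expX.
have K0 : 0 <= K by rewrite (le_trans ler01).
rewrite muleA -ge0_muleDl ?lee_fin// ?mulr_ge0 ?sumr_ge0//.
rewrite lee_wpmul2r// lee_fin /c'.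
have := ler_wpM2l (sumr_ge0 _ (fun i (_ : xpredT i) => c0 i)) K1.
by have := ler_wpM2r c'0 K1; rewrite /c'; lra.
Qed.

End sub_gaussian_integrals.

(** * Conditional moments and conditional signs *)

Section kernel_moments.
Context {R : realType} {n : nat}.
Variable mu : {measure set 'cV[R]_n -> \bar R}.
Implicit Types (x y z : 'cV[R]_n).

Hypothesis mu_fin : (mu setT < +oo)%E.
Hypothesis mu_sq : forall i, (\int[mu]_y (y i ord0 ^+ 2)%:E < +oo)%E.

(** [second_moment] consists of real-valued integrals, which return a default value when the
    integral is infinite. Integrability makes its entries genuine and lets sums be exchanged with
    the integral. *)
Let integrable_prod x i j : mu.-integrable setT
  (EFin \o (fun y => (x + y) i ord0 * (x + y) j ord0)).
Proof.
have mc k : measurable_fun setT (fun y => (x + y) k ord0).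
  under eq_fun do rewrite mxE.
  by apply: measurable_funD => //; exact: measurable_coord.
have [K [K0 hK]] : exists K, 0 <= K /\ forall y : 'cV[R]_n,
    `|(x + y) i ord0 * (x + y) j ord0| <=
    K + (2 * y i ord0 ^+ 2 + 2 * y j ord0 ^+ 2).
  exists (2 * x i ord0 ^+ 2 + 2 * x j ord0 ^+ 2).
  split=> [|y]; first by rewrite addr_ge0// mulr_ge0// sqr_ge0.
  rewrite !mxE.
  set a := x i _; set b := x j _; set c := y i _; set e := y j _.
  have := sqr_ge0 (a + c + (b + e)); have := sqr_ge0 (a + c - (b + e)).
  have := sqr_ge0 (a - c); have := sqr_ge0 (b - e).
  have := sqr_ge0 a; have := sqr_ge0 b; have := sqr_ge0 c; have := sqr_ge0 e.
  rewrite !expr2 => *; rewrite ler_norml; apply/andP; split; lra.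
have s0 (y : 'cV[R]_n) : 0 <= 2 * y i ord0 ^+ 2 + 2 * y j ord0 ^+ 2.
  by rewrite addr_ge0// mulr_ge0// sqr_ge0.
apply: (@le_integrable _ _ _ _ _ measurableT _ (EFin \o (fun y : 'cV[R]_n =>
  K + (2 * y i ord0 ^+ 2 + 2 * y j ord0 ^+ 2)))).
- by apply/measurable_EFinP; exact: measurable_funM.
- move=> y _; rewrite /= lee_fin [leRHS]ger0_norm; first exact: hK.
  by rewrite addr_ge0.
- have msq k : measurable_fun setT (fun y : 'cV[R]_n => y k ord0 ^+ 2).
    by apply: measurable_funX; exact: measurable_coord.
  apply/integrableP; split.
    apply/measurable_EFinP; apply: measurable_funD => //.
    by apply: measurable_funD; apply: measurable_funM.
  rewrite (eq_integral (fun y : 'cV[R]_n =>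
    (K + (2 * y i ord0 ^+ 2 + 2 * y j ord0 ^+ 2))%:E)); last first.
    by move=> y _; rewrite /= ger0_norm// addr_ge0.
  rewrite integralD_EFin_ge0//; last first.
    by apply: measurable_funD; apply: measurable_funM.
  rewrite integral_cst// [X in (_ + X)%E]integralD_EFin_ge0//; last 4 first.
  + exact: measurable_funM.
  + exact: measurable_funM.
  + by move=> y; rewrite mulr_ge0// sqr_ge0.
  + by move=> y; rewrite mulr_ge0// sqr_ge0.
  rewrite !integralZl_EFin_ge0//; last 2 first.
  + by move=> y; rewrite sqr_ge0.
  + by move=> y; rewrite sqr_ge0.
  by rewrite !lte_add_pinfty// lte_mul_pinfty// lee_fin.
Qed.

Lemma second_moment_lower (lambda b : R) z :
  (forall x, loewner_le (lambda ^+ 2)%:M (second_moment mu x)) ->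
  norm2 z = 1 ->
  ((lambda ^+ 2)%:E <= \int[mu]_y ((b + dotv y z) ^+ 2)%:E)%E.
Proof.
(* Since [norm2 z = 1], the scalar [b] is the component along [z] of the vector shift [b *: z]; here
   the freedom of [x] in the non-degeneracy assumption enters. *)
move=> nd z1; pose x := b *: z.
have zz : dotv z z = 1 by rewrite -sqr_norm2 z1 expr1n.
have -> : (\int[mu]_y ((b + dotv y z) ^+ 2)%:E =
    \sum_i \sum_j (z i ord0 * z j ord0 * second_moment mu x i j)%:E)%E.
  transitivity (\int[mu]_y (\sum_i \sum_j ((z i ord0 * z j ord0)%:E *
      ((x + y) i ord0 * (x + y) j ord0)%:E)))%E.
    apply: eq_integral => y _.
    have -> : b + dotv y z = dotv (x + y) z by rewrite dotvDl dotvZl zz mulr1.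
    under eq_bigr => i _ do
      (under eq_bigr do rewrite -EFinM; rewrite sumEFin).
    rewrite sumEFin; congr EFin; rewrite expr2 mulr_suml; apply: eq_bigr => i _.
    rewrite mulr_sumr; apply: eq_bigr => j _; ring.
  rewrite integral_sum//; last first.
    move=> i; apply: integrable_sum => // j _.
    by apply: integrableZl => //; exact: integrable_prod.
  apply: eq_bigr => i _; rewrite integral_sum//; last first.
    by move=> j; apply: integrableZl => //; exact: integrable_prod.
  apply: eq_bigr => j _; rewrite integralZl//; last exact: integrable_prod.
  rewrite [RHS]EFinM mxE; congr (_ * _)%E; rewrite /Rintegral fineK//.
  by apply: integrable_fin_num => //; exact: integrable_prod.
have [_ /(_ z)] := nd x.
rewrite mulmxBl dotvC dotvDl dotvNl mul_scalar_mx dotvZl zz mulr1 subr_ge0.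
under [X in _ -> (_ <= X)%E]eq_bigr do rewrite sumEFin.
rewrite sumEFin lee_fin => /le_trans; apply.
rewrite le_eqVlt; apply/orP; left; apply/eqP/eq_bigr => i _.
rewrite mxE mulr_suml; apply: eq_bigr => j _; ring.
Qed.

End kernel_moments.

Section conditional_bounds.
Context {R : realType} {d0} {Omega : measurableType d0} {n : nat}.
Variables (P : probability Omega R) (G : set (set Omega)).
Hypothesis mG : <<s G >> `<=` measurable.
Variables (E : set Omega) (X : Omega -> 'cV[R]_n).
Hypotheses (mE : measurable E) (mX : measurable_fun setT X).

Let GT := g_sigma_algebraType G.

Lemma cond_sub_gaussian (sigma c : R) (H : GT -> R) (z : 'cV[R]_n) :
  cond_law_sat P G E X (fun mu => psi2_normv mu id <= sigma%:E)%E ->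
  sigma < c -> measurable_fun setT H -> (forall w, 0 <= H w) ->
  norm2 z <= 1 ->
  (\int[P]_(w in E) (H w * expR (dotv (X w) z ^+ 2 / c ^+ 2))%:E <=
   2%:E * \int[P]_(w in E) (H w)%:E)%E.
Proof.
move=> [k [lawk subk]] sc mH H0 z1.
have me : measurable_fun setT (fun y : 'cV[R]_n => expR (dotv y z ^+ 2 / c ^+ 2)).
  apply: measurableT_comp => //; apply: measurable_funM => //.
  by apply: measurable_funX; exact: measurable_dotv.
pose f (u : GT * 'cV[R]_n) := (H u.1 * expR (dotv u.2 z ^+ 2 / c ^+ 2))%:E.
have mf : measurable_fun setT f.
  apply/measurable_EFinP; apply: measurable_funM.
    exact: measurableT_comp.
  by apply: (measurableT_comp me).
have f0 u : (0 <= f u)%E by rewrite lee_fin mulr_ge0// expR_ge0.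
rewrite -[leLHS]/(\int[P]_(w in E) f (w, X w))%E.
rewrite (disintegration mG mE mX lawk mf f0).
rewrite -integralZl_EFin_ge0//; last exact: (measurable_fun_sub mG).
apply: ae_ge0_le_integral => //.
- by move=> w _; exact: integral_ge0.
- apply/measurable_funTS/(measurable_fun_sub mG).
  exact: (measurable_fun_integral_finite_kernel f).
- by move=> w _; rewrite lee_fin mulr_ge0.
- apply/measurable_funTS/measurable_EFinP; apply: measurable_funM => //.
  exact: (measurable_fun_sub mG).
apply: (@filterS _ _ (ae_filter_ringOfSetsType P) _ _ _ subk) => w subw _.
rewrite /f /= integralZl_EFin_ge0//.
rewrite mulrC EFinM lee_wpmul2l ?lee_fin//.
by apply: (psi2_normv_le _ subw sc z1); exact: measurable_id.
Qed.

(** The shift [b] is random but known from the past, so it is frozen together with [H]. Outside one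
    null set the matrix inequality holds for all shifts at once, and the value [b w] may be inserted
    afterwards. *)
Lemma cond_non_degenerate (lambda : R) (H b : GT -> R) (z : 'cV[R]_n) :
  cond_law_sat P G E X
    (fun mu => forall x, loewner_le (lambda ^+ 2)%:M (second_moment mu x)) ->
  (forall i, (\int[P]_(w in E) (X w i ord0 ^+ 2)%:E < +oo)%E) ->
  measurable_fun setT H -> measurable_fun setT b ->
  (forall w, 0 <= H w) -> norm2 z = 1 ->
  ((lambda ^+ 2)%:E * \int[P]_(w in E) (H w)%:E <=
   \int[P]_(w in E) (H w * (b w + dotv (X w) z) ^+ 2)%:E)%E.
Proof.
move=> [k [lawk ndk]] X2 mH mb H0 z1.
pose f (u : GT * 'cV[R]_n) := (H u.1 * (b u.1 + dotv u.2 z) ^+ 2)%:E.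
have md : measurable_fun setT (fun u : GT * 'cV[R]_n => dotv u.2 z).
  by apply: (measurableT_comp (measurable_dotv z)).
have mf : measurable_fun setT f.
  apply/measurable_EFinP; apply: measurable_funM.
    exact: measurableT_comp.
  apply: measurable_funX; apply: measurable_funD => //.
  exact: measurableT_comp.
have f0 u : (0 <= f u)%E by rewrite lee_fin mulr_ge0// sqr_ge0.
rewrite -[leRHS]/(\int[P]_(w in E) f (w, X w))%E.
rewrite (disintegration mG mE mX lawk mf f0).
rewrite -integralZl_EFin_ge0//; last 2 first.
- exact: (measurable_fun_sub mG).
- exact: sqr_ge0.
apply: ae_ge0_le_integral => //.
- by move=> w _; rewrite lee_fin mulr_ge0// sqr_ge0.
- apply/measurable_funTS/measurable_EFinP; apply: measurable_funM => //.
  exact: (measurable_fun_sub mG).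
- by move=> w _; exact: integral_ge0.
- apply/measurable_funTS/(measurable_fun_sub mG).
  exact: (measurable_fun_integral_finite_kernel f).
(* Reading [second_moment] requires finite second moments of the kernel measures. They hold almost
   surely on [E], because by disintegration their integral over [E] is the finite quantity in
   [X2]. *)
have sqf : {ae P, forall w, E w ->
    forall i, (\int[k w]_y (y i ord0 ^+ 2)%:E < +oo)%E}.
  suff : forall i, {ae P, forall w, E w ->
      (\int[k w]_y (y i ord0 ^+ 2)%:E < +oo)%E}.
    move=> h; have := filter_forall (ae_filter_ringOfSetsType P) h.
    by apply: (@filterS _ _ (ae_filter_ringOfSetsType P)) => w hw Ew i; exact: hw.
  move=> i; pose g (u : GT * 'cV[R]_n) := (u.2 i ord0 ^+ 2)%:E.
  have mg : measurable_fun setT g.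
    apply/measurable_EFinP; apply: measurable_funX.
    by apply: (measurableT_comp (measurable_coord i)).
  have g0 u : (0 <= g u)%E by rewrite lee_fin sqr_ge0.
  have int0 w : (0 <= \int[k w]_y g (w, y))%E by exact: integral_ge0.
  have : P.-integrable E (fun w => \int[k w]_y g (w, y))%E.
    apply/integrableP; split.
      apply/measurable_funTS/(measurable_fun_sub mG).
      exact: (measurable_fun_integral_finite_kernel g).
    under eq_integral do rewrite gee0_abs//.
    by rewrite -(disintegration mG mE mX lawk mg g0); exact: X2.
  move=> /(integrable_ae mE).
  by apply: (@filterS _ _ (ae_filter_ringOfSetsType P)) => w /[apply];
    rewrite ge0_fin_numE.
apply: (@filterS2 _ _ (ae_filter_ringOfSetsType P) _ _ _ _ ndk sqf) => w ndw sqw Ew.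
rewrite /f /= integralZl_EFin_ge0//; last 2 first.
- by apply: measurable_funX; apply: measurable_funD => //; exact: measurable_dotv.
- by move=> y; rewrite sqr_ge0.
rewrite mulrC EFinM lee_wpmul2l ?lee_fin//.
apply: second_moment_lower => //; last exact: sqw.
by rewrite prob_kernel ltry.
Qed.

End conditional_bounds.

Section conditional_sign.
Context {R : realType} {d0} {Omega : measurableType d0} {n : nat}.
Variables (P : probability Omega R) (G : set (set Omega)).
Hypothesis mG : <<s G >> `<=` measurable.
Variables (E : set Omega) (X alpha beta : Omega -> 'cV[R]_n).
Hypotheses (mE : measurable E) (malpha : measurable_fun setT alpha).

Let GT := g_sigma_algebraType G.

(** Multiplication by a positive [beta] keeps signs, so on [E] the signs of [X] are those of
    [alpha], whose conditional law is balanced. A weight known from the past does not disturb the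
    balance. *)
Lemma cond_sign (Q : {measure set 'cV[R]_n -> \bar R} -> Prop) (H : GT -> R) i :
  (forall w, E w -> X w = hadamard (alpha w) (beta w) /\
     forall i, 0 < beta w i ord0) ->
  cond_law_sat P G E alpha (fun mu => Q mu /\
    forall i, mu [set a | 0 < a i ord0] = mu [set a | a i ord0 < 0]) ->
  measurable_fun setT H -> (forall w, 0 <= H w) ->
  (\int[P]_(w in E) (H w * (0 < X w i ord0)%R%:R)%:E =
   \int[P]_(w in E) (H w * (X w i ord0 < 0)%R%:R)%:E)%E.
Proof.
move=> XE [k [lawk symk]] mH H0.
have sgnX w : E w -> ((0 < X w i ord0) = (0 < alpha w i ord0)) /\
    ((X w i ord0 < 0) = (alpha w i ord0 < 0)).
  move=> /XE[-> b0]; rewrite !mxE.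
  by rewrite pmulr_lgt0// pmulr_llt0.
have mpos : measurable [set a : 'cV[R]_n | 0 < a i ord0].
  rewrite -[X in measurable X]setTI.
  by have := @measurable_coord R n i measurableT _
    (measurable_itv `]0, +oo[); rewrite set_itvoy.
have mneg : measurable [set a : 'cV[R]_n | a i ord0 < 0].
  rewrite -[X in measurable X]setTI.
  by have := @measurable_coord R n i measurableT _
    (measurable_itv `]-oo, 0[); rewrite set_itvNyo.
have disint (A : set 'cV[R]_n) : measurable A ->
    (\int[P]_(w in E) (H w * (\1_A (alpha w)))%:E =
     \int[P]_(w in E) ((H w)%:E * k w A))%E.
  move=> mA; pose f (u : GT * 'cV[R]_n) := (H u.1 * \1_A u.2)%:E.
  have mf : measurable_fun setT f.
    apply/measurable_EFinP; apply: measurable_funM.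
      exact: measurableT_comp.
    by apply: (measurableT_comp (measurable_indic mA)).
  have f0 u : (0 <= f u)%E by rewrite lee_fin mulr_ge0.
  rewrite -[LHS]/(\int[P]_(w in E) f (w, alpha w))%E.
  rewrite (disintegration mG mE malpha lawk mf f0).
  apply: eq_integral => w _; rewrite /f /= integralZl_EFin_ge0//.
  by rewrite integral_indic// setIT.
transitivity (\int[P]_(w in E) (H w *
    \1_[set a : 'cV[R]_n | 0 < a i ord0] (alpha w))%:E)%E.
  apply: eq_integral => w /[!inE] Ew; congr (_ * _)%:E.
  rewrite indicE (sgnX _ Ew).1.
  by congr ((nat_of_bool _)%:R); apply/idP/idP => [?|/set_mem//]; apply/mem_set.
transitivity (\int[P]_(w in E) (H w *
    \1_[set a : 'cV[R]_n | a i ord0 < 0] (alpha w))%:E)%E; last first.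
  apply: eq_integral => w /[!inE] Ew; congr (_ * _)%:E.
  rewrite indicE (sgnX _ Ew).2.
  by congr ((nat_of_bool _)%:R); apply/idP/idP => [/set_mem//|?]; apply/mem_set.
rewrite !disint//.
have mHk A : measurable A ->
    measurable_fun setT ((fun w => (H w)%:E * k w A)%E : Omega -> \bar R).
  move=> mA; apply: (measurable_fun_sub mG); apply: emeasurable_funM.
    exact/measurable_EFinP.
  exact: measurable_kernel.
apply: ge0_ae_eq_integral => //.
- by apply: measurable_funTS; exact: mHk.
- by apply: measurable_funTS; exact: mHk.
- by move=> w _; rewrite mule_ge0// lee_fin.
- by move=> w _; rewrite mule_ge0// lee_fin.
- apply: (@filterS _ _ (ae_filter_ringOfSetsType P) _ _ _ symk) => w [_ hw] _.
  by rewrite hw.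
Qed.

End conditional_sign.

(** * One step of the linearized loss *)

Section one_step.
Context {R : realType} {d0} {Omega : measurableType d0} {n : nat}.
Variables (P : probability Omega R) (G : set (set Omega)).
Hypothesis mG : <<s G >> `<=` measurable.
Variables (E : set Omega) (X : Omega -> 'cV[R]_n) (p sigma lambda : R).
Hypotheses (mE : measurable E) (mX : measurable_fun setT X).
Hypothesis p01 : 0 < p < 1.
Hypothesis X0 : forall w, ~ E w -> X w = 0.
Hypothesis condE : is_cond_prob P G (~` E) (cst (1 - p)%:E).

Let GT := g_sigma_algebraType G.

Let condP A : <<s G >> A -> P (A `&` ~` E) = ((1 - p)%:E * P A)%E.
Proof.
move=> sA; rewrite condE.2//; under eq_integral do rewrite /cst.
by rewrite integral_cst//; exact: mG.
Qed.

Lemma attack_prob A : <<s G >> A -> P (A `&` E) = (p%:E * P A)%E.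
Proof.
move=> sA; have mA := mG sA.
have PA : P A = (P (A `&` E) + P (A `&` ~` E))%E.
  by rewrite -[in LHS](setIT A) -(setUv E) setIUr measureU//;
    [exact: measurableI|apply: measurableI => //; exact: measurableC|
     apply/seteqP; split => // w /= []; tauto].
move: PA; rewrite condP//.
have : P A \is a fin_num by exact: fin_num_measure.
have : P (A `&` E) \is a fin_num by apply: fin_num_measure; exact: measurableI.
case: (P A) => // a; case: (P (A `&` E)) => // b _ _.
by rewrite -!EFinM -EFinD => -[ab]; congr EFin; lra.
Qed.

Lemma integral_attack (H : GT -> R) :
  measurable_fun setT H -> (forall w, 0 <= H w) ->
  (\int[P]_(w in E) (H w)%:E = p%:E * \int[P]_w (H w)%:E)%E.
Proof.
move=> mH H0; apply: (integral_indep mG) => //.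
- by case/andP: p01 => /ltW.
- exact: attack_prob.
- exact/measurable_EFinP.
Qed.

Lemma integral_no_attack (H : GT -> R) :
  measurable_fun setT H -> (forall w, 0 <= H w) ->
  (\int[P]_(w in ~` E) (H w)%:E = (1 - p)%:E * \int[P]_w (H w)%:E)%E.
Proof.
move=> mH H0; apply: (integral_indep mG) => //.
- exact: measurableC.
- by case/andP: p01 => _ /ltW; rewrite subr_ge0.
- exact/measurable_EFinP.
Qed.

Lemma integral_split (f : Omega -> R) :
  measurable_fun setT f -> (forall w, 0 <= f w) ->
  (\int[P]_w (f w)%:E =
   \int[P]_(w in E) (f w)%:E + \int[P]_(w in ~` E) (f w)%:E)%E.
Proof.
move=> mf f0; rewrite -ge0_integral_setU//; first by rewrite setUv.
- exact: measurableC.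
- by rewrite setUv; exact/measurable_EFinP.
- by move=> w _; rewrite lee_fin.
- exact/disj_setPCl.
Qed.

Let mXi i : measurable_fun setT (fun w => X w i ord0).
Proof. exact: (measurableT_comp (measurable_coord i)). Qed.

Let mXz z : measurable_fun setT (fun w => dotv (X w) z).
Proof. exact: (measurableT_comp (measurable_dotv z)). Qed.

Section sign.
Variables (alpha beta : Omega -> 'cV[R]_n).
Hypothesis malpha : measurable_fun setT alpha.
Hypothesis XE : forall w, E w -> X w = hadamard (alpha w) (beta w) /\
  forall i, 0 < beta w i ord0.
Variable Q : {measure set 'cV[R]_n -> \bar R} -> Prop.
Hypothesis symE : cond_law_sat P G E alpha (fun mu => Q mu /\
  forall i, mu [set a | 0 < a i ord0] = mu [set a | a i ord0 < 0]).

(** On [E] the balance of signs acts like a fair coin, so the exponential is dominated by the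
    average [U + V] of its two possible values; off [E] the tilt is [|a|]. The mixture with weights
    [p] and [1 - p] is the three-point law of [hoeffding_three_point] at [th * |a|]. *)
Lemma loss_step (H a : GT -> R) (th : R) i : 0 < th ->
  measurable_fun setT H -> (forall w, 0 <= H w) -> measurable_fun setT a ->
  (\int[P]_w (H w * expR (- (th * tilt (X w i ord0) (a w))))%:E <=
   \int[P]_w (H w * expR (- ((1 - p) * (th * `|a w|)) +
                          8 * (th * a w) ^+ 2))%:E)%E.
Proof.
move=> th0 mH H0 ma; case/andP: (p01) => p0 p1.
have mH' := measurable_fun_sub mG mH; have ma' := measurable_fun_sub mG ma.
pose x w := X w i ord0.
pose L (w : Omega) : R := H w * expR (- (th * tilt (x w) (a w))).
pose U (w : Omega) : R := H w * expR (th * a w) / 2.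
pose V (w : Omega) : R := H w * expR (- (th * a w)) / 2.
pose pos w : R := (0 < x w)%R%:R; pose neg w : R := (x w < 0)%R%:R.
pose Z (w : Omega) : R := H w * expR (- (th * `|a w|)).
have mx : measurable_fun setT x by exact: mXi.
have mL : measurable_fun setT L.
  apply: measurable_funM => //; apply: measurableT_comp => //.
  apply: measurable_funN; apply: measurable_funM => //.
  exact: measurable_tilt.
have gmU : measurable_fun setT (U : GT -> R).
  apply: measurable_funM => //; apply: measurable_funM => //.
  by apply: measurableT_comp => //; exact: measurable_funM.
have gmV : measurable_fun setT (V : GT -> R).
  apply: measurable_funM => //; apply: measurable_funM => //.
  by apply: measurableT_comp => //; apply: measurable_funN; exact: measurable_funM.
have gmZ : measurable_fun setT (Z : GT -> R).
  apply: measurable_funM => //; apply: measurableT_comp => //.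
  apply: measurable_funN; apply: measurable_funM => //.
  exact: measurableT_comp.
have mU := measurable_fun_sub mG gmU; have mV := measurable_fun_sub mG gmV.
have mpos : measurable_fun setT pos.
  have -> : pos = \1_(x @^-1` `]0, +oo[).
    apply/funext => w; rewrite indicE /pos; congr ((nat_of_bool _)%:R).
    by apply/idP/idP => [?|/set_mem]; [apply/mem_set|];
      rewrite /= in_itv/= ?andbT.
  apply: measurable_indic; rewrite -[X in measurable X]setTI.
  exact: mx.
have mneg : measurable_fun setT neg.
  have -> : neg = \1_(x @^-1` `]-oo, 0[).
    apply/funext => w; rewrite indicE /neg; congr ((nat_of_bool _)%:R).
    by apply/idP/idP => [?|/set_mem]; [apply/mem_set|];
      rewrite /= in_itv/=.
  apply: measurable_indic; rewrite -[X in measurable X]setTI.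
  exact: mx.
have L0 w : 0 <= L w by rewrite mulr_ge0 ?expR_ge0.
have U0 w : 0 <= U w by rewrite !mulr_ge0 ?expR_ge0.
have V0 w : 0 <= V w by rewrite !mulr_ge0 ?expR_ge0.
have Z0 w : 0 <= Z w by rewrite mulr_ge0 ?expR_ge0.
have nul0 w : 0 <= 1 - pos w - neg w.
  by rewrite /pos /neg; case: (ltrgt0P (x w)) => _ /=; lra.
have pos0 w : 0 <= pos w by [].
have neg0 w : 0 <= neg w by [].
(* Coordinate [i] may vanish at an attack time as well. [D] collects this case, in which
   [expR (- (th * |a|))] lies below both exponentials, hence below their average. *)
pose D w := (U w + V w) * (1 - pos w - neg w).
have mD : measurable_fun setT D.
  apply: measurable_funM; first exact: measurable_funD.
  by apply: measurable_funB => //; exact: measurable_funB.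
have D0 w : 0 <= D w by apply: mulr_ge0 => //; exact: addr_ge0.
have mM (f g : Omega -> R) : measurable_fun setT f -> measurable_fun setT g ->
    measurable_fun setT (fun w => f w * g w).
  by move=> *; exact: measurable_funM.
have split5 (f1 f2 f3 f4 : Omega -> R) :
    (measurable_fun setT f1) -> (measurable_fun setT f2) ->
    (measurable_fun setT f3) -> (measurable_fun setT f4) ->
    (forall w, 0 <= f1 w) -> (forall w, 0 <= f2 w) ->
    (forall w, 0 <= f3 w) -> (forall w, 0 <= f4 w) ->
    (\int[P]_(w in E) (f1 w + (f2 w + (f3 w + (f4 w + D w))))%:E =
     \int[P]_(w in E) (f1 w)%:E + (\int[P]_(w in E) (f2 w)%:E +
     (\int[P]_(w in E) (f3 w)%:E + (\int[P]_(w in E) (f4 w)%:E +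
      \int[P]_(w in E) (D w)%:E))))%E.
  move=> m1 m2 m3 m4 p1' p2' p3' p4'.
  rewrite !integralD_EFin_ge0//;
    do ?[exact: measurable_funD | apply: measurable_funD => //];
    by move=> w; rewrite !addr_ge0.
have UE : (\int[P]_(w in E) (U w * pos w)%:E =
    \int[P]_(w in E) (U w * neg w)%:E)%E 
  by have := @cond_sign R d0 Omega n P G mG E X alpha beta mE malpha Q U i XE
    symE gmU U0.
have VE : (\int[P]_(w in E) (V w * pos w)%:E =
    \int[P]_(w in E) (V w * neg w)%:E)%E 
  by have := @cond_sign R d0 Omega n P G mG E X alpha beta mE malpha Q V i XE
    symE gmV V0.
(* Pointwise [L] is at most [2 U pos + 2 V neg + D]. One of the two copies of [U pos] is exchanged
   for [U neg] by [UE], and one copy of [V neg] for [V pos] by [VE]; the indicators then add up to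
   1. *)
have LE : (\int[P]_(w in E) (L w)%:E <= \int[P]_(w in E) (U w + V w)%:E)%E.
  apply: (@le_trans _ _ (\int[P]_(w in E) (U w * pos w + (U w * pos w +
      (V w * neg w + (V w * neg w + D w))))%:E)%E).
    apply: le_integral_EFin => //.
      do 4![apply: measurable_funD; first exact: mM]; exact: mD.
    move=> w _; rewrite L0/=.
    rewrite /D /pos /neg; case: (ltrgt0P (x w)) => x0 /=.
    - rewrite (_ : _ + _ = H w * expR (th * a w)); last by rewrite /U; field.
      apply: ler_wpM2l => //; rewrite ler_expR tilt_gt0//.
      by rewrite mulrN opprK.
    - rewrite (_ : _ + _ = H w * expR (- (th * a w))); last by rewrite /V; field.
      apply: ler_wpM2l => //; rewrite ler_expR tilt_lt0// lexx.
    - rewrite (_ : _ + _ = H w * ((expR (th * a w) + expR (- (th * a w))) / 2));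
        last by rewrite /U /V; field.
      apply: ler_wpM2l => //; rewrite x0 tilt0.
      have : expR (- (th * `|a w|)) <= expR (th * a w).
        by rewrite ler_expR -mulrN (ler_pM2l th0)// lerNl -normrN ler_norm.
      have : expR (- (th * `|a w|)) <= expR (- (th * a w)).
        by rewrite ler_expR lerN2 (ler_pM2l th0)// ler_norm.
      lra.
  rewrite split5//; do ?[exact: mM | by move=> w; rewrite mulr_ge0].
  rewrite {1}UE -{2}VE.
  rewrite [leRHS](_ : _ = \int[P]_(w in E) (U w * neg w + (U w * pos w +
      (V w * neg w + (V w * pos w + D w))))%:E)%E; last first.
    by apply: eq_integral => w _; congr EFin; rewrite /D; ring.
  rewrite split5//; do ?[exact: mM | by move=> w; rewrite mulr_ge0].
rewrite -[leLHS]/(\int[P]_w (L w)%:E)%E integral_split//.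
rewrite (_ : (\int[P]_(w in ~` E) (L w)%:E = \int[P]_(w in ~` E) (Z w)%:E)%E);
  last first.
  apply: eq_integral => w /set_mem/X0 Xw; rewrite /L /x Xw mxE.
  by rewrite tilt0.
rewrite integral_no_attack//.
apply: (@le_trans _ _ (p%:E * \int[P]_w (U w + V w)%:E +
    (1 - p)%:E * \int[P]_w (Z w)%:E)%E).
  rewrite leeD2r// (le_trans LE)// integral_attack//.
    exact: measurable_funD.
  by move=> w; rewrite addr_ge0.
have mZ := measurable_fun_sub mG gmZ.
rewrite -!integralZl_EFin_ge0//; last 4 first.
- by rewrite subr_ge0 ltW.
- exact: measurable_funD.
- by move=> w; rewrite addr_ge0.
- by rewrite ltW.
rewrite -integralD_EFin_ge0//; last 4 first.
- by apply: measurable_funM => //; exact: measurable_funD.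
- exact: measurable_funM.
- by move=> w; rewrite mulr_ge0 ?addr_ge0// ltW.
- by move=> w; rewrite mulr_ge0// subr_ge0 ltW.
apply: le_integral_EFin => //.
- apply: measurable_funD; apply: measurable_funM => //.
  exact: measurable_funD.
- apply: measurable_funM => //; apply: measurableT_comp => //.
  apply: measurable_funD.
    apply: measurable_funN; do 2![apply: measurable_funM => //].
    exact: measurableT_comp.
  by apply: measurable_funM => //; apply: measurable_funX; exact: measurable_funM.
- move=> w _; apply/andP; split.
    apply: addr_ge0; apply: mulr_ge0 => //; [exact: ltW|exact: addr_ge0|].
    by rewrite subr_ge0 ltW.
  rewrite (_ : 8 * (th * a w) ^+ 2 = 8 * (th * `|a w|) ^+ 2); last first.
    by rewrite !exprMn real_normK ?num_real.
  have := @hoeffding_three_point _ p (th * `|a w|).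
  rewrite (ltW p0) (ltW p1) => /(_ isT) /(ler_wpM2l (H0 w)); apply: le_trans.
  rewrite le_eqVlt; apply/orP; left; apply/eqP; rewrite /U /V /Z.
  have [a0|a0] := leP 0 (a w); first by rewrite (ger0_norm a0); field.
  by rewrite (ltr0_norm a0) mulrN opprK; field.
Qed.

End sign.

End one_step.

(** * One step of the energy *)

Section sub_gaussian_steps.
Context {R : realType} {d0} {Omega : measurableType d0} {n : nat}.
Variables (P : probability Omega R) (G : set (set Omega)).
Hypothesis mG : <<s G >> `<=` measurable.
Variables (E : set Omega) (X : Omega -> 'cV[R]_n) (p sigma s lambda : R).
Hypotheses (mE : measurable E) (mX : measurable_fun setT X).
Hypothesis p01 : 0 < p < 1.
Hypothesis X0 : forall w, ~ E w -> X w = 0.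
Hypothesis condE : is_cond_prob P G (~` E) (cst (1 - p)%:E).
Hypotheses (sigma0 : 0 < sigma) (sigma_s : sigma < s).
Hypothesis subE :
  cond_law_sat P G E X (fun mu => psi2_normv mu id <= sigma%:E)%E.

Let GT := g_sigma_algebraType G.

Let s0 : 0 < s. Proof. exact: lt_trans sigma_s. Qed.

Let mXz z : measurable_fun setT (fun w => dotv (X w) z).
Proof. exact: (measurableT_comp (measurable_dotv z)). Qed.

Let me c z : measurable_fun setT (fun w => expR (dotv (X w) z ^+ 2 / c ^+ 2)).
Proof.
apply: measurableT_comp => //; apply: measurable_funM => //.
exact: measurable_funX.
Qed.

Lemma attack_sub_gaussian (H : GT -> R) z :
  measurable_fun setT H -> (forall w, 0 <= H w) -> norm2 z <= 1 ->
  (\int[P]_(w in E) (H w * expR (dotv (X w) z ^+ 2 / s ^+ 2))%:E <=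
   2%:E * \int[P]_(w in E) (H w)%:E)%E.
Proof.
by move=> *; exact: (cond_sub_gaussian mG mE mX subE).
Qed.

Let P_E : P E = p%:E.
Proof.
have := attack_prob mG mE condE (A := setT).
by rewrite setTI probability_setT mule1; apply; 
  exact: (@measurableT _ (g_sigma_algebraType G)).
Qed.

Let int_cst r : (\int[P]_(w in E) (cst r w)%:E = (r * p)%:E)%E.
Proof.
transitivity (r%:E * P E)%E; first exact: (integral_cst P mE r%:E).
by rewrite P_E EFinM.
Qed.

Lemma attack_norm1 :
  (\int[P]_(w in E) (norm1 (X w))%:E <= (n%:R * (s * (2 * p)))%:E)%E.
Proof.
apply: integral_norm1_le => // z z1.
have := @attack_sub_gaussian (cst 1) z (measurable_cst _) (fun=> ler01) z1.
rewrite int_cst mul1r EFinM; apply: le_trans; rewrite le_eqVlt; apply/orP; left.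
by apply/eqP/eq_integral => w _; rewrite /cst mul1r.
Qed.

Let sqr_le x : x ^+ 2 <= s ^+ 2 * (expR (x ^+ 2 / s ^+ 2) - 1).
Proof.
rewrite mulrC -ler_pdivrMr ?exprn_gt0// lerBrDl -expr_div_n.
exact: expR_sqr_ge.
Qed.

Lemma attack_sqr_lty i : (\int[P]_(w in E) (X w i ord0 ^+ 2)%:E < +oo)%E.
Proof.
have := @attack_sub_gaussian (cst 1) _ (measurable_cst _) (fun=> ler01).
move=> /(_ (delta_mx i ord0)); rewrite norm2_delta => /(_ (lexx _)).
rewrite int_cst mul1r.
move=> h; apply: (@le_lt_trans _ _ (s ^+ 2 * (2 * p))%:E); last exact: ltry.
rewrite 2!EFinM; apply: (le_trans _ (lee_wpmul2l _ h)); last first.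
  by rewrite lee_fin sqr_ge0.
rewrite -integralZl_EFin_ge0//; last 3 first.
- exact: measurable_funM.
- by move=> w; rewrite mulr_ge0// expR_ge0.
- exact: sqr_ge0.
apply: le_integral_EFin => //.
- by apply: measurable_funX; exact: (measurableT_comp (measurable_coord i)).
- by apply: measurable_funM => //; exact: measurable_funM.
- move=> w _; rewrite sqr_ge0 dotv_delta /cst mul1r.
  have := sqr_le (X w i ord0); have := sqr_ge0 s; lra.
Qed.

(** The factor 2 of the sub-Gaussian bound is paid at attack times only, and
    [2 * p + (1 - p) = 1 + p]. This keeps the total energy proportional to [p T] instead of [T]. *)
Lemma exp_step (I : finType) (c : I -> R) (z : I -> 'cV[R]_n) (H : GT -> R) :
  (forall i, 0 <= c i) -> \sum_i c i <= 1 -> (forall i, norm2 (z i) <= 1) ->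
  measurable_fun setT H -> (forall w, 0 <= H w) ->
  (\int[P]_w (H w * expR (\sum_i c i * (dotv (X w) (z i) ^+ 2 / s ^+ 2)))%:E <=
   (1 + p)%:E * \int[P]_w (H w)%:E)%E.
Proof.
move=> c0 c1 z1 mH H0; have mH' := measurable_fun_sub mG mH.
have mS : measurable_fun setT (fun w =>
    expR (\sum_i c i * (dotv (X w) (z i) ^+ 2 / s ^+ 2))).
  apply: measurableT_comp => //; apply: measurable_sum => i.
  by do 2![apply: measurable_funM => //]; exact: measurable_funX.
rewrite (integral_split P mE (measurable_funM mH' mS)); last first.
  by move=> w; rewrite mulr_ge0 ?expR_ge0.
have -> : (1 + p)%:E = (2%:E * p%:E + (1 - p)%:E :> \bar R)%E.
  by rewrite -EFinM -EFinD; congr EFin; ring.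
rewrite ge0_muleDl; last 2 first.
- by rewrite lee_fin mulr_ge0//; case/andP: p01 => /ltW.
- by rewrite lee_fin subr_ge0; case/andP: p01 => _ /ltW.
apply: leeD; last first.
  rewrite -(integral_no_attack mG mE p01 condE)//.
  rewrite le_eqVlt; apply/orP; left; apply/eqP/eq_integral => w /set_mem nE /=.
  rewrite X0//.
  rewrite big1 ?expR0 ?mulr1// => i _.
  by rewrite dotv0l expr0n mul0r mulr0.
rewrite -muleA -(integral_attack mG mE p01 condE)//.
apply: integral_exp_convex => //; first by rewrite ler1n.
by move=> i; exact: attack_sub_gaussian.
Qed.

End sub_gaussian_steps.

(** * One step of the excitation: the small-ball estimate *)

Section small_ball.
Context {R : realType} {d0} {Omega : measurableType d0} {n : nat}.
Variables (P : probability Omega R) (G : set (set Omega)).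
Hypothesis mG : <<s G >> `<=` measurable.
Variables (E : set Omega) (X : Omega -> 'cV[R]_n) (p sigma s lambda : R).
Hypotheses (mE : measurable E) (mX : measurable_fun setT X).
Hypothesis p01 : 0 < p < 1.
Hypothesis X0 : forall w, ~ E w -> X w = 0.
Hypothesis condE : is_cond_prob P G (~` E) (cst (1 - p)%:E).
Hypotheses (sigma0 : 0 < sigma) (sigma_s : sigma < s) (lambda0 : 0 < lambda).
Hypothesis subE :
  cond_law_sat P G E X (fun mu => psi2_normv mu id <= sigma%:E)%E.
Hypothesis ndE : cond_law_sat P G E X
  (fun mu => forall x, loewner_le (lambda ^+ 2)%:M (second_moment mu x)).

Let GT := g_sigma_algebraType G.

Let s0 : 0 < s. Proof. exact: lt_trans sigma_s. Qed.

Let mXz z : measurable_fun setT (fun w => dotv (X w) z).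
Proof. exact: (measurableT_comp (measurable_dotv z)). Qed.

Let me z : measurable_fun setT (fun w => expR (dotv (X w) z ^+ 2 / s ^+ 2)).
Proof.
apply: measurableT_comp => //; apply: measurable_funM => //.
exact: measurable_funX.
Qed.

Let fin_real (x : \bar R) (c : R) : (0 <= x)%E -> (x <= c%:E)%E ->
  exists2 r : R, 0 <= r & x = r%:E.
Proof. by case: x => [r| |]//; exists r. Qed.

Let fin_real_scaled (x : \bar R) (k c : R) : 0 < k -> (0 <= x)%E ->
  (k%:E * x <= c%:E)%E -> exists2 r : R, 0 <= r & x = r%:E.
Proof.
move=> k0; case: x => [r| |]//; first by exists r.
by rewrite gt0_muley ?lte_fin// leye_eq.
Qed.

Let le_scaled_exp x : x <= s ^+ 2 * expR (x / s ^+ 2) - s ^+ 2.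
Proof.
have s2 : 0 < s ^+ 2 by rewrite exprn_gt0.
have := ler_wpM2l (ltW s2) (expR_ge1Dx (x / s ^+ 2)).
have -> : s ^+ 2 * (1 + x / s ^+ 2) = s ^+ 2 + x by field; rewrite gt_eqF.
lra.
Qed.

Lemma non_degenerate_le (H b : GT -> R) z :
  measurable_fun setT H -> measurable_fun setT b ->
  (forall w, 0 <= H w) -> norm2 z = 1 ->
  ((lambda ^+ 2)%:E * \int[P]_(w in E) (H w)%:E <=
   \int[P]_(w in E) (H w * (b w + dotv (X w) z) ^+ 2)%:E)%E.
Proof.
move=> mH mb H0 z1; apply: (cond_non_degenerate mG mE mX ndE) => //.
exact: (attack_sqr_lty mG mE mX condE sigma0 sigma_s subE).
Qed.

(** A Paley-Zygmund argument in exponential form. [expRN_quartic] is used with the random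
    coefficient [r = rho / (b^2 + 4 s^2)]: the shift [b] is unbounded, and this choice keeps the
    fourth-moment term [r^2 Y^4] of order [rho^2] in conditional mean whatever the size of [b]. *)
Lemma small_ball_step (H b : GT -> R) z : lambda <= s ->
  measurable_fun setT H -> measurable_fun setT b ->
  (forall w, 0 <= H w <= 1) -> norm2 z = 1 ->
  (\int[P]_w (H w * expR (- (`|b w + dotv (X w) z| / lambda)))%:E <=
   (1 - p * (lambda ^+ 4 / (4096 * s ^+ 4)))%:E * \int[P]_w (H w)%:E)%E.
Proof.
move=> ls mH mb H01 z1.
have H0 w : 0 <= H w by case/andP: (H01 w).
have H1 w : H w <= 1 by case/andP: (H01 w).
have mH' := measurable_fun_sub mG mH; have mb' := measurable_fun_sub mG mb.
(* The rate obtained at attack times is [4 * rho ^+ 2], which is the stated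
   [lambda ^+ 4 / (4096 * s ^+ 4)]; [lambda <= s] gives [rho <= 1 / 128]. *)
pose rho := lambda ^+ 2 / (128 * s ^+ 2).
have s2 : 0 < s ^+ 2 by rewrite exprn_gt0.
have l2 : 0 < lambda ^+ 2 by rewrite exprn_gt0.
have ls2 : lambda ^+ 2 <= s ^+ 2 
  by rewrite ler_pXn2r// nnegrE ltW.
have rhoE : 128 * s ^+ 2 * rho = lambda ^+ 2.
  by rewrite /rho mulrC divfK// gt_eqF// mulr_gt0.
have rho0 : 0 < rho by rewrite divr_gt0// mulr_gt0.
pose q (w : Omega) : R := b w ^+ 2 + 4 * s ^+ 2.
pose r (w : Omega) : R := rho / q w.
have q0 w : 0 < q w.
  by have := sqr_ge0 (b w); rewrite /q; lra.
have rq w : r w * q w = rho by rewrite /r divfK// gt_eqF.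
have r0 w : 0 < r w by rewrite divr_gt0.
have mq : measurable_fun setT (q : GT -> R).
  by apply: measurable_funD => //; exact: measurable_funX.
have mr : measurable_fun setT (r : GT -> R).
  have -> : r = fun w => rho * expR (- ln (q w)).
    by apply/funext => w; rewrite expRN lnK// posrE.
  apply: measurable_funM => //; apply: measurableT_comp => //.
  apply: measurable_funN; exact: measurableT_comp.
have mHr : measurable_fun setT (fun w : GT => H w * r w : R) by exact: measurable_funM.
have Hr0 w : 0 <= H w * r w by rewrite mulr_ge0// ltW.
have mHr' := measurable_fun_sub mG mHr.
pose Y (w : Omega) : R := b w + dotv (X w) z.
have mY : measurable_fun setT Y by exact: measurable_funD.
pose e (w : Omega) : R := expR (- (`|Y w| / lambda)).
have mec : measurable_fun setT e.
  apply: measurableT_comp => //; apply: measurable_funN.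
  by apply: measurable_funM => //; exact: measurableT_comp.
have e0 w : 0 <= e w by exact: expR_ge0.
have e1 w : e w <= 1 by rewrite -expR0 ler_expR oppr_le0 divr_ge0// ltW.
have mHe : measurable_fun setT (fun w : Omega => H w * e w) by exact: measurable_funM.
pose D := (\int[P]_(w in E) (H w)%:E)%E.
pose A := (\int[P]_(w in E) (H w * e w)%:E)%E.
pose I := (\int[P]_(w in E) (H w * r w * Y w ^+ 2)%:E)%E.
pose J := (\int[P]_(w in E) (H w * r w)%:E)%E.
pose B := (\int[P]_(w in E) (H w * r w * b w ^+ 2)%:E)%E.
pose F := (\int[P]_(w in E) (H w * r w ^+ 2 * Y w ^+ 4)%:E)%E.
have ge0 (f : Omega -> R) : (forall w, 0 <= f w) ->
    (0 <= \int[P]_(w in E) (f w)%:E)%E.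
  by move=> f0; apply: integral_ge0 => w _; rewrite lee_fin.
have PE1 : (\int[P]_(w in E) (1 : R)%:E <= 1%:E)%E.
  by rewrite integral_cst// mul1e; exact: probability_le1.
have D1 : (D <= 1%:E)%E.
  apply: le_trans PE1.
  exact: (@le_integral_EFin _ _ _ P E H (fun=> 1)).
have mI : measurable_fun setT (fun w : Omega => H w * r w * Y w ^+ 2).
  by apply: measurable_funM => //; exact: measurable_funX.
have I0 w : 0 <= H w * r w * Y w ^+ 2 by rewrite mulr_ge0// sqr_ge0.
pose e2 (w : Omega) := expR (dotv (X w) z ^+ 2 / s ^+ 2).
have mr' : measurable_fun setT r by exact: (measurable_fun_sub mG mr).
have mHr2 : measurable_fun setT (fun w : GT => H w * r w ^+ 2 : R).
  by apply: measurable_funM => //; exact: measurable_funX.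
have mHr2' := measurable_fun_sub mG mHr2.
have Hr20 w : 0 <= H w * r w ^+ 2 by rewrite mulr_ge0// sqr_ge0.
have mF : measurable_fun setT (fun w : Omega => H w * r w ^+ 2 * Y w ^+ 4).
  by apply: measurable_funM => //; exact: measurable_funX.
have Y40 (y : R) : 0 <= y ^+ 4 by rewrite (exprM y 2 2) sqr_ge0.
have F0 w : 0 <= H w * r w ^+ 2 * Y w ^+ 4 by rewrite mulr_ge0.
have qE w : q w = b w ^+ 2 + 4 * s ^+ 2 by [].
have rl w : r w * lambda ^+ 2 <= 1.
  have : r w * lambda ^+ 2 <= r w * q w.
    by rewrite ler_pM2l// qE; have := sqr_ge0 (b w); lra.
  rewrite rq => /le_trans; apply; rewrite /rho ler_pdivrMr ?mulr_gt0//; lra.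
have step1 : (A + 2^-1%:E * I <= D + 2^-1%:E * F)%E.
  rewrite /A /I /D /F -!integralZl_EFin_ge0// -!integralD_EFin_ge0//;
    do ?[exact: measurable_funM | by move=> w; rewrite mulr_ge0].
  apply: le_integral_EFin => //; do ?[by apply: measurable_funD => //;
    exact: measurable_funM].
  move=> w _; apply/andP; split; first by rewrite addr_ge0// mulr_ge0.
  have := expRN_quartic (Y w) lambda0 (ltW (r0 w)) (rl w).
  by move=> /(ler_wpM2l (H0 w)); rewrite -/(e w); lra.
have subg (K : GT -> R) : measurable_fun setT K -> (forall w, 0 <= K w) ->
    (\int[P]_(w in E) (K w * e2 w)%:E <= 2%:E * \int[P]_(w in E) (K w)%:E)%E.
  move=> mK K0.
  by apply: (attack_sub_gaussian mG mE mX sigma_s subE) => //; rewrite z1.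
have mb4 : measurable_fun setT (fun w : Omega => H w * r w ^+ 2 * b w ^+ 4).
  by apply: measurable_funM => //; exact: measurable_funX.
have b40 w : 0 <= H w * r w ^+ 2 * b w ^+ 4 by rewrite mulr_ge0.
have me2 : measurable_fun setT e2 by exact: me.
have e20 w : 0 <= e2 w by exact: expR_ge0.
have c1 : 0 <= 32 * s ^+ 4 by rewrite mulr_ge0.
have c2 : 0 <= 32 * s ^+ 4 * 2 by rewrite mulr_ge0.
have c3 : 0 <= 8 * rho ^+ 2 by rewrite mulr_ge0// sqr_ge0.
(* With [W = dotv (X w) z]: [(b + W)^4 <= 8 b^4 + 8 W^4], [W^4 <= 4 s^4 e2], and the conditional
   mean of [e2] is at most 2. The sum [8 b^4 + 64 s^4] is below [8 q^2], and [r q = rho]. *)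
have step2 : (F <= (8 * rho ^+ 2)%:E * D)%E.
  apply: (@le_trans _ _ (\int[P]_(w in E) (8 * (H w * r w ^+ 2 * b w ^+ 4) +
      32 * s ^+ 4 * (H w * r w ^+ 2 * e2 w))%:E)%E).
    apply: le_integral_EFin => //.
      by apply: measurable_funD; do 2![apply: measurable_funM => //].
    move=> w _; rewrite F0 /=.
    rewrite (_ : _ + _ = H w * r w ^+ 2 * (8 * b w ^+ 4 + 32 * s ^+ 4 * e2 w));
      last by ring.
    apply: ler_wpM2l => //; rewrite /Y; set W := dotv (X w) z.
    have h4 : W ^+ 4 <= 4 * s ^+ 4 * e2 w.
      have := expR_sqr_ge4 (W / s); rewrite !expr_div_n -/(e2 w).
      by rewrite ler_pdivrMr ?exprn_gt0//; lra.
    have h2 : (b w + W) ^+ 2 <= 2 * b w ^+ 2 + 2 * W ^+ 2.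
      by have := sqr_ge0 (b w - W); rewrite !expr2; lra.
    have h3 : (b w + W) ^+ 4 <= (2 * b w ^+ 2 + 2 * W ^+ 2) ^+ 2.
      rewrite (_ : (b w + W) ^+ 4 = (b w + W) ^+ 2 ^+ 2); last by rewrite -exprM.
      rewrite ler_pXn2r// nnegrE ?sqr_ge0//.
      by rewrite addr_ge0// mulr_ge0// sqr_ge0.
    have h5 := sqr_ge0 (b w ^+ 2 - W ^+ 2).
    have -> : 32 * s ^+ 4 * e2 w = 8 * (4 * s ^+ 4 * e2 w) by ring.
    have E4 (y : R) : y ^+ 4 = (y ^+ 2) ^+ 2 by rewrite -exprM.
    move: h3 h4 h5; rewrite !E4 !expr2; lra.
  rewrite integralD_EFin_ge0//; do ?[by apply: measurable_funM => //;
    exact: measurable_funM | by move=> w; rewrite mulr_ge0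
    | by move=> w; rewrite mulr_ge0// mulr_ge0].
  rewrite !integralZl_EFin_ge0//; do ?[exact: measurable_funM |
    by move=> w; rewrite mulr_ge0 | by rewrite mulr_ge0// exprn_ge0// ltW].
  apply: (@le_trans _ _ (8%:E * (\int[P]_(w in E) (H w * r w ^+ 2 * b w ^+ 4)%:E) +
      (32 * s ^+ 4)%:E * (2%:E * \int[P]_(w in E) (H w * r w ^+ 2)%:E))%E).
    rewrite leeD2l// lee_wpmul2l ?lee_fin//.
    exact: subg.
  rewrite muleA -EFinM -!integralZl_EFin_ge0//.
  rewrite -integralD_EFin_ge0//; do ?[exact: measurable_funM |
    by move=> w; rewrite mulr_ge0].
  apply: le_integral_EFin => //; do ?[exact: measurable_funM |
    by apply: measurable_funD; exact: measurable_funM].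
  move=> w _; apply/andP; split; first by rewrite addr_ge0// mulr_ge0.
  rewrite -(rq w) qE; have := Hr20 w; set h := H w; set t := r w.
  have -> : 8 * (t * (b w ^+ 2 + 4 * s ^+ 2)) ^+ 2 * h =
    8 * (h * t ^+ 2 * b w ^+ 4) + 64 * (h * t ^+ 2) * (b w ^+ 2 * s ^+ 2) +
    128 * s ^+ 4 * (h * t ^+ 2) by ring.
  move=> h0.
  have : 0 <= h * t ^+ 2 * (b w ^+ 2 * s ^+ 2).
    by apply: mulr_ge0 => //; apply: mulr_ge0; exact: sqr_ge0.
  have : 0 <= h * t ^+ 2 * s ^+ 4 by rewrite mulr_ge0.
  lra.
(* Two lower bounds for the second moment: [step3] serves for small [b], [step4] for large [b]. The
   latter is [Y^2 >= b^2 / 2 - W^2] together with [W^2 <= s^2 (e2 - 1)], written without subtraction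
   because the integrals are extended reals. *)
have step3 : ((lambda ^+ 2)%:E * J <= I)%E by exact: non_degenerate_le.
have mB : measurable_fun setT (fun w : Omega => H w * r w * b w ^+ 2).
  by apply: measurable_funM => //; exact: measurable_funX.
have B0 w : 0 <= H w * r w * b w ^+ 2 by rewrite mulr_ge0// sqr_ge0.
have mHre2 : measurable_fun setT (fun w : Omega => H w * r w * e2 w).
  exact: measurable_funM.
have Hre20 w : 0 <= H w * r w * e2 w by rewrite mulr_ge0.
have s20 : 0 <= s ^+ 2 by exact: sqr_ge0.
have step4 : (2^-1%:E * B + (s ^+ 2)%:E * J <= I + (2 * s ^+ 2)%:E * J)%E.
  apply: (@le_trans _ _ (I + (s ^+ 2)%:E *
      \int[P]_(w in E) (H w * r w * e2 w)%:E)%E); last first.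
    rewrite leeD2l// (_ : (2 * s ^+ 2)%:E * J = (s ^+ 2)%:E * (2%:E * J))%E.
      by rewrite lee_wpmul2l ?lee_fin//; exact: subg.
    by rewrite muleA -EFinM; congr (_%:E * _)%E; ring.
  rewrite /B /J /I -!integralZl_EFin_ge0//; do ?[by move=> w; rewrite mulr_ge0].
  rewrite -!integralD_EFin_ge0//; do ?[exact: measurable_funM |
    by move=> w; rewrite mulr_ge0 | by move=> w; rewrite mulr_ge0// invr_ge0].
  apply: le_integral_EFin => //; do ?[by apply: measurable_funD => //;
    exact: measurable_funM].
  move=> w _; apply/andP; split; first by rewrite addr_ge0// mulr_ge0.
  have : 2^-1 * b w ^+ 2 + s ^+ 2 <= Y w ^+ 2 + s ^+ 2 * e2 w.
    have := le_scaled_exp (dotv (X w) z ^+ 2); rewrite -/(e2 w) /Y.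
    have := sqr_ge0 (b w + 2 * dotv (X w) z); rewrite !expr2; lra.
  by move=> /(ler_wpM2l (Hr0 w)); lra.
have step5 : (B + (4 * s ^+ 2)%:E * J = rho%:E * D)%E.
  rewrite /B /J /D -!integralZl_EFin_ge0//; do ?[by rewrite mulr_ge0 | exact: ltW].
  rewrite -integralD_EFin_ge0//; do ?[exact: measurable_funM |
    by move=> w; rewrite mulr_ge0// mulr_ge0].
  by apply: eq_integral => u _; congr EFin; rewrite -(rq u) qE; ring.
have key : (A <= (1 - 4 * rho ^+ 2)%:E * D)%E.
  have [d d0' dE] := fin_real (ge0 _ H0) D1; rewrite -/D in dE.
  have J0 : (0 <= J)%E by exact: ge0.
  have BJ : (B <= (rho * d)%:E /\ (4 * s ^+ 2)%:E * J <= (rho * d)%:E)%E.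
    rewrite EFinM -dE -step5; split.
      by rewrite leeDl// mule_ge0// lee_fin mulr_ge0.
    by rewrite leeDr// ge0.
  have [b' b'0 BE] := fin_real (ge0 _ B0) BJ.1; rewrite -/B in BE.
  have [j j0 JE] : exists2 j : R, 0 <= j & J = j%:E.
    by apply: (fin_real_scaled _ J0 BJ.2); rewrite mulr_gt0.
  have F2 : (F <= (8 * rho ^+ 2 * d)%:E)%E by rewrite [leRHS]EFinM -dE; exact: step2.
  have [f f0 FE] := fin_real (ge0 _ F0) F2; rewrite -/F in FE.
  have A0 : (0 <= A)%E by apply: ge0 => w; rewrite mulr_ge0.
  have II0 : (0 <= I)%E by exact: ge0.
  have [a a0 AE] : exists2 a : R, 0 <= a & A = a%:E.
    apply: (@fin_real _ (d + 2^-1 * f)) => //.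
    by rewrite EFinD EFinM -dE -FE (le_trans _ step1)// leeDl// mule_ge0// lee_fin.
  have [i i0 IE] : exists2 i : R, 0 <= i & I = i%:E.
    apply: (@fin_real_scaled _ 2^-1 (d + 2^-1 * f)) => //.
    by rewrite EFinD EFinM -dE -FE (le_trans _ step1)// leeDr.
  move: step1 step3 step4 step5 F2; rewrite dE BE JE FE AE IE.
  rewrite -!EFinM -!EFinD !lee_fin => h1 h3 h4 [h5] h2.
  rewrite -rhoE in h3.
  have rho1 : rho <= 1 / 128.
    by rewrite /rho ler_pdivrMr ?mulr_gt0//; lra.
  pose k := s ^+ 2 * j.
  have k0 : 0 <= k by rewrite mulr_ge0.
  have h3' : 128 * rho * k <= i by rewrite /k; lra.
  have h4' : 2^-1 * b' - k <= i by rewrite /k; lra.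
  have h5' : b' = rho * d - 4 * k by rewrite /k; lra.
  (* The bounds [128 rho k] and [rho d / 2 - 3 k] are averaged with weights [1 - 32 rho] and
     [32 rho]. The coefficient of [k] becomes [32 rho (1 - 128 rho)], which is nonnegative, and
     [16 rho^2 d] remains. Half of it exceeds half of the bound on [f] by [4 rho^2 d]. *)
  have hi : 16 * rho ^+ 2 * d <= i.
    have : (1 - 32 * rho) * (128 * rho * k) <= (1 - 32 * rho) * i.
      by apply: ler_wpM2l => //; lra.
    have : 32 * rho * (2^-1 * b' - k) <= 32 * rho * i.
      by apply: ler_wpM2l => //; lra.
    have : 0 <= rho * k * (1 - 128 * rho).
      by apply: mulr_ge0; [apply: mulr_ge0 => //; exact: ltW|lra].
    rewrite h5' !expr2; lra.
  lra.
have kappaE : lambda ^+ 4 / (4096 * s ^+ 4) = 4 * rho ^+ 2.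
  by rewrite /rho; field; rewrite gt_eqF.
rewrite kappaE (integral_split P mE mHe) //; last first.
  by move=> w; rewrite mulr_ge0.
have DE : D = (p%:E * \int[P]_w (H w)%:E)%E.
  exact: (integral_attack mG mE p01 condE).
have ND : (\int[P]_(w in ~` E) (H w * e w)%:E <=
    (1 - p)%:E * \int[P]_w (H w)%:E)%E.
  rewrite -(integral_no_attack mG mE p01 condE)//.
  apply: le_integral_EFin => //; first exact: measurableC.
  by move=> w _; rewrite mulr_ge0//= ler_piMr.
apply: (le_trans (leeD key ND)); rewrite DE muleA -EFinM.
have [h h0 ->] : exists2 h : R, 0 <= h & (\int[P]_w (H w)%:E = h%:E)%E.
  apply: (@fin_real _ 1); first by apply: integral_ge0 => w _; rewrite lee_fin.
  apply: (@le_trans _ _ (\int[P]_w (1 : R)%:E)%E); last first.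
    by rewrite integral_cst// mul1e; exact: probability_le1.
  exact: (@le_integral_EFin _ _ _ P setT H (fun=> 1)).
rewrite -!EFinM -EFinD lee_fin; lra.
Qed.

(** The second moment along [z] at attack times is at least [lambda^2] by non-degeneracy, and at
    most [s^2 (2 - 1)] because [y <= s^2 (exp (y / s^2) - 1)]. *)
Lemma lambda_le (z : 'cV[R]_n) : norm2 z = 1 -> lambda <= s.
Proof.
move=> z1; have p0 : 0 < p by case/andP: p01.
have P_E : (\int[P]_(w in E) (1 : R)%:E = p%:E)%E.
  rewrite (integral_attack mG mE p01 condE (H := cst 1))//.
  rewrite (_ : (\int[P]_w (cst 1 w)%:E = 1%:E)%E) ?mule1//.
  transitivity (1%:E * P setT)%E.
    exact: (integral_cst P (@measurableT _ Omega) 1%:E).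
  by rewrite mul1e; exact: probability_setT.
have nd := @non_degenerate_le (cst 1) (cst 0) z (measurable_cst _)
  (measurable_cst _) (fun=> ler01) z1.
have := attack_sub_gaussian mG mE mX sigma_s subE (H := cst 1) (z := z)
  (measurable_cst _) (fun=> ler01).
rewrite z1 => /(_ (lexx _)) sub.
have s2 : 0 < s ^+ 2 by rewrite exprn_gt0.
have nd' : ((lambda ^+ 2)%:E * p%:E <=
    \int[P]_(w in E) (dotv (X w) z ^+ 2)%:E)%E.
  rewrite -P_E; apply: (le_trans nd); rewrite le_eqVlt; apply/orP; left.
  by apply/eqP/eq_integral => w _; rewrite /cst mul1r add0r.
have sub' : (\int[P]_(w in E) (expR (dotv (X w) z ^+ 2 / s ^+ 2))%:E <=
    2%:E * p%:E)%E.
  rewrite -P_E; apply: le_trans sub; rewrite le_eqVlt; apply/orP; left.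
  by apply/eqP/eq_integral => w _; rewrite /cst mul1r.
have s20 := ltW s2.
have mX2 : measurable_fun setT (fun w => dotv (X w) z ^+ 2).
  exact: measurable_funX.
have : ((lambda ^+ 2)%:E * p%:E + (s ^+ 2)%:E * p%:E <=
    (s ^+ 2)%:E * (2%:E * p%:E))%E.
  apply: le_trans (lee_wpmul2l _ sub'); last by rewrite lee_fin.
  apply: (le_trans (leeD nd' (lexx _))).
  rewrite -P_E -!integralZl_EFin_ge0//.
  rewrite -integralD_EFin_ge0//; do ?[by move=> w; exact: sqr_ge0 |
    by move=> w; rewrite mulr1 | exact: measurable_funM].
  apply: le_integral_EFin => //.
  - by apply: measurable_funD => //; exact: measurable_funM.
  - exact: measurable_funM.
  - move=> w _; rewrite mulr1 addr_ge0 ?sqr_ge0//=.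
    have := le_scaled_exp (dotv (X w) z ^+ 2); lra.
rewrite -!EFinM -EFinD lee_fin => h.
rewrite -(ler_pXn2r (n := 2)) ?nnegrE ?(ltW s0) ?(ltW lambda0)//.
rewrite -(ler_pM2r p0); lra.
Qed.

End small_ball.

(** * Pathwise bounds along the trajectory *)

Section trajectory.
Context {R : realType} {d0} {Omega : measurableType d0} {d : nat}.
Variables (A : 'M[R]_d) (x0 : Omega -> 'cV[R]_d) (w : nat -> Omega -> 'cV[R]_d).

Local Notation x := (state x0 w A).
Local Notation F t := (g_sigma_algebraType (history x0 w t)).

Lemma history_sub T t : measurable_fun setT x0 ->
  (forall k, (k < T)%N -> measurable_fun setT (w k)) -> (t <= T)%N ->
  <<s history x0 w t >> `<=` measurable.
Proof.
move=> mx0 mw tT; apply: smallest_sub; first exact: sigma_algebra_measurable.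
move=> _ [[B mB <-]|[k kt [B mB <-]]]; rewrite -[X in measurable X]setTI.
  exact: mx0.
by apply: mw => //; exact: leq_trans tT.
Qed.

Lemma measurable_history_x0 t : measurable_fun setT (x0 : F t -> 'cV[R]_d).
Proof.
by move=> _ B mB; rewrite setTI; apply: sub_gen_smallest; left; exists B.
Qed.

Lemma measurable_history_w t k : (k < t)%N ->
  measurable_fun setT (w k : F t -> 'cV[R]_d).
Proof.
move=> kt _ B mB; rewrite setTI; apply: sub_gen_smallest; right.
by exists k => //; exists B.
Qed.

Lemma measurable_history_state t k : (k <= t)%N ->
  measurable_fun setT (x k : F t -> 'cV[R]_d).
Proof.
elim: k => [_|k ih kt]; first exact: measurable_history_x0.
apply: measurable_fun_cV => i.
have -> : (fun u => x k.+1 u i ord0) =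
    (fun u => \sum_j A i j * x k u j ord0 + w k u i ord0).
  by apply/funext => u; rewrite /= !mxE.
apply: measurable_funD; last first.
  by apply: (measurableT_comp (measurable_coord i)); exact: measurable_history_w.
apply: measurable_sum => j; apply: measurable_funM => //.
by apply: (measurableT_comp (measurable_coord j)); apply: ih; exact: ltnW.
Qed.

Lemma measurable_history_dotv t k (z : 'cV[R]_d) : (k <= t)%N ->
  measurable_fun setT ((fun u => dotv (x k u) z) : F t -> R).
Proof.
by move=> kt; apply: (measurableT_comp (measurable_dotv z));
  exact: measurable_history_state.
Qed.

Lemma dotv_stateS t u z :
  dotv (x t.+1 u) z = dotv (x t u) (A^T *m z) + dotv (w t u) z.
Proof. by rewrite /= dotvDl dotv_mulmx. Qed.

(* The sequence [x_0, w_0, w_1, ...], so that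
   [x_t = \sum_(j <= t) A ^+ (t - j) input_j]. *)
Definition input (t : nat) (u : Omega) : 'cV[R]_d := if t is k.+1 then w k u else x0 u.

(** The backward directions rescaled by [r^-j]: for [opnorm2 A <= r] they do not grow, and the decay
    is carried by weights [r^j]. A separate [r > 0] is used because [opnorm2 A] may be 0. *)
Definition dir (r : R) (z : 'cV[R]_d) (j : nat) : 'cV[R]_d :=
  iter j (fun v => r^-1 *: (A^T *m v)) z.

Lemma norm2_dir r z j : 0 < r -> opnorm2 A <= r -> norm2 (dir r z j) <= norm2 z.
Proof.
move=> r0 Ar; elim: j => //= j ih; rewrite norm2Z gtr0_norm ?invr_gt0//.
rewrite mulrC ler_pdivrMr// (le_trans (norm2_mulmx_tr _ _))// mulrC.
by rewrite ler_pM ?norm2_ge0 ?opnorm2_ge0.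
Qed.

Lemma dir_shift r z j : dir r (r^-1 *: (A^T *m z)) j = dir r z j.+1.
Proof. by rewrite /dir iterSr. Qed.

(** Convexity of the square with weights [r] and [1 - r] gives
    [(r a + b)^2 <= r a^2 + b^2 / (1 - r)]. Going one step back replaces [z] by [r^-1 A^T z], so the
    induction leaves [z] free. The double sum holds more pairs than the recursion produces; the
    extra ones are nonnegative and make the weights the same for all [t]. *)
Lemma energy_le (r : R) (z : 'cV[R]_d) (n : nat) (u : Omega) : 0 < r < 1 ->
  \sum_(t < n) dotv (x t u) z ^+ 2 <=
  (1 - r)^-1 * \sum_(t < n) \sum_(j < n)
     r ^+ j * dotv (input t u) (dir r z j) ^+ 2.
Proof.
move=> /andP[r0 r1]; elim: n z => [|n ih] z; first by rewrite !big_ord0 mulr0.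
have r1' : 0 < 1 - r by rewrite subr_gt0.
pose z1 := r^-1 *: (A^T *m z).
have step (t : nat) : dotv (x t.+1 u) z ^+ 2 <=
    (1 - r)^-1 * dotv (input t.+1 u) z ^+ 2 + r * dotv (x t u) z1 ^+ 2.
  rewrite dotv_stateS.
  have -> : dotv (x t u) (A^T *m z) = r * dotv (x t u) z1.
    by rewrite dotvZr mulrA divff ?mul1r ?gt_eqF.
  set a := dotv (x t u) z1; set b := dotv (w t u) z.
  have -> : (1 - r)^-1 * b ^+ 2 + r * a ^+ 2 =
      (r * a + b) ^+ 2 + r * ((1 - r) * a - b) ^+ 2 / (1 - r).
    by field; rewrite gt_eqF.
  rewrite lerDl; apply: divr_ge0; last exact: ltW.
  by apply: mulr_ge0; [exact: ltW|exact: sqr_ge0].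
pose c (t : nat) := dotv (input t u) z ^+ 2.
pose e (t : nat) := \sum_(j < n) r ^+ j * dotv (input t u) (dir r z1 j) ^+ 2.
have e0 t : 0 <= e t.
  by apply: sumr_ge0 => j _; rewrite mulr_ge0 ?sqr_ge0// exprn_ge0// ltW.
have -> : \sum_(t < n.+1) \sum_(j < n.+1)
    r ^+ j * dotv (input t u) (dir r z j) ^+ 2 =
    \sum_(t < n.+1) c t + r * \sum_(t < n.+1) e t.
  rewrite mulr_sumr -big_split; apply: eq_bigr => t _.
  rewrite big_ord_recl expr0 mul1r mulr_sumr; congr (_ + _).
  by apply: eq_bigr => j _; rewrite lift0 -dir_shift -/z1 exprS mulrA.
have h0 : dotv (x 0 u) z ^+ 2 <= (1 - r)^-1 * c 0.
  rewrite /c ler_peMl ?sqr_ge0// invf_ge1//.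
  by rewrite gerBl ltW.
rewrite big_ord_recl.
have h1 : \sum_(t < n) dotv (x t.+1 u) z ^+ 2 <=
    (1 - r)^-1 * \sum_(t < n) c t.+1 + r * ((1 - r)^-1 * \sum_(t < n) e t).
  apply: (@le_trans _ _ (\sum_(t < n) ((1 - r)^-1 * c t.+1 +
      r * dotv (x t u) z1 ^+ 2))).
    by apply: ler_sum => t _; exact: step.
  rewrite big_split /= -!mulr_sumr lerD2l ler_pM2l//.
apply: (le_trans (lerD h0 h1)); rewrite addrA -mulrDr.
rewrite [in leRHS]mulrDr (_ : c 0 + _ = \sum_(t < n.+1) c t); last first.
  by rewrite [RHS]big_ord_recl.
rewrite lerD2l mulrCA ler_pM2l ?invr_gt0// ler_pM2l//.
by rewrite [leRHS]big_ord_recr /= lerDl.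
Qed.

Lemma sum_norm2_le n u :
  (1 - opnorm2 A) * \sum_(t < n) norm2 (x t u) <=
  norm2 (x0 u) + \sum_(t < n) norm2 (w t u).
Proof.
have : \sum_(t < n.+1) norm2 (x t u) <= norm2 (x0 u) +
    (opnorm2 A * \sum_(t < n) norm2 (x t u) + \sum_(t < n) norm2 (w t u)).
  rewrite big_ord_recl lerD2l mulr_sumr -big_split.
  apply: ler_sum => t _; rewrite lift0 /= (le_trans (norm2D _ _))// lerD2r.
  exact: norm2_mulmx.
have : \sum_(t < n) norm2 (x t u) <= \sum_(t < n.+1) norm2 (x t u).
  by rewrite big_ord_recr /= lerDl norm2_ge0.
lra.
Qed.

End trajectory.

(** * The three exponential supermartingales *)

Section process_bounds.
Context {R : realType} {d0} {Omega : measurableType d0} {d : nat}.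
Variables (P : probability Omega R) (A : 'M[R]_d).
Variables (x0 : Omega -> 'cV[R]_d) (w : nat -> Omega -> 'cV[R]_d).
Variables (attack : nat -> set Omega) (T : nat) (p sigma s lambda : R).
Hypothesis mx0 : measurable_fun setT x0.
Hypothesis mw : forall t, (t < T)%N -> measurable_fun setT (w t).
Hypothesis p01 : 0 < p < 1.
Hypotheses (sigma0 : 0 < sigma) (sigma_s : sigma < s) (lambda0 : 0 < lambda).
Hypothesis subP : max_sub_gaussian P x0 w attack T sigma.
Hypothesis attP : probabilistic_attack P x0 w attack T p.
Hypothesis ndP : non_degenerate P x0 w attack T lambda.
Hypothesis signP : sign_restricted P x0 w attack T.

Local Notation x := (state x0 w A).
Local Notation F t := (g_sigma_algebraType (history x0 w t)).

Let mF t : (t <= T)%N -> <<s history x0 w t >> `<=` measurable.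
Proof. exact: history_sub. Qed.

Let s0 : 0 < s. Proof. exact: lt_trans sigma_s. Qed.

Let Psub t (tT : (t < T)%N) : cond_law_sat P (history x0 w t) (attack t) (w t)
  (fun mu => psi2_normv mu id <= sigma%:E)%E.
Proof. by apply: subP.2 => //; right. Qed.

Let Patt t (tT : (t < T)%N) : measurable (attack t) /\
  is_cond_prob P (history x0 w t) (~` attack t) (cst (1 - p)%:E).
Proof. by case: (attP tT). Qed.

Let Pw0 t (tT : (t < T)%N) : forall u, ~ attack t u -> w t u = 0.
Proof. by case: (attP tT). Qed.

Let int1 : (\int[P]_u (1 : R)%:E = 1%:E)%E.
Proof.
transitivity (1%:E * P setT)%E.
  exact: (integral_cst P (@measurableT _ Omega) 1%:E).
by rewrite mul1e; exact: probability_setT.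
Qed.

Definition tilted_loss (i : 'I_d) (z : 'cV[R]_d) (t : nat) (u : Omega) : R :=
  tilt (w t u i ord0) (dotv (x t u) z).

Lemma measurable_tilted_loss i z t k : (t < k)%N ->
  measurable_fun setT (tilted_loss i z t : F k -> R).
Proof.
move=> tk; have mwi : measurable_fun setT ((fun u => w t u i ord0) : F k -> R).
  by apply: (measurableT_comp (measurable_coord i)); exact: measurable_history_w.
by apply: measurable_tilt => //; apply: measurable_history_dotv; exact: ltnW.
Qed.

(** Minus the exponent on the right of [loss_step]. It is known before [w t] is drawn, so it can
    serve as compensator. *)
Definition drift (th : R) (z : 'cV[R]_d) (t : nat) (u : Omega) : R :=
  (1 - p) * (th * `|dotv (x t u) z|) - 8 * (th * dotv (x t u) z) ^+ 2.

Lemma measurable_drift th z t k : (t <= k)%N ->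
  measurable_fun setT (drift th z t : F k -> R).
Proof.
move=> tk; have ma := @measurable_history_dotv _ _ _ _ A x0 w k t z tk.
apply: measurable_funB.
  do 2![apply: measurable_funM => //]; exact: measurableT_comp.
apply: measurable_funM => //; apply: measurable_funX.
exact: measurable_funM.
Qed.

Lemma loss_mgf i z th n : 0 < th -> (n <= T)%N ->
  (\int[P]_u (expR (\sum_(t < n) (drift th z t u - th * tilted_loss i z t u)))%:E
   <= 1%:E)%E.
Proof.
move=> th0; elim: n => [_|n ih nT].
  by under eq_integral do rewrite big_ord0 expR0; rewrite int1.
apply: le_trans (ih (ltnW nT)).
have [alpha [beta ab]] := signP; have {ab} [malpha _ abE sym] := ab _ nT.
have [mE condE] := Patt nT.
(* The compensator of step [n] belongs to the past and is put into the weight; the bound of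
   [loss_step] then cancels it exactly. *)
pose H : F n -> R := fun u => expR (\sum_(t < n)
  (drift th z t u - th * tilted_loss i z t u) + drift th z n u).
have mH : measurable_fun setT H.
  apply: measurableT_comp => //; apply: measurable_funD.
    apply: measurable_sum => t; apply: measurable_funB.
      by apply: measurable_drift; exact: ltnW.
    by apply: measurable_funM => //; exact: measurable_tilted_loss.
  exact: measurable_drift.
have H0 u : 0 <= H u by exact: expR_ge0.
have := loss_step (mF (ltnW nT)) mE (mw nT) p01 (Pw0 nT) condE malpha abE sym
  i th0 mH H0 (@measurable_history_dotv _ _ _ _ A x0 w n n z (leqnn n)).
rewrite [leLHS](_ : _ = \int[P]_u (expR (\sum_(t < n.+1)
    (drift th z t u - th * tilted_loss i z t u)))%:E)%E; last first.
  apply: eq_integral => u _; rewrite big_ord_recr /H /= -expRD.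
  by rewrite /tilted_loss; congr (expR _)%:E; ring.
move=> /le_trans; apply; rewrite le_eqVlt; apply/orP; left; apply/eqP.
apply: eq_integral => u _; rewrite /H -expRD; congr (expR _)%:E.
by rewrite /drift; ring.
Qed.

Lemma lambda_le_s (z : 'cV[R]_d) : (0 < T)%N -> norm2 z = 1 -> lambda <= s.
Proof.
move=> T0 z1; have [mE condE] := Patt T0.
exact: (lambda_le (mF (leq0n T)) mE (mw T0) p01 condE sigma0 sigma_s lambda0
  (Psub T0) (ndP T0) z1).
Qed.

Definition small_ball_rate : R := p * (lambda ^+ 4 / (4096 * s ^+ 4)).

(** The sum starts at [x_1], since nothing bounds [x_0] away from 0. In [x_(t+1)] the disturbance
    [w t] provides the spread, and [dotv (x t) (A^T *m z)] is the predictable shift. *)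
Lemma excitation_mgf z n : norm2 z = 1 -> lambda <= s -> (n <= T)%N ->
  (\int[P]_u (expR (- \sum_(t < n) (`|dotv (x t.+1 u) z| / lambda)))%:E <=
   (expR (- (small_ball_rate * n%:R)))%:E)%E.
Proof.
move=> z1 ls; elim: n => [_|n ih nT].
  by under eq_integral do rewrite big_ord0 oppr0 expR0; rewrite int1 mulr0 oppr0 expR0.
have [mE condE] := Patt nT.
pose H : F n -> R := fun u => expR (- \sum_(t < n) (`|dotv (x t.+1 u) z| / lambda)).
have mH : measurable_fun setT H.
  apply: measurableT_comp => //; apply: measurable_funN.
  apply: measurable_sum => t; apply: measurable_funM => //.
  by apply: measurableT_comp => //; exact: measurable_history_dotv.
have H01 u : 0 <= H u <= 1.
  rewrite expR_ge0 -expR0 ler_expR oppr_le0 sumr_ge0// => t _.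
  by rewrite divr_ge0// ltW.
have := small_ball_step (mF (ltnW nT)) mE (mw nT) p01 condE sigma0 sigma_s
  lambda0 (Psub nT) (ndP nT) ls mH
  (@measurable_history_dotv _ _ _ _ A x0 w n n (A^T *m z) (leqnn n)) H01 z1.
rewrite [leLHS](_ : _ = \int[P]_u (expR (- \sum_(t < n.+1)
    (`|dotv (x t.+1 u) z| / lambda)))%:E)%E; last first.
  apply: eq_integral => u _; rewrite big_ord_recr /H /= -expRD.
  rewrite -/(state x0 w A n u) dotvDl -dotv_mulmx.
  by congr (expR _)%:E; ring.
move=> /le_trans; apply; rewrite -/small_ball_rate.
have int0 : (0 <= \int[P]_u (H u)%:E)%E.
  by apply: integral_ge0 => u _; rewrite lee_fin expR_ge0.
apply: (@le_trans _ _ ((expR (- small_ball_rate))%:E * \int[P]_u (H u)%:E)%E).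
  by rewrite lee_wpmul2r// lee_fin; have := expR_ge1Dx (- small_ball_rate).
rewrite -natr1 mulrDr mulr1 opprD addrC expRD EFinM.
by rewrite lee_wpmul2l ?lee_fin ?expR_ge0//; exact: ih (ltnW nT).
Qed.

Let energy (c : nat -> R) (z : nat -> 'cV[R]_d) (v : 'cV[R]_d) :=
  \sum_(j < T) c j * (dotv v (z j) ^+ 2 / s ^+ 2).

Let energy_input_mgf (c : nat -> R) (z : nat -> 'cV[R]_d) n :
  (forall j, 0 <= c j) -> \sum_(j < T) c j <= 1 -> (forall j, norm2 (z j) <= 1) ->
  (n <= T)%N ->
  (\int[P]_u (expR (\sum_(t < n.+1) energy c z (input x0 w t u)))%:E <=
   (2 * (1 + p) ^+ n)%:E)%E.
Proof.
move=> c0 c1 z1; elim: n => [_|n ih nT].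
  rewrite expr0 mulr1; under eq_integral do rewrite big_ord_recl big_ord0 addr0.
  have h (v : 'cV[R]_d) : norm2 v <= 1 -> (\int[P]_u (cst 1 u *
      expR (dotv (x0 u) v ^+ 2 / s ^+ 2))%:E <=
      2%:E * \int[P]_u (cst (1 : R) u)%:E)%E.
    move=> v1; rewrite int1 mule1.
    apply: le_trans (psi2_normv_le mx0 subP.1 sigma_s v1).
    rewrite le_eqVlt; apply/orP; left; apply/eqP/eq_integral => u _.
    by rewrite /cst mul1r.
  have := integral_exp_convex mx0 (D := setT) (K := 2) (H := cst 1)
    measurableT _ (fun j : 'I_T => c0 j) c1 (measurable_cst _) (fun=> ler01)
    (fun j : 'I_T => h _ (z1 j)).
  rewrite ler1n int1 mule1 => /(_ isT); apply: le_trans.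
  rewrite le_eqVlt; apply/orP; left; apply/eqP/eq_integral => u _.
  by rewrite /cst mul1r.
have [mE condE] := Patt nT.
pose H : F n -> R := fun u => expR (\sum_(t < n.+1) energy c z (input x0 w t u)).
have mH : measurable_fun setT H.
  apply: measurableT_comp => //; apply: measurable_sum => t.
  apply: measurable_sum => j; do 2![apply: measurable_funM => //].
  apply: measurable_funX; apply: (measurableT_comp (measurable_dotv _)).
  case: t => -[|t] tn /=; first exact: measurable_history_x0.
  exact: measurable_history_w.
have H0 u : 0 <= H u by exact: expR_ge0.
have := exp_step (mF (ltnW nT)) mE (mw nT) p01 (Pw0 nT) condE sigma_s
  (Psub nT) (fun j : 'I_T => c0 j) c1 (fun j : 'I_T => z1 j) mH H0.
rewrite [leLHS](_ : _ = \int[P]_u (expR (\sum_(t < n.+2)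
    energy c z (input x0 w t u)))%:E)%E; last first.
  apply: eq_integral => u _; rewrite [in RHS]big_ord_recr /H /= -expRD.
  by [].
move=> /le_trans; apply.
rewrite exprS mulrCA EFinM lee_wpmul2l//; last exact: ih (ltnW nT).
by rewrite lee_fin addr_ge0//; case/andP: p01 => /ltW.
Qed.

(** One factor [1 - r] compensates the constant of [energy_le]; the other normalizes the geometric
    weights [r^j] to mass at most 1, as convexity requires. On the right, [x_0] accounts for the
    factor 2 and each disturbance for [1 + p]. *)
Lemma energy_mgf (r : R) (z : 'cV[R]_d) : 0 < r < 1 -> opnorm2 A <= r ->
  norm2 z = 1 ->
  (\int[P]_u (expR ((1 - r) ^+ 2 / s ^+ 2 *
      \sum_(t < T) dotv (x t u) z ^+ 2))%:E <=
   (2 * (1 + p) ^+ T)%:E)%E.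
Proof.
move=> r01 Ar z1; case/andP: (r01) => r0 r1.
have r1' : 0 < 1 - r by rewrite subr_gt0.
have c0 j : 0 <= (1 - r) * r ^+ j by rewrite mulr_ge0 ?exprn_ge0 ?ltW.
have c1 : \sum_(j < T) (1 - r) * r ^+ j <= 1.
  rewrite -mulr_sumr; have := subrX1 r T.
  have : 0 <= r ^+ T by rewrite exprn_ge0// ltW.
  lra.
have mT (z' : 'cV[R]_d) t : (t <= T)%N ->
    measurable_fun setT (fun u => dotv (x t u) z').
  by move=> tT; apply: (measurable_fun_sub (mF (leqnn T)));
    exact: measurable_history_dotv.
have m_in (z' : 'cV[R]_d) (t : 'I_T.+1) :
    measurable_fun setT (fun u => dotv (input x0 w t u) z').
  apply: (measurableT_comp (measurable_dotv z')).
  case: t => -[|t] tn /=; first exact: mx0.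
  exact: mw.
have dir1 j : norm2 (dir A r z j) <= 1 by rewrite -z1 norm2_dir.
have := energy_input_mgf c0 c1 dir1 (leqnn T).
apply: le_trans; apply: le_integral_EFin => //.
- apply: measurableT_comp => //; apply: measurable_funM => //.
  apply: measurable_sum => t; apply: measurable_funX.
  by apply: mT; exact: ltnW.
- apply: measurableT_comp => //; apply: measurable_sum => t.
  apply: measurable_sum => j; do 2![apply: measurable_funM => //].
  exact: measurable_funX.
move=> u _; rewrite expR_ge0 ler_expR.
have e0 t : 0 <= energy (fun j => (1 - r) * r ^+ j) (dir A r z) (input x0 w t u).
  by apply: sumr_ge0 => j _; rewrite mulr_ge0// divr_ge0// sqr_ge0.
apply: (@le_trans _ _ (\sum_(t < T)
    energy (fun j => (1 - r) * r ^+ j) (dir A r z) (input x0 w t u))); last first.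
  by rewrite [leRHS]big_ord_recr /= lerDl.
have rs0 : 0 <= (1 - r) ^+ 2 / s ^+ 2 by rewrite divr_ge0// sqr_ge0.
apply: (le_trans (ler_wpM2l rs0 (energy_le A x0 w z T u r01))).
rewrite le_eqVlt; apply/orP; left; apply/eqP.
rewrite mulrA mulr_sumr; apply: eq_bigr => t _.
rewrite mulr_sumr; apply: eq_bigr => j _.
by field; rewrite !gt_eqF.
Qed.

(** A first moment is enough: it controls the Lipschitz constant of the linearized loss, which
    affects the mesh of the grid and hence the sample size through a logarithm. *)
Lemma mean_norm2 : opnorm2 A < 1 ->
  (\int[P]_u ((1 - opnorm2 A) * \sum_(t < T) norm2 (x t u))%:E <=
   (d%:R * (s * 2) * (1 + p * T%:R))%:E)%E.
Proof.
move=> A1.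
have mn1 (f : Omega -> 'cV[R]_d) : measurable_fun setT f ->
    measurable_fun setT (fun u => norm1 (f u)).
  move=> mf; apply: measurable_sum => i; apply: measurableT_comp => //.
  by apply: (measurableT_comp (measurable_coord i)).
have n1 (v : 'cV[R]_d) : 0 <= norm1 v by exact: sumr_ge0.
have mn2 t : (t < T)%N -> measurable_fun setT (fun u => norm2 (x t u)).
  move=> tT; apply: (measurableT_comp (continuous_measurable_fun
    (@sqrt_continuous R))); apply: measurable_sum => i.
  apply: measurable_funX; apply: (measurableT_comp (measurable_coord i)).
  apply: (measurable_fun_sub (mF (ltnW tT))).
  exact: measurable_history_state.
apply: (@le_trans _ _ (\int[P]_u (norm1 (x0 u) +
    \sum_(t < T) norm1 (w t u))%:E)%E).
  apply: le_integral_EFin => //.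
  - by apply: measurable_funM => //; apply: measurable_sum => t; exact: mn2.
  - apply: measurable_funD; first exact: mn1.
    by apply: measurable_sum => t; apply: mn1; exact: mw.
  - move=> u _; rewrite mulr_ge0 ?subr_ge0 ?(ltW A1) ?sumr_ge0//=; last first.
      by move=> t _; exact: norm2_ge0.
    rewrite (le_trans (sum_norm2_le A x0 w T u))// lerD ?norm2_le_norm1//.
    by apply: ler_sum => t _; exact: norm2_le_norm1.
rewrite integralD_EFin_ge0//; last 3 first.
- exact: mn1.
- by apply: measurable_sum => t; apply: mn1; exact: mw.
- by move=> u; exact: sumr_ge0.
rewrite mulrDr mulr1 EFinD; apply: leeD.
  apply: integral_norm1_le => // z z1.
  exact: (psi2_normv_le mx0 subP.1 sigma_s z1).
under eq_integral do rewrite -sumEFin.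
rewrite ge0_integral_sum//; last 2 first.
- by move=> t; apply/measurable_EFinP; apply: mn1; exact: mw.
- by move=> t u _; rewrite lee_fin.
rewrite (_ : (_ * (p * T%:R))%:E = \sum_(t < T) (d%:R * (s * (2 * p)))%:E)%E;
  last first.
  by rewrite sumEFin sumr_const card_ord; congr EFin; rewrite -[RHS]mulr_natr; ring.
apply: lee_sum => t _; have tT := ltn_ord t; have [mE condE] := Patt tT.
rewrite (integral_split P mE (mn1 _ (mw tT)))// [X in (_ + X)%E](_ : _ = 0%E).
  rewrite adde0.
  exact: (attack_norm1 (mF (ltnW tT)) mE (mw tT) condE sigma0 sigma_s (Psub tT)).
rewrite integral0_eq// => u nu; rewrite (Pw0 tT nu) /norm1 big1// => i _.
by rewrite mxE normr0.
Qed.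

End process_bounds.

Ltac pos := repeat first [ rewrite ltr0n; reflexivity
  | apply: divr_gt0 | apply: mulr_gt0 | apply: exprn_gt0 | assumption ].

(** * Markov and Chernoff bounds *)

Section tail.
Context {R : realType} {d0} {Omega : measurableType d0}.
Variable P : probability Omega R.

Lemma prob_ge_le_mean (Y : Omega -> R) (c K : R) : measurable_fun setT Y ->
  (forall u, 0 <= Y u) -> 0 < c -> (\int[P]_u (Y u)%:E <= K%:E)%E ->
  (P [set u | (c <= Y u)%R] <= (K / c)%:E)%E.
Proof.
move=> mY Y0 c0 YK; set A := [set u | _].
have mA : measurable A.
  rewrite (_ : A = Y @^-1` `[c, +oo[); last first.
    by apply/seteqP; split => u /=; rewrite in_itv/= andbT.
  by rewrite -[X in measurable X]setTI; exact: mY.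
have -> : (K / c)%:E = (c^-1%:E * K%:E)%E by rewrite -EFinM mulrC.
rewrite -[leLHS]mul1e -(mulVf (lt0r_neq0 c0)) EFinM -muleA.
rewrite lee_wpmul2l ?lee_fin ?invr_ge0 ?(ltW c0)//.
apply: le_trans YK; rewrite -(integral_cst P mA c%:E).
apply: (@le_trans _ _ (\int[P]_(u in A) (Y u)%:E)%E).
  apply: (@le_integral_EFin _ _ _ P A (cst c) Y) => //.
  by move=> u Au; rewrite (ltW c0).
apply: ge0_subset_integral => //; first exact/measurable_EFinP.
by move=> u _; rewrite lee_fin.
Qed.

Lemma prob_ge_le_expR (Y : Omega -> R) (c K : R) : measurable_fun setT Y ->
  (\int[P]_u (expR (Y u))%:E <= K%:E)%E ->
  (P [set u | (c <= Y u)%R] <= (K * expR (- c))%:E)%E.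
Proof.
move=> mY YK; rewrite (_ : [set u | _] = [set u | expR c <= expR (Y u)]).
  rewrite expRN; apply: prob_ge_le_mean => //; last exact: expR_gt0.
  exact: measurableT_comp.
by apply/seteqP; split => u /=; rewrite ler_expR.
Qed.

End tail.

(** * Lower tail of the linearized loss in one direction *)

Section loss_lower_tail.
Context {R : realType} {d0} {Omega : measurableType d0} {d : nat}.
Variables (P : probability Omega R) (A : 'M[R]_d).
Variables (x0 : Omega -> 'cV[R]_d) (w : nat -> Omega -> 'cV[R]_d).
Variables (attack : nat -> set Omega) (T : nat) (p sigma s lambda : R).
Hypothesis mx0 : measurable_fun setT x0.
Hypothesis mw : forall t, (t < T)%N -> measurable_fun setT (w t).
Hypothesis p01 : 0 < p < 1.
Hypotheses (sigma0 : 0 < sigma) (sigma_s : sigma < s) (lambda0 : 0 < lambda).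
Hypothesis subP : max_sub_gaussian P x0 w attack T sigma.
Hypothesis attP : probabilistic_attack P x0 w attack T p.
Hypothesis ndP : non_degenerate P x0 w attack T lambda.
Hypothesis signP : sign_restricted P x0 w attack T.

Local Notation x := (state x0 w A).

Definition total_loss (i : 'I_d) (z : 'cV[R]_d) (u : Omega) : R :=
  \sum_(t < T) tilted_loss A x0 w i z t u.

(** A quarter of the guaranteed linear term: outside the bad event for excitation the sum of [|a_t|]
    exceeds [lambda p k (T - 1) / 2], which is at least [lambda p k T / 4], where [k] is the inner
    quotient. *)
Definition loss_margin : R :=
  (1 - p) * (p * lambda * (lambda ^+ 4 / (4096 * s ^+ 4))) * T%:R / 16.

(** The Chernoff exponent [th * loss_margin] equals the same expression with 6144 in place of 8192;
    the smaller value serves for all three bad events. *)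
Definition loss_exponent (r : R) : R :=
  p * T%:R * ((1 - p) ^+ 2 * (1 - r) ^+ 2 * (lambda / s) ^+ 10) / (4096 * 4096) / 8192.

Lemma measurable_total_loss i z : measurable_fun setT (total_loss i z).
Proof.
apply: measurable_sum => t.
apply: (measurable_fun_sub (history_sub mx0 mw (leqnn T))).
exact: measurable_tilted_loss.
Qed.

Lemma total_loss_tail i z r : (1 < T)%N -> lambda <= s -> 0 < r < 1 ->
  opnorm2 A <= r -> norm2 z = 1 ->
  (P [set u | (total_loss i z u <= loss_margin)%R] <=
   (4 * expR (- loss_exponent r))%:E)%E.
Proof.
have lin1 (a b : R) : 0 < b -> a <= b ->
    (a + b) / (4096 * 4096) / 8192 <= b / 4096 / 2 by lra.
have lin2 (a b : R) : b <= a -> (a + b) / 4 <= a / 2 by lra.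
have lin3 (a b : R) : b <= a / 2 -> - a + a / 2 <= - b by lra.
have lin4 (a b e f : R) : 4 * e <= a -> b <= e -> f <= e -> 0 < e ->
    a - b - f < e -> False by lra.
have lin5 (a : R) : 0 <= a -> a / 8192 <= a / 6144 by lra.
have lin6 (a : R) : a - 3 * a <= - (2 * a) by lra.
have lin7 (a b : R) : 0 <= a -> b <= a -> b / (4096 * 4096) / 8192 <= 2 * a by lra.
move=> T1 ls r01 Ar z1.
have s0 : 0 < s by exact: lt_trans sigma_s.
have [p0 p1] := andP p01; have [r0 r1] := andP r01.
have u0 : 0 < 1 - p by rewrite subr_gt0.
have v0 : 0 < 1 - r by rewrite subr_gt0.
have [k kE] : exists k, k = lambda ^+ 4 / (4096 * s ^+ 4) by eexists.
have k0 : 0 < k.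
  by rewrite kE; pos.
have [m mE] : exists m : R, m = (T.-1)%:R by eexists.
have TR : T%:R = m + 1 :> R by rewrite mE natr1 prednK// ltnW.
have m1 : 1 <= m by rewrite mE ler1n -ltnS prednK// ltnW.
(* Chosen so that the quadratic penalty [8 th^2 S2] equals [th * g] when the energy [S2] is at its
   threshold [3 p T s^2 / (1 - r)^2]. *)
have [th thE] : exists th, th = (1 - p) * lambda * k * (1 - r) ^+ 2 / (384 * s ^+ 2).
  by eexists.
have th0 : 0 < th by rewrite thE; pos.
pose Y1 u := \sum_(t < T) (drift A x0 w p th z t u - th * tilted_loss A x0 w i z t u).
pose Y2 u := - \sum_(t < T.-1) (`|dotv (x t.+1 u) z| / lambda).
pose Y3 u := (1 - r) ^+ 2 / s ^+ 2 * \sum_(t < T) dotv (x t u) z ^+ 2.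
have mdot (t : nat) : (t <= T)%N -> measurable_fun setT (fun u => dotv (x t u) z).
  move=> tT; apply: (measurable_fun_sub (history_sub mx0 mw tT)).
  exact: measurable_history_dotv.
have mY1 : measurable_fun setT Y1.
  apply: measurable_sum => t.
  apply: (measurable_fun_sub (history_sub mx0 mw (leqnn T))).
  apply: measurable_funB; first by apply: measurable_drift; exact: ltnW.
  by apply: measurable_funM => //; exact: measurable_tilted_loss.
have mY2 : measurable_fun setT Y2.
  apply: measurable_funN; apply: measurable_sum => t.
  apply: measurable_funM => //; apply: measurableT_comp => //; apply: mdot.
  by rewrite (leq_trans (ltn_ord t))// leq_pred.
have mY3 : measurable_fun setT Y3.
  apply: measurable_funM => //; apply: measurable_sum => t.
  by apply: measurable_funX; apply: mdot; exact: ltnW.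
have [g gE] : exists g, g = (1 - p) * (p * lambda * k) * T%:R / 16 by eexists.
rewrite (_ : loss_margin = g); last by rewrite gE kE.
(* The bad events: a large supermartingale, too little excitation, too much energy. Half of the
   excitation rate is given up in [B2]; in [B3] the threshold [3 p T] outweighs
   [(1 + p)^T <= exp (p T)] and leaves [exp (- 2 p T)]. *)
pose B1 := [set u | th * g <= Y1 u].
pose B2 := [set u | - (p * k * m / 2) <= Y2 u].
pose B3 := [set u | 3 * (p * T%:R) <= Y3 u].
have mB (Y : Omega -> R) c : measurable_fun setT Y -> measurable [set u | c <= Y u].
  move=> mY; rewrite (_ : [set u | _] = Y @^-1` `[c, +oo[); last first.
    by apply/seteqP; split => u /=; rewrite in_itv/= andbT.
  by rewrite -[X in measurable X]setTI; exact: mY.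
have q0 : 0 < lambda / s by exact: divr_gt0.
have q1 : lambda / s <= 1 by rewrite ler_pdivrMr// mul1r.
move qE : (lambda / s) q0 q1 => q q0 q1.
have uv1 : (1 - p) ^+ 2 * (1 - r) ^+ 2 <= 1.
  by rewrite mulr_ile1 ?exprn_ge0 ?exprn_ile1 ?(ltW u0)
     ?(ltW v0) ?gerBl ?(ltW p0) ?(ltW r0).
have uv0 : 0 <= (1 - p) ^+ 2 * (1 - r) ^+ 2 by rewrite mulr_ge0// sqr_ge0.
have uvq : (1 - p) ^+ 2 * (1 - r) ^+ 2 * q ^+ 10 <= q ^+ 4.
  rewrite -[leRHS]mul1r ler_pM// ?exprn_ge0 ?(ltW q0)//.
  by rewrite ler_wiXn2l// (ltW q0).
have q41 : q ^+ 4 <= 1 by rewrite exprn_ile1// (ltW q0).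
have kq : k = q ^+ 4 / 4096 by rewrite kE -qE; field; rewrite gt_eqF.
have pT0 : 0 <= p * T%:R by rewrite mulr_ge0// ltW.
have e1 : loss_exponent r <= th * g.
  have -> : th * g = p * T%:R * ((1 - p) ^+ 2 * (1 - r) ^+ 2 * q ^+ 10) /
      (4096 * 4096) / 6144.
    by rewrite thE gE kq -qE; field; rewrite gt_eqF.
  rewrite /loss_exponent qE; set W := _ / (4096 * 4096).
  have W0 : 0 <= W.
    apply: divr_ge0; last by apply: ltW; pos.
    by apply: mulr_ge0 => //; apply: mulr_ge0 => //; apply: exprn_ge0; exact: ltW.
  exact: lin5.
have e23 : loss_exponent r <= p * T%:R * q ^+ 4 / (4096 * 4096) / 8192.
  rewrite /loss_exponent qE; do 2![rewrite ler_pM2r; last by rewrite invr_gt0; pos].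
  exact: ler_wpM2l.
have e2 : loss_exponent r <= p * k * m / 2.
  apply: (le_trans e23); rewrite kq TR.
  have pq0 : 0 < p * q ^+ 4 by pos.
  have : p * q ^+ 4 * 1 <= p * q ^+ 4 * m by rewrite ler_pM2l.
  have -> : p * (m + 1) * q ^+ 4 = p * q ^+ 4 * 1 + p * q ^+ 4 * m by ring.
  have -> : p * (q ^+ 4 / 4096) * m / 2 = p * q ^+ 4 * m / 4096 / 2 by ring.
  by apply: lin1; exact: mulr_gt0 pq0 (lt_le_trans ltr01 m1).
have e3 : loss_exponent r <= 2 * (p * T%:R).
  apply: (le_trans e23).
  by apply: lin7 => //; rewrite ler_piMr.
have P1 : (P B1 <= (expR (- loss_exponent r))%:E)%E.
  have := prob_ge_le_expR (th * g) mY1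
    (loss_mgf A mx0 mw p01 attP signP i z th0 (leqnn T)).
  by move=> /le_trans; apply; rewrite lee_fin mul1r ler_expR lerN2.
have P2 : (P B2 <= (expR (- loss_exponent r))%:E)%E.
  have := prob_ge_le_expR (- (p * k * m / 2)) mY2 (excitation_mgf A mx0 mw p01 sigma0
    sigma_s lambda0 subP attP ndP z1 ls (leq_pred T)).
  move=> /le_trans; apply; rewrite lee_fin -expRD ler_expR.
  rewrite /small_ball_rate -kE -mE opprK.
  exact: lin3.
have P3 : (P B3 <= (2 * expR (- loss_exponent r))%:E)%E.
  have := prob_ge_le_expR (3 * (p * T%:R)) mY3
    (energy_mgf mx0 mw p01 sigma0 sigma_s subP attP r01 Ar z1).
  move=> /le_trans; apply; rewrite lee_fin -mulrA ler_pM2l//.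
  apply: (@le_trans _ _ (expR (p * T%:R) * expR (- (3 * (p * T%:R))))).
    rewrite ler_wpM2r ?expR_ge0// expRM_natr lerXn2r ?nnegrE ?expR_ge0//.
      by rewrite addr_ge0// ltW.
    exact: expR_ge1Dx.
  rewrite -expRD ler_expR (le_trans (lin6 _))// lerN2.
  exact: e3.
(* Off the bad events the linear term is at least [4 th g] and the penalty at most [th g]. A loss at
   most [g] would then make [Y1] at least [2 th g], against the complement of [B1]. *)
have sub : [set u | total_loss i z u <= g] `<=` B1 `|` B2 `|` B3.
  move=> u /= lu; apply: contrapT => /not_orP[/not_orP[n1 n2] n3].
  move/negP: n1; move/negP: n2; move/negP: n3; rewrite -!ltNge.
  rewrite /Y1 /Y2 /Y3.
  pose S1 : R := \sum_(t < T) `|dotv (x t u) z|.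
  set S2 : R := \sum_(t < T) _ ^+ 2.
  have S10 : \sum_(t < T.-1) (`|dotv (x t.+1 u) z| / lambda) <= S1 / lambda.
    rewrite -mulr_suml ler_pM2r ?invr_gt0// /S1.
    case: (T) T1 => // n _; rewrite [leRHS]big_ord_recl/= lerDr//.
  move=> h3 h2.
  have -> : \sum_(t < T) (drift A x0 w p th z t u - th * tilted_loss A x0 w i z t u)
     = (1 - p) * (th * S1) - 8 * th ^+ 2 * S2 - th * total_loss i z u.
    rewrite sumrB -mulr_sumr; congr (_ - _).
    rewrite /drift sumrB -!mulr_sumr; congr (_ - _); rewrite -mulrA; congr (8 * _).
    by rewrite mulr_sumr; apply: eq_bigr => t _; rewrite exprMn.
  have h2' : p * k * m / 2 < S1 / lambda.
    by move: h2; rewrite ltrN2 => /lt_le_trans; exact.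
  have h2'' : lambda * (p * k * m / 2) < S1.
    by move: h2'; rewrite ltr_pdivlMr// mulrC.
  have h3' : S2 < 3 * (p * T%:R) * s ^+ 2 / (1 - r) ^+ 2.
    have -> : S2 = (1 - r) ^+ 2 / s ^+ 2 * S2 * (s ^+ 2 / (1 - r) ^+ 2).
      by field; rewrite !gt_eqF.
    by rewrite -[ltRHS]mulrA ltr_pM2r//; pos.
  have g1 : 4 * (th * g) <= (1 - p) * (th * S1).
    apply: (@le_trans _ _ ((1 - p) * (th * (lambda * (p * k * m / 2))))); last first.
      by rewrite ler_pM2l// ler_pM2l//; exact: ltW.
    have -> : 4 * (th * g) = (1 - p) * (th * (lambda * (p * k * (m + 1) / 4))).
      by rewrite gE TR; field.
    rewrite ler_pM2l// ler_pM2l// ler_pM2l//.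
    have : p * k * 1 <= p * k * m by rewrite ler_pM2l//; pos.
    have -> : p * k * (m + 1) = p * k * m + p * k * 1 by ring.
    exact: lin2.
  have g2 : 8 * th ^+ 2 * S2 <= th * g.
    apply: (@le_trans _ _ (8 * th ^+ 2 * (3 * (p * T%:R) * s ^+ 2 / (1 - r) ^+ 2))).
      by rewrite ler_pM2l; [exact: ltW|pos].
    rewrite le_eqVlt; apply/orP; left; apply/eqP.
    by rewrite thE gE; field; rewrite !gt_eqF.
  have g3 : th * total_loss i z u <= th * g by rewrite ler_wpM2l// ltW.
  have T0 : 0 < T%:R :> R by rewrite ltr0n ltnW.
  have g4 : 0 < th * g by rewrite gE; pos.
  exact: (lin4 _ _ _ _ g1 g2 g3 g4).
have mU : (P [set u | (total_loss i z u <= g)%R] <= P B1 + P B2 + P B3)%E.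
  have mB12 : measurable (B1 `|` B2) by apply: measurableU; exact: mB.
  apply: (@le_trans _ _ (P (B1 `|` B2 `|` B3))).
    apply: le_measure => //; rewrite inE.
      rewrite (_ : [set u | _] = total_loss i z @^-1` `]-oo, g]); last first.
        by apply/seteqP; split => u /=; rewrite in_itv.
      by rewrite -[X in measurable X]setTI; exact: measurable_total_loss.
    by apply: measurableU => //; exact: mB.
  apply: (le_trans (measureU2 _ mB12 (mB _ _ mY3))).
  by apply: leeD => //; apply: measureU2; exact: mB.
apply: (le_trans mU).
have -> : 4 * expR (- loss_exponent r) = expR (- loss_exponent r) +
  expR (- loss_exponent r) + 2 * expR (- loss_exponent r) by ring.
by rewrite !EFinD; apply: leeD => //; apply: leeD.
Qed.

End loss_lower_tail.

(** * Discretization of directions and the union bound *)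

Section grid.
Context {R : realType} {d : nat}.

Definition grid (K : nat) (k : {ffun 'I_d -> 'I_(2 * K).+1}) : 'cV[R]_d :=
  \col_i (((k i)%:R - K%:R) / K%:R).

(** Each coordinate is rounded down to a multiple of [1 / K]. The values [1] and [-1] are themselves
    grid values, so coordinate [j] is unchanged and keeps the norm at least 1. *)
Lemma grid_approx (K : nat) (z : 'cV[R]_d) (j : 'I_d) : (0 < K)%N ->
  (forall i, `|z i ord0| <= 1) -> `|z j ord0| = 1 ->
  exists k : {ffun 'I_d -> 'I_(2 * K).+1},
    1 <= norm2 (grid k) /\ norm1 (z - grid k) <= d%:R / K%:R.
Proof.
move=> K0 z1 zj; have K0' : 0 < K%:R :> R by rewrite ltr0n.
pose y i : R := K%:R * z i ord0 + K%:R.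
have y0 i : 0 <= y i.
  have /andP[+ _] : -1 <= z i ord0 <= 1 by rewrite -ler_norml.
  by rewrite -(ler_pM2l K0') /y; lra.
have y2 i : y i <= (2 * K)%:R.
  have /andP[_ +] : -1 <= z i ord0 <= 1 by rewrite -ler_norml.
  by rewrite -(ler_pM2l K0') natrM /y; lra.
have ty i : (Num.trunc (y i) < (2 * K).+1)%N.
  rewrite ltnS -(ler_nat R); apply: le_trans (y2 i).
  by have /andP[] := truncn_itv (y0 i).
exists [ffun i => Ordinal (ty i)]; split.
  apply: (@le_trans _ _ `|grid [ffun i => Ordinal (ty i)] j ord0|);
    last exact: norm_coord_le.
  rewrite mxE ffunE /=.
  have [zj1|zj1] : z j ord0 = 1 \/ z j ord0 = -1.
    by move: zj; case: (ger0P (z j ord0)) => _ <-; [left|right; rewrite opprK].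
  - have -> : y j = (2 * K)%:R by rewrite /y zj1 natrM; ring.
    rewrite natrK (_ : _ / _ = 1) ?normr1// natrM; field.
    by rewrite gt_eqF.
  - have -> : y j = 0%:R by rewrite /y zj1; ring.
    rewrite natrK (_ : _ / _ = -1) ?normrN1//; field.
    by rewrite gt_eqF.
rewrite /norm1 (_ : d%:R / K%:R = \sum_(i < d) (K%:R^-1 : R)); last first.
  by rewrite sumr_const card_ord mulr_natl.
apply: ler_sum => i _; rewrite !mxE ffunE /=.
have /andP[t1] := truncn_itv (y0 i); rewrite -natr1.
move: (Num.trunc (y i))%:R t1 => a t1 t2.
have -> : z i ord0 - (a - K%:R) / K%:R = (y i - a) / K%:R.
  by rewrite /y; field; rewrite gt_eqF.
rewrite normrM [X in _ * X]gtr0_norm ?invr_gt0// ler_piMl ?invr_ge0 ?ltW//.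
by rewrite ger0_norm; lra.
Qed.

End grid.

Section union_bound.
Context {R : realType} {d0} {Omega : measurableType d0}.
Variable P : probability Omega R.

Lemma prob_bigsetU_le (I : finType) (F : I -> set Omega) (c : R) :
  (forall i, measurable (F i)) -> (forall i, (P (F i) <= c%:E)%E) ->
  (P (\big[setU/set0]_i F i) <= (#|I|%:R * c)%:E)%E.
Proof.
move=> mF Fc; rewrite -sum1_card natr_sum mulr_suml -sumEFin.
have [] : measurable (\big[setU/set0]_i F i) /\
  (P (\big[setU/set0]_i F i) <= \sum_(i in I) (1%:R * c)%:E)%E => //.
rewrite (@eq_bigl _ _ _ _ _ (fun i => i \in I) xpredT)//.
elim/big_rec2: _ => [|i e U _ [mU PU]]; first by split => //; rewrite measure0.
split; first exact: measurableU.
apply: (le_trans (measureU2 _ (mF i) mU)).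
apply: leeD; last exact: PU.
by rewrite mul1r; exact: Fc.
Qed.

End union_bound.

(** * From positive linearized losses to exact recovery *)

Section exact_recovery.
Context {R : realType} {d0} {Omega : measurableType d0} {d : nat}.
Variables (A : 'M[R]_d) (x0 : Omega -> 'cV[R]_d) (w : nat -> Omega -> 'cV[R]_d).
Variables (T : nat).

Local Notation x := (state x0 w A).
Local Notation loss := (total_loss A x0 w T).

Lemma total_lossZ i z c u : 0 <= c -> loss i (c *: z) u = c * loss i z u.
Proof.
move=> c0; rewrite /total_loss mulr_sumr; apply: eq_bigr => t _.
by rewrite /tilted_loss dotvZr tiltM.
Qed.

Lemma total_loss_lipschitz i z z' u :
  loss i z' u - norm1 (z - z') * \sum_(t < T) norm2 (x t u) <= loss i z u.
Proof.
rewrite /total_loss mulr_sumr -sumrB; apply: ler_sum => t _.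
apply: le_trans (tilt_lipschitz _ _ (dotv (x t u) z')); rewrite lerD2l lerN2.
rewrite -mulN1r -dotvZr scaleN1r -dotvDr (le_trans (dotv_abs_le _ _))// mulrC.
by rewrite ler_wpM2r ?norm2_ge0 ?norm2_le_norm1.
Qed.

Lemma total_loss_gt0 (K : nat) (g : R) i u : (0 < K)%N ->
  (forall k, 1 <= norm2 (@grid R d K k) -> g < loss i (@grid R d K k) u) ->
  d%:R / K%:R * \sum_(t < T) norm2 (x t u) <= g ->
  forall z, z != 0 -> 0 < loss i z u.
Proof.
move=> K0 gk dK z z0.
have [j0 zj0|nz] := pickP (fun j => z j ord0 != 0); last first.
  case/eqP: z0; apply/matrixP => j l; rewrite ord1 mxE.
  by apply/eqP/negPn; rewrite nz.
have [j _ jmax] := @Order.TotalTheory.arg_maxP _ _ _ j0 xpredT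
  (fun j => `|z j ord0|) isT.
have {}jmax l : `|z l ord0| <= `|z j ord0| by exact: jmax.
have m0 : 0 < `|z j ord0|.
  by apply: lt_le_trans (jmax j0); rewrite normr_gt0.
set m := `|z j ord0| in m0 jmax.
have -> : z = m *: (m^-1 *: z) by rewrite scalerA divff ?scale1r ?gt_eqF.
rewrite total_lossZ ?mulr_gt0 ?(ltW m0)//.
set v := m^-1 *: z.
have vE l : `|v l ord0| = `|z l ord0| / m.
  by rewrite mxE normrM gtr0_norm ?invr_gt0// mulrC.
have [k [k1 kv]] : exists k : {ffun 'I_d -> 'I_(2 * K).+1},
    1 <= norm2 (@grid R d K k) /\ norm1 (v - grid k) <= d%:R / K%:R.
  apply: (@grid_approx R d K v j) => //; last by rewrite vE divff ?gt_eqF.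
  by move=> l; rewrite vE ler_pdivrMr// mul1r jmax.
apply: lt_le_trans (total_loss_lipschitz i v (grid k) u).
rewrite subr_gt0; apply: le_lt_trans (gk k k1); apply: le_trans dK.
by rewrite ler_wpM2r// sumr_ge0// => t _; exact: norm2_ge0.
Qed.

(** The l1 loss separates over rows: row [i] of [A' - A] moves coordinate [i] of the residuals
    alone, and the residual at [A] is [w t]. Then [tilt_le] applies termwise. *)
Lemma l1_loss_le (A' : 'M[R]_d) u :
  \sum_i loss i (row i (A' - A))^T u <= l1_loss x0 w A T u A' - l1_loss x0 w A T u A.
Proof.
rewrite /l1_loss -sumrB /total_loss exchange_big /=; apply: ler_sum => t _.
rewrite /norm1 -sumrB; apply: ler_sum => i _.
rewrite /tilted_loss (le_trans (tilt_le _ _))//.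
have -> : dotv (x t u) (row i (A' - A))^T = ((A' - A) *m x t u) i ord0.
  by rewrite /dotv mxE; apply: eq_bigr => j _; rewrite !mxE mulrC.
rewrite lerB//.
  rewrite (_ : _ - A' *m _ = w t u - (A' - A) *m x t u) ?[in X in X _ <= _]mxE.
    by rewrite !mxE.
  by rewrite mulmxBl opprB addrCA addrA.
by rewrite !mxE addrAC subrr add0r.
Qed.

Lemma argmin_l1_loss u : (forall i z, z != 0 -> 0 < loss i z u) ->
  argmin (l1_loss x0 w A T u) = [set A].
Proof.
move=> pos; have loss0 i : loss i 0 u = 0.
  by rewrite -(scale0r 0) total_lossZ// mul0r.
have loss_ge0 i z : 0 <= loss i z u.
  by have [->|/pos/ltW//] := eqVneq z 0; rewrite loss0.
have min A' : l1_loss x0 w A T u A <= l1_loss x0 w A T u A'.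
  by rewrite -subr_ge0; apply: le_trans (l1_loss_le A' u); exact: sumr_ge0.
apply/seteqP; split => [A' /= /(_ A) A'A|_ -> //].
apply/eqP; rewrite -subr_eq0; apply/negPn/negP => nz.
have [i /pos lt0 | nzi] := pickP (fun i => (row i (A' - A))^T != 0); last first.
  case/eqP: nz; apply/row_matrixP => i; rewrite row0.
  by apply: trmx_inj; rewrite trmx0; apply/eqP/negPn; rewrite nzi.
have := l1_loss_le A' u; rewrite leNgt => /negP; apply.
apply: (@le_lt_trans _ _ 0); first by rewrite subr_le0.
rewrite (bigD1 i)//= ltr_pwDl//.
by apply: sumr_ge0.
Qed.

End exact_recovery.

(** * Probability of recovery *)

Section recovery_probability.
Context {R : realType} {d0} {Omega : measurableType d0} {d : nat}.
Variables (P : probability Omega R) (A : 'M[R]_d).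
Variables (x0 : Omega -> 'cV[R]_d) (w : nat -> Omega -> 'cV[R]_d).
Variables (attack : nat -> set Omega) (T : nat) (p sigma s lambda : R).
Hypothesis mx0 : measurable_fun setT x0.
Hypothesis mw : forall t, (t < T)%N -> measurable_fun setT (w t).
Hypothesis p01 : 0 < p < 1.
Hypotheses (sigma0 : 0 < sigma) (sigma_s : sigma < s) (lambda0 : 0 < lambda).
Hypothesis subP : max_sub_gaussian P x0 w attack T sigma.
Hypothesis attP : probabilistic_attack P x0 w attack T p.
Hypothesis ndP : non_degenerate P x0 w attack T lambda.
Hypothesis signP : sign_restricted P x0 w attack T.
Hypotheses (T1 : (1 < T)%N) (lambda_s : lambda <= s).

Local Notation x := (state x0 w A).
Local Notation loss := (total_loss A x0 w T).
Local Notation margin := (loss_margin T p s lambda).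

Lemma loss_margin_ge0 : 0 <= margin.
Proof.
have [p0 p1] := andP p01; have s0 := lt_trans sigma0 sigma_s.
rewrite /loss_margin; apply: ltW; have T0 : 0 < T%:R :> R by rewrite ltr0n ltnW.
have p1' : 0 < 1 - p by rewrite subr_gt0.
by pos.
Qed.

(** By homogeneity, a loss above the nonnegative margin at the unit vector only grows when the
    direction is lengthened. *)
Lemma total_loss_tail_ge1 i z r : 0 < r < 1 -> opnorm2 A <= r -> 1 <= norm2 z ->
  (P [set u | (loss i z u <= margin)%R] <=
   (4 * expR (- loss_exponent T p s lambda r))%:E)%E.
Proof.
move=> r01 Ar z1; have z0 : 0 < norm2 z by exact: lt_le_trans z1.
pose v := (norm2 z)^-1 *: z.
have v1 : norm2 v = 1.
  by rewrite norm2Z gtr0_norm ?invr_gt0// mulVf ?gt_eqF.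
have := total_loss_tail mx0 mw p01 sigma0 sigma_s lambda0 subP attP ndP signP i
  T1 lambda_s r01 Ar v1.
apply: le_trans; apply: le_measure; rewrite ?inE.
- rewrite (_ : [set u | _] = loss i z @^-1` `]-oo, margin]); last first.
    by apply/seteqP; split => u /=; rewrite in_itv.
  by rewrite -[X in measurable X]setTI; exact: measurable_total_loss.
- rewrite (_ : [set u | _] = loss i v @^-1` `]-oo, margin]); last first.
    by apply/seteqP; split => u /=; rewrite in_itv.
  by rewrite -[X in measurable X]setTI; exact: measurable_total_loss.
move=> u /=; rewrite (_ : z = norm2 z *: v); last first.
  by rewrite scalerA divff ?scale1r ?gt_eqF.
rewrite total_lossZ ?(ltW z0)// => h; rewrite leNgt; apply/negP => mv.
have : loss i v u <= norm2 z * loss i v u.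
  by rewrite ler_peMl//; apply: le_trans (ltW mv); exact: loss_margin_ge0.
by move=> /(lt_le_trans mv)/lt_le_trans/(_ h); rewrite ltxx.
Qed.

(** [c] is the Markov threshold for the trajectory, and the last hypothesis says that rounding to
    the grid costs at most the margin. The event is the complement of explicit bad events, so
    measurability of the recovery set itself is not at issue. *)
Lemma recovery_probability (K : nat) (c r : R) : (0 < K)%N -> 0 < c ->
  opnorm2 A < 1 -> 0 < r < 1 -> opnorm2 A <= r ->
  d%:R / K%:R * (c / (1 - opnorm2 A)) <= margin ->
  exists E : set Omega, [/\ measurable E,
    ((1 - (d%:R * (2 * K).+1%:R ^+ d * (4 * expR (- loss_exponent T p s lambda r)) +
      d%:R * (s * 2) * (1 + p * T%:R) / c))%:E <= P E)%E &
    forall u, E u -> argmin (l1_loss x0 w A T u) = [set A]].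
Proof.
move=> K0 c0 A1 r01 Ar Kc.
pose I := ('I_d * {ffun 'I_d -> 'I_(2 * K).+1})%type.
have A1' : 0 < 1 - opnorm2 A by rewrite subr_gt0.
(* Grid points of norm below 1 receive the empty set, so that one bound holds uniformly over the
   whole grid; rounding never produces them. *)
pose F (ik : I) : set Omega := if 1 <= norm2 (@grid R d K ik.2) then
  [set u | loss ik.1 (grid ik.2) u <= margin] else set0.
have mF ik : measurable (F ik).
  rewrite /F; case: ifP => // _.
  rewrite (_ : [set u | _] = loss ik.1 (grid ik.2) @^-1` `]-oo, margin]); last first.
    by apply/seteqP; split => u /=; rewrite in_itv.
  by rewrite -[X in measurable X]setTI; exact: measurable_total_loss.
have PF ik : (P (F ik) <= (4 * expR (- loss_exponent T p s lambda r))%:E)%E.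
  rewrite /F; case: ifP => [z1|_]; last by rewrite measure0 lee_fin mulr_ge0 ?expR_ge0.
  exact: total_loss_tail_ge1.
pose Y u := (1 - opnorm2 A) * \sum_(t < T) norm2 (x t u).
have mY : measurable_fun setT Y.
  apply: measurable_funM => //; apply: measurable_sum => t.
  apply: (measurableT_comp (continuous_measurable_fun (@sqrt_continuous R))).
  apply: measurable_sum => i.
  apply: measurable_funX; apply: (measurableT_comp (measurable_coord i)).
  apply: (measurable_fun_sub (history_sub mx0 mw (ltnW (ltn_ord t)))).
  exact: measurable_history_state.
pose G := [set u | c <= Y u].
have mG : measurable G.
  rewrite (_ : G = Y @^-1` `[c, +oo[); last first.
    by apply/seteqP; split => u /=; rewrite in_itv/= andbT.
  by rewrite -[X in measurable X]setTI; exact: mY.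
have PG : (P G <= (d%:R * (s * 2) * (1 + p * T%:R) / c)%:E)%E.
  apply: (prob_ge_le_mean mY _ c0).
    by move=> u; rewrite mulr_ge0 ?(ltW A1')// sumr_ge0// => t _; exact: norm2_ge0.
  exact: (mean_norm2 mx0 mw sigma0 sigma_s subP attP A1).
pose U := \big[setU/set0]_ik F ik.
have mU : measurable U by apply: bigsetU_measurable.
have PU := prob_bigsetU_le mF PF.
exists (~` (U `|` G)); split.
- by apply: measurableC; exact: measurableU.
- rewrite probability_setC; last exact: measurableU.
  rewrite EFinB; apply: leeB => //.
  apply: (le_trans (measureU2 _ mU mG)); rewrite EFinD; apply: leeD => //.
  apply: (le_trans PU); rewrite card_prod card_ffun !card_ord natrM natrX.
  by rewrite !mulrA.
move=> u /not_orP[nU nG]; apply: argmin_l1_loss => i.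
have nF ik : ~ F ik u.
  by move=> Fu; apply: nU; rewrite /U (bigD1 ik)//=; left.
have lt_margin k : 1 <= norm2 (@grid R d K k) -> margin < loss i (grid k) u.
  by move=> z1; have := nF (i, k); rewrite /F /= z1 => /negP; rewrite -ltNge.
apply: (total_loss_gt0 K0 lt_margin).
apply: le_trans Kc; rewrite ler_wpM2l ?divr_ge0// ler_pdivlMr// mulrC.
by move/negP: nG; rewrite -ltNge => /ltW.
Qed.

End recovery_probability.

(** * Arithmetic of the sample size *)

Section sample_size.
Context {R : realType}.
Implicit Types (B L X delta u v p tau sigma lambda : R) (d T K : nat).

(** Here [2 K + 1 <= 2^27 B^5 <= exp (27 + 5 L) <= exp (32 L)]. *)
Lemma grid_card_le d K B L : 1 <= B -> 1 <= L -> B <= expR L ->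
  K%:R <= 4096 * 4096 * B ^+ 5 + 1 -> (2 * K).+1%:R ^+ d <= expR (32 * (d%:R * L)).
Proof.
move=> B1 L1 BL KB.
have B50 : 0 <= B ^+ 5 by rewrite exprn_ge0// (le_trans ler01).
have B51 : 1 <= B ^+ 5 by rewrite exprn_ege1.
have -> : 32 * (d%:R * L) = (32 * L) * d%:R by ring.
rewrite expRM_natr lerXn2r ?nnegrE ?ler0n ?expR_ge0//.
have e2 : 2 <= expR (1 : R) by have := expR_ge1Dx (1 : R).
have e27 : 2 ^+ 27 <= expR (27 : R).
  rewrite -[X in expR X]mul1r expRM_natr lerXn2r ?nnegrE ?expR_ge0//.
have eL5 : B ^+ 5 <= expR (L * 5%:R).
  by rewrite expRM_natr lerXn2r ?nnegrE ?expR_ge0// (le_trans ler01).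
apply: (@le_trans _ _ (2 ^+ 27 * B ^+ 5)).
  have -> : 2 ^+ 27 = 8 * (4096 * 4096) :> R by ring.
  by rewrite -natr1 natrM; move: (B ^+ 5) B51 KB => b b1 kb; lra.
apply: (@le_trans _ _ (expR 27 * expR (L * 5%:R))).
  by rewrite ler_pM// exprn_ge0.
by rewrite -expRD ler_expR; lra.
Qed.

(** The factor 8 costs [3 L], the factor [d / delta] costs [L], and the grid costs [32 d L]:
    [36 d L] in all, within the assumed [37 d L]. *)
Lemma failure_le d K B L X delta : (0 < d)%N -> 0 < delta -> 1 <= B -> 1 <= L ->
  B <= expR L -> K%:R <= 4096 * 4096 * B ^+ 5 + 1 -> d%:R / delta <= B ->
  37 * (d%:R * L) <= X ->
  d%:R * (2 * K).+1%:R ^+ d * (4 * expR (- X)) <= delta / 2.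
Proof.
move=> d0 de0 B1 L1 BL KB dB LX.
have d1 : 1 <= d%:R :> R by rewrite ler1n.
have dL : L <= d%:R * L by rewrite ler_peMl// (le_trans ler01).
have N0 : 0 <= (2 * K).+1%:R ^+ d :> R by rewrite exprn_ge0.
have NL := grid_card_le d B1 L1 BL KB.
set N := _ ^+ d in N0 NL *.
have e8 : 8 <= expR (3 * L).
  apply: (@le_trans _ _ (expR 3)); last by rewrite ler_expR; lra.
  have e2 : 2 <= expR (1 : R) by have := expR_ge1Dx (1 : R).
  have -> : 3 = 1 * 3%:R :> R by rewrite mul1r.
  rewrite expRM_natr (_ : 8 = 2 ^+ 3); last by ring.
  by rewrite lerXn2r ?nnegrE ?expR_ge0.
have dd : d%:R <= delta * expR L.
  by rewrite mulrC -ler_pdivrMr// (le_trans dB).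
have : 8 * (d%:R * N) <= delta * expR X.
  apply: (@le_trans _ _ (expR (3 * L) * (delta * expR L * expR (32 * (d%:R * L))))).
    rewrite ler_pM// ?mulr_ge0//; by rewrite ler_pM.
  rewrite mulrCA -!mulrA ler_pM2l// mulrCA mulrA -!expRD ler_expR.
  by move: (d%:R * L) dL LX => a; lra.
have -> : d%:R * N * (4 * expR (- X)) = 8 * (d%:R * N) * expR (- X) / 2 by field.
rewrite ler_pM2r ?invr_gt0// expRN ler_pdivrMr ?expR_gt0//.
Qed.

(** The margin is of order [u p lambda T / tau^4] and the error of order
    [d^2 tau lambda p T / (K delta v)]. So [K] of order [d^2 tau^5 / (delta u v)] is needed, and
    [B^5] is the power of [B] that covers [tau^5]. *)
Lemma margin_ge d T K (p sigma lambda delta rho B : R) :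
  let u := 1 - p in let v := 1 - rho in let s := 2 * sigma in
  (0 < d)%N -> (0 < T)%N -> 0 < p < 1 -> 0 < sigma -> 0 < lambda ->
  0 < delta <= 1 -> 0 <= rho < 1 ->
  B = d%:R * (sigma / lambda) / (delta * u * v) ->
  4096 * 4096 * B ^+ 5 <= K%:R -> 0 < K%:R :> R ->
  d%:R / K%:R * (d%:R * (s * 2) * (2 * (p * T%:R)) * 2 / delta / v) <=
    loss_margin T p s lambda.
Proof.
move=> u v s d0 T0 /andP[p0 p1] sg0 l0 /andP[de0 de1] /andP[rh0 rh1] BE BK K0.
have u0 : 0 < u by rewrite subr_gt0.
have v0 : 0 < v by rewrite subr_gt0.
have d1 : 1 <= d%:R :> R by rewrite ler1n.
have dp : 0 < d%:R :> R by rewrite ltr0n.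
have Tp : 0 < T%:R :> R by rewrite ltr0n.
have [tau tE] : exists tau, tau = sigma / lambda by eexists.
have t0 : 0 < tau by rewrite tE divr_gt0.
have sE : sigma = tau * lambda by rewrite tE; field; rewrite gt_eqF.
have [e eE] : exists e, e = delta * u * v by eexists.
have e0 : 0 < e by rewrite eE !mulr_gt0.
have e1 : e <= 1.
  have u1 : u <= 1 by rewrite /u gerBl ltW.
  have v1 : v <= 1 by rewrite /v gerBl.
  have du0 : 0 <= delta * u by rewrite mulr_ge0 ?(ltW de0) ?(ltW u0).
  by rewrite eE mulr_ile1 ?(ltW v0)// mulr_ile1 ?(ltW de0) ?(ltW u0).
have -> : loss_margin T p s lambda =
    u * p * lambda * T%:R / tau ^+ 4 / (4096 * 4096) * 16.
  by rewrite /loss_margin /s sE -/u; field; rewrite !gt_eqF.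
rewrite mulrAC ler_pdivrMr//.
apply: (@le_trans _ _ (u * p * lambda * T%:R / tau ^+ 4 / (4096 * 4096) * 16 *
    (4096 * 4096 * B ^+ 5))); last first.
  by rewrite ler_pM2l; [exact: BK|pos].
have -> : u * p * lambda * T%:R / tau ^+ 4 / (4096 * 4096) * 16 *
    (4096 * 4096 * B ^+ 5) =
    16 * p * lambda * T%:R * tau * u * ((d%:R / e) ^+ 5).
  by rewrite BE -tE -eE; field; rewrite !gt_eqF.
have -> : d%:R * (d%:R * (s * 2) * (2 * (p * T%:R)) * 2 / delta / v) =
   16 * p * lambda * T%:R * tau * u * (d%:R ^+ 2 / e).
  by rewrite /s sE eE; field; rewrite !gt_eqF.
rewrite ler_pM2l; last by pos.
rewrite expr_div_n; apply: ler_pM.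
- exact: exprn_ge0.
- by rewrite invr_ge0 ltW.
- by rewrite ler_weXn2l.
- by rewrite lef_pV2 ?posrE ?exprn_gt0// -[leRHS]expr1 ler_wiXn2l// ltW.
Qed.

(** Taking [s = 2 sigma] costs [2^10 = 1024] in the tenth power, and the midpoint [(rho + 1) / 2]
    halves [1 - rho], which costs 4. The other factors of [C] are those of [loss_exponent] and the
    37 of [failure_le]. *)
Lemma loss_exponent_ge d T (p sigma lambda rho L C : R) :
  let u := 1 - p in let v := 1 - rho in let tau := sigma / lambda in
  (0 < d)%N -> 0 < p < 1 -> 0 < sigma -> 0 < lambda -> 0 <= rho < 1 ->
  C = 37 * (4 * 1024) * (4096 * 4096) * 8192 ->
  C * (d%:R * tau ^+ 10 / (p * u ^+ 2 * v ^+ 2)) * L <= T%:R ->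
  37 * (d%:R * L) <= loss_exponent T p (2 * sigma) lambda ((rho + 1) / 2).
Proof.
move=> u v tau d0 /andP[p0 p1] sg0 l0 /andP[rh0 rh1] CE CT.
have u0 : 0 < u by rewrite subr_gt0.
have v0 : 0 < v by rewrite subr_gt0.
have t0 : 0 < tau by rewrite divr_gt0.
have -> : loss_exponent T p (2 * sigma) lambda ((rho + 1) / 2) =
   T%:R * (p * u ^+ 2 * v ^+ 2 / tau ^+ 10) / (4 * 1024) / (4096 * 4096) / 8192.
  by rewrite /loss_exponent /tau -/u /v; field; rewrite !gt_eqF.
do 3![rewrite ler_pdivlMr; last by pos].
rewrite -ler_pdivrMr; last by pos.
apply: le_trans CT; rewrite CE le_eqVlt; apply/orP; left; apply/eqP.
by field; rewrite !gt_eqF.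
Qed.

Lemma loss_exponent_le T (p s lambda r : R) : 0 < p < 1 -> 0 < r < 1 ->
  0 < lambda -> lambda <= s -> loss_exponent T p s lambda r <= p * T%:R.
Proof.
move=> /andP[p0 p1] /andP[r0 r1] l0 ls; have s0 : 0 < s by exact: lt_le_trans ls.
have q0 : 0 <= lambda / s by rewrite divr_ge0// ltW.
have q1 : lambda / s <= 1 by rewrite ler_pdivrMr// mul1r.
have p1' : 0 <= 1 - p by rewrite subr_ge0 ltW.
have r1' : 0 <= 1 - r by rewrite subr_ge0 ltW.
have W0 : 0 <= (1 - p) ^+ 2 * (1 - r) ^+ 2 * (lambda / s) ^+ 10.
  by apply: mulr_ge0; [apply: mulr_ge0|]; exact: exprn_ge0.
have W1 : (1 - p) ^+ 2 * (1 - r) ^+ 2 * (lambda / s) ^+ 10 <= 1.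
  rewrite mulr_ile1 ?exprn_ge0 ?exprn_ile1// ?mulr_ge0 ?exprn_ge0//.
  by rewrite mulr_ile1 ?exprn_ge0 ?exprn_ile1// gerBl ltW.
have pT0 : 0 <= p * T%:R by rewrite mulr_ge0// ltW.
have lin (a b : R) : 0 <= a -> a <= b -> a / (4096 * 4096) / 8192 <= b by lra.
by apply: lin; [exact: mulr_ge0|rewrite ler_piMr].
Qed.

End sample_size.

Theorem theorem2 (R : realType) :
  exists C : R, 0 < C /\
  forall (d0 : measure_display) (Omega : measurableType d0)
    (P : probability Omega R) (d T : nat) (Astar : 'M[R]_d)
    (x0 : Omega -> 'cV[R]_d) (w : nat -> Omega -> 'cV[R]_d)
    (attack : nat -> set Omega) (p sigma lambda delta : R),
  (0 < d)%N ->
  measurable_fun [set: Omega] x0 ->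
  (forall t, (t < T)%N -> measurable_fun [set: Omega] (w t)) ->
  0 < p < 1 -> 0 < sigma -> 0 < lambda -> 0 < delta <= 1 ->
  opnorm2 Astar < 1 ->
  max_sub_gaussian P x0 w attack T sigma ->
  probabilistic_attack P x0 w attack T p ->
  non_degenerate P x0 w attack T lambda ->
  sign_restricted P x0 w attack T ->
  let tau := sigma / lambda in
  C * (d%:R * Num.max 1 (tau ^+ 10)
       / (p * (1 - p) ^+ 2 * (1 - opnorm2 Astar) ^+ 2))
    * Num.max 1 (ln (d%:R * tau / (delta * (1 - p) * (1 - opnorm2 Astar))))
    <= T%:R ->
  exists E : set Omega,
    [/\ measurable E, ((1 - delta)%:E <= P E)%E
      & forall omega, E omega ->
          argmin (l1_loss x0 w Astar T omega) = [set Astar]].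
Proof.
have [C CE] : exists C : R, C = 37 * (4 * 1024) * (4096 * 4096) * 8192 by eexists.
have C0 : 0 < C by rewrite CE; pos.
exists C; split => // d0 Omega P d T A x0 w attack p sigma lambda delta dpos mx0 mw
  p01 sg0 l0 de01 A1 subP attP ndP signP tau CT.
have /andP[p0 p1] := p01; have /andP[de0 de1] := de01.
pose rho := opnorm2 A; rewrite -/rho in A1 CT.
have rho0 : 0 <= rho by exact: opnorm2_ge0.
have u0 : 0 < 1 - p by rewrite subr_gt0.
have v0 : 0 < 1 - rho by rewrite subr_gt0.
have t0 : 0 < tau by rewrite divr_gt0.
have dp : 0 < d%:R :> R by rewrite ltr0n.
have d1 : 1 <= d%:R :> R by rewrite ler1n.
pose B := d%:R * tau / (delta * (1 - p) * (1 - rho)); rewrite -/B in CT.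
pose L := Num.max 1 (ln B); rewrite -/L in CT.
have L1 : 1 <= L by rewrite /L le_max lexx.
have T0 : (0 < T)%N.
  rewrite -(ltr_nat R); apply: lt_le_trans CT.
  have m0 : 0 < Num.max 1 (tau ^+ 10) by rewrite lt_max ltr01.
  have L0 : 0 < L by exact: lt_le_trans L1.
  by pos.
(* [lambda_le_s] gives [lambda <= s] for every [s > sigma]; the midpoint of a supposed gap
   contradicts it. Hence [tau >= 1] and the maximum with 1 disappears. *)
have ls : lambda <= sigma.
  rewrite leNgt; apply/negP => sl; pose s := (sigma + lambda) / 2.
  have /andP[ss s_lt] : (sigma < s) && (s < lambda).
    by rewrite /s; have [-> ->] := midf_lt sl.
  have := lambda_le_s mx0 mw p01 sg0 ss l0 subP attP ndP T0
    (norm2_delta (Ordinal dpos)).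
  by rewrite leNgt s_lt.
have t1 : 1 <= tau by rewrite /tau ler_pdivlMr// mul1r.
have tm : Num.max 1 (tau ^+ 10) = tau ^+ 10.
  by apply/max_idPr; exact: exprn_ege1.
rewrite tm in CT.
have e1 : (1 - p) * (1 - rho) <= 1.
  by rewrite mulr_ile1 ?(ltW u0) ?(ltW v0) ?gerBl ?(ltW p0).
have dB : d%:R / delta <= B.
  have -> : B = d%:R / delta * (tau / ((1 - p) * (1 - rho))).
    by rewrite /B; field; rewrite !gt_eqF.
  rewrite ler_peMr ?divr_ge0 ?(ltW de0)// ler_pdivlMr ?mulr_gt0// mul1r.
  exact: le_trans t1.
have B1 : 1 <= B.
  apply: le_trans dB; rewrite ler_pdivlMr// mul1r.
  exact: le_trans d1.
have B0 : 0 < B by exact: lt_le_trans B1.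
have BL : B <= expR L by rewrite -[leLHS]lnK ?posrE// ler_expR /L le_max lexx orbT.
have LX := loss_exponent_ge dpos p01 sg0 l0 (introT andP (conj rho0 A1)) CE CT.
(* Strictly between 0 and 1 even when [rho = 0], and [1 - r] is comparable to [1 - rho]. *)
pose r := (rho + 1) / 2.
have [rho_r r1] : rho < r /\ r < 1 by have [] := midf_lt A1.
have r01 : 0 < r < 1 by rewrite r1 (le_lt_trans rho0).
have ss : sigma < 2 * sigma by rewrite ltr_pMl// ltr1n.
have ls2 : lambda <= 2 * sigma := le_trans ls (ltW ss).
(* The exponent is at least [37 d L >= 1] and at most [p T]. This gives [T > 1] and, in the Markov
   bound, [1 + p T <= 2 p T]. *)
have pT : 1 <= p * T%:R.
  apply: le_trans (loss_exponent_le T p01 r01 l0 ls2); apply: le_trans LX.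
  by rewrite mulr_ege1 ?ler1n// mulr_ege1.
have T1 : (1 < T)%N.
  rewrite -(ltr_nat R); apply: le_lt_trans pT _.
  by rewrite gtr_pMl// ltr0n.
have Ar : opnorm2 A <= r := ltW rho_r.
have ceil (y : R) : 0 <= y -> exists K : nat,
    [/\ (0 < K)%N, K%:R <= y + 1 & y <= K%:R].
  move=> y0; exists (Num.trunc y).+1; have /andP[K1 /ltW K2] := truncn_itv y0.
  by split => //; rewrite -natr1 lerD2r.
have B5 : 0 <= 4096 * 4096 * B ^+ 5 by apply: ltW; pos.
have [K [K0 KB BK]] := ceil _ B5.
have K0' : 0 < K%:R :> R by rewrite ltr0n.
(* The mean from [mean_norm2], with [1 + p T] replaced by [2 p T], divided by [delta / 2]: Markov's
   inequality then spends half of the failure probability. *)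
pose c := d%:R * (2 * sigma * 2) * (2 * (p * T%:R)) * 2 / delta.
have Tp : 0 < T%:R :> R by rewrite ltr0n.
have c0 : 0 < c by rewrite /c; pos.
have Kc : d%:R / K%:R * (c / (1 - opnorm2 A)) <= loss_margin T p (2 * sigma) lambda.
  exact: (margin_ge dpos T0 p01 sg0 l0 de01 (introT andP (conj rho0 A1)) erefl
    BK K0').
have [E [mE PE EA]] := recovery_probability mx0 mw p01 sg0 ss l0 subP attP ndP
  signP T1 ls2 K0 c0 A1 r01 Ar Kc.
exists E; split => //; apply: le_trans PE; rewrite lee_fin lerD2l lerN2.
rewrite [leRHS](splitr delta); apply: lerD.
  exact: (failure_le dpos de0 B1 L1 BL KB dB LX).
rewrite ler_pdivrMr// /c.
have -> : delta / 2 * (d%:R * (2 * sigma * 2) * (2 * (p * T%:R)) * 2 / delta) =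
    d%:R * (2 * sigma * 2) * (2 * (p * T%:R)).
  by field; rewrite gt_eqF.
rewrite ler_pM2l; last by pos.
by rewrite [leRHS]mulr_natl mulr2n lerD2r.
Qed.
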